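(* Let $N>4$. For all $u\in C_0^\infty(\mathbb{H}^N)$ there holds $$\int_{\mathbb{H}^{N}} (\Delta_{\mathbb{H}^{N}} u)^{2} \, dv_{\mathbb{H}^{N}} - \left( \frac{N-1}{2} \right)^{2} \int_{\mathbb{H}^{N}} |\nabla_{\mathbb{H}^{N}} u|^2 \, dv_{\mathbb{H}^{N}} \geq \frac{(N-1)^2}{16} \int_{\mathbb{H}^{N}} \frac{u^2}{r^2} \, dv_{\mathbb{H}^{N}} + \frac{9}{16} \int_{\mathbb{H}^{N}} \frac{u^2}{r^4} \, dv_{\mathbb{H}^{N}}$$ $$+\frac{(N-1)(N-3)(N^2 -2N - 7)}{16} \int_{\mathbb{H}^{N}} \frac{u^2}{\sinh^2 r} \, dv_{\mathbb{H}^{N}} +\frac{(N-1)(N-3)(N^2-4N-3)}{16} \int_{\mathbb{H}^{N}} \frac{u^2}{\sinh^4 r} \, dv_{\mathbb{H}^{N}}.$$ The constant $\left( \frac{N-1}{2} \right)^{2}$ is sharp by construction, namely it cannot be replaced by a larger one.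
   Context: $\mathbb{H}^N$ is the $N$-dimensional hyperbolic space (constant sectional curvature $-1$), $dv_{\mathbb{H}^N}$ its Riemannian volume measure, $\nabla_{\mathbb{H}^N}$ the Riemannian gradient and $\Delta_{\mathbb{H}^N}$ the Laplace-Beltrami operator. A pole $x_0\in\mathbb{H}^N$ is fixed and $r:=\varrho(x,x_0)$ is the geodesic distance from $x$ to $x_0$. $C_0^\infty(\mathbb{H}^N)$ denotes the smooth compactly supported real functions on $\mathbb{H}^N$. *)

(* Defs.v *)
From HB Require Import structures.
From mathcomp Require Import all_boot all_order all_algebra.
From mathcomp Require Import all_classical all_reals all_analysis.

Set Implicit Arguments.
Unset Strict Implicit.
Unset Printing Implicit Defensive.

Import Order.TTheory GRing.Theory Num.Theory.
Import numFieldNormedType.Exports.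

Local Open Scope classical_set_scope.
Local Open Scope ring_scope.

(* Lebesgue measure on R^n, seen as n.-tuple R with its product sigma-algebra:
   the n-fold product of the Lebesgue measure of R.                          *)
Section tuple_cons.
Context d (T : measurableType d) (n : nat).

Definition tuple_cons (p : T * n.-tuple T) : n.+1.-tuple T :=
  [tuple of p.1 :: p.2].

Definition tuple_uncons (t : n.+1.-tuple T) : T * n.-tuple T :=
  (thead t, [tuple of behead t]).

Lemma tuple_consK : cancel tuple_cons tuple_uncons.
Proof. by move=> [x t]; congr pair; apply/val_inj. Qed.

Lemma measurable_tuple_cons : measurable_fun setT tuple_cons.
Proof. exact: (measurable_cons measurable_fst measurable_snd). Qed.

Lemma measurable_tuple_uncons : measurable_fun setT tuple_uncons.
Proof.
apply/measurable_fun_pairP; split; last exact: measurable_behead.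
exact: measurable_tnth.
Qed.

End tuple_cons.

Section measure_cons.
Context d (T : measurableType d) (R : realType) (n : nat).
Context (mu : {sigma_finite_measure set T -> \bar R}).
Context (m : {sigma_finite_measure set (n.-tuple T) -> \bar R}).

Definition measure_cons : set (n.+1.-tuple T) -> \bar R :=
  pushforward (mu \x m)%E (@tuple_cons _ T n).

Let measure_cons0 : measure_cons set0 = 0%E.
Proof. by rewrite /measure_cons /pushforward preimage_set0 measure0. Qed.

Let measure_cons_ge0 A : (0 <= measure_cons A)%E.
Proof.
rewrite /measure_cons /pushforward; exact: measure_ge0.
Qed.

Let measure_cons_sigma_additive : semi_sigma_additive measure_cons.
Proof.
have mcons A : measurable A -> measurable (@tuple_cons _ T n @^-1` A).
  by move=> mA; rewrite -[X in measurable X]setTI; exact: measurable_tuple_cons.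
move=> F mF tF mUF; rewrite /measure_cons /pushforward preimage_bigcup.
apply: measure_semi_sigma_additive; first by move=> k; exact: mcons.
  apply/trivIsetP => i j Di Dj ij; rewrite -preimage_setI.
  by move/trivIsetP : tF => /(_ _ _ Di Dj ij) ->; rewrite preimage_set0.
by rewrite -preimage_bigcup; exact: mcons.
Qed.

HB.instance Definition _ := isMeasure.Build _ _ _ measure_cons
  measure_cons0 measure_cons_ge0 measure_cons_sigma_additive.

Let measure_cons_sigma_finite : sigma_finite setT measure_cons.
Proof.
have /sigma_finiteP[F [FT ndF Foo]] := sigma_finiteT mu.
have /sigma_finiteP[G [GT ndG Goo]] := sigma_finiteT m.
exists (fun k => @tuple_uncons _ T n @^-1` (F k `*` G k)).
  rewrite -preimage_bigcup -[LHS](preimage_setT (@tuple_uncons _ T n)).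
  congr (_ @^-1` _); rewrite -setXTT FT GT predeqE => -[x y]; split.
    move=> [/= [i _ Fx] [j _ Gy]]; exists (maxn i j) => //; split.
    - by move: x Fx; exact/subsetPset/ndF/leq_maxl.
    - by move: y Gy; exact/subsetPset/ndG/leq_maxr.
  by move=> [i _ []/= ? ?]; split; exists i.
move=> k; have [mF Flty] := Foo k; have [mG Glty] := Goo k; split.
  rewrite -[X in measurable X]setTI; apply: measurable_tuple_uncons => //.
  exact: measurableX.
rewrite /measure_cons /pushforward -comp_preimage.
rewrite (_ : _ \o _ = id); last by apply/funext => p; exact: tuple_consK.
by rewrite preimage_id product_measure1E// lte_mul_pinfty// ge0_fin_numE.
Qed.

HB.instance Definition _ :=
  Measure_isSigmaFinite.Build _ _ _ measure_cons measure_cons_sigma_finite.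

End measure_cons.

Fixpoint lebesgue_tuple (R : realType) (n : nat) :
    {sigma_finite_measure set (n.-tuple (measurableTypeR R)) -> \bar R} :=
  match n with
  | 0 => \d_ ([tuple] : 0.-tuple (measurableTypeR R))
  | n'.+1 => measure_cons lebesgue_measure (lebesgue_tuple R n')
  end.

Definition sinh {R : realType} (t : R) : R := (expR t - expR (- t)) / 2.

(* Riemannian geometry of an open set U of R^n, seen as a manifold with a
   single global chart; a metric is given by its Gram matrices G x = (g_ij x).
   Tangent vectors are row vectors.                                           *)
Section riemannian_chart.
Context {R : realType} {n : nat}.
Local Notation point := 'rV[R]_n.
Implicit Types (U : set point) (G : point -> 'M[R]_n) (u f : point -> R).

Definition partial (i : 'I_n) u : point -> R :=
  fun x => 'D_(delta_mx 0 i) u x.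

(* C^oo: all the iterated partial derivatives exist and are differentiable. *)
Definition smooth_on U u : Prop :=
  forall (s : seq 'I_n) x, U x -> differentiable (foldr partial u s) x.

Definition support u : set point := closure [set x | u x != 0].

(* C_0^oo(U); u vanishes off U, so it is the extension by zero of a function
   on U.                                                                      *)
Definition test_function U u : Prop :=
  [/\ smooth_on U u, compact (support u) & support u `<=` U].

Definition inner G (x v w : point) : R := (v *m G x *m w^T) 0 0.

Definition vol_density G (x : point) : R := Num.sqrt (\det (G x)).

(* (grad u)^j = \sum_i g^ij \partial_i u *)
Definition grad G u : point -> point :=
  fun x => (\row_i partial i u x) *m invmx (G x).

Definition divergence G (X : point -> point) : point -> R :=
  fun x => (vol_density G x)^-1 *
    \sum_i partial i (fun y => vol_density G y * X y 0 i) x.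

Definition laplace_beltrami G u : point -> R := divergence G (grad G u).

Definition point_of_tuple (t : n.-tuple (measurableTypeR R)) : point :=
  \row_i tnth t i.

Definition vol_integral U G f : \bar R :=
  (\int[lebesgue_tuple R n]_(t in point_of_tuple @^-1` U)
    (f (point_of_tuple t) * vol_density G (point_of_tuple t))%:E)%E.

(* C^1 curves in U from x to y, parametrized by [0, 1]; as usual a C^1 curve
   on [0, 1] is given as a C^1 map on R, of which only the restriction to
   [0, 1] matters.  Piecewise C^1 curves would give the same infimum of lengths. *)
Definition curve U (x y : point) (c : R -> point) : Prop :=
  [/\ (forall t, derivable c t 1), continuous (derive1 c),
      c 0 = x, c 1 = y & forall t, 0 <= t <= 1 -> U (c t)].

Definition curve_length G (c : R -> point) : R :=
  \int[lebesgue_measure]_(t in `[0, 1]%classic)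
    Num.sqrt (inner G (c t) (derive1 c t) (derive1 c t)).

Definition geodesic_dist U G (x y : point) : R :=
  inf [set curve_length G c | c in curve U x y].

End riemannian_chart.

(* The hyperbolic space H^N in the Poincare ball model: the Euclidean unit ball
   with the metric (2 / (1 - |x|^2))^2 |dx|^2, of sectional curvature -1.  The
   norm of the library on row vectors is the sup norm, hence sqnorm.          *)
Section hyperbolic_space.
Context {R : realType} {N : nat}.
Local Notation point := 'rV[R]_N.
Implicit Types (x : point) (u f : point -> R).

Definition sqnorm x : R := \sum_i x 0 i ^+ 2.

Definition Hspace : set point := [set x | sqnorm x < 1].

Definition Hmetric x : 'M[R]_N := ((2 / (1 - sqnorm x)) ^+ 2)%:M.

Definition Hdist : point -> point -> R := geodesic_dist Hspace Hmetric.

Definition Hlaplace u : point -> R := laplace_beltrami Hmetric u.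

(* |grad u|^2, in the hyperbolic metric *)
Definition Hgrad2 u : point -> R :=
  fun x => inner Hmetric x (grad Hmetric u x) (grad Hmetric u x).

Definition Hint f : \bar R := vol_integral Hspace Hmetric f.

End hyperbolic_space.

Section poincare_rellich.
Context {R : realType} {N : nat}.
Implicit Types (u : 'rV[R]_N -> R).
Local Notation NR := (N%:R : R).

Definition rellich_lhs (c : R) u : \bar R :=
  (Hint (fun x => Hlaplace u x ^+ 2)%R - c%:E * Hint (Hgrad2 u))%E.

Definition rellich_rhs (x0 : 'rV[R]_N) u : \bar R :=
  let r x := Hdist x x0 in
  (((NR - 1) ^+ 2 / 16)%:E * Hint (fun x => u x ^+ 2 / r x ^+ 2)%R
   + (9 / 16)%:E * Hint (fun x => u x ^+ 2 / r x ^+ 4)%R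
   + ((NR - 1) * (NR - 3) * (NR ^+ 2 - 2 * NR - 7) / 16)%:E
     * Hint (fun x => u x ^+ 2 / sinh (r x) ^+ 2)%R
   + ((NR - 1) * (NR - 3) * (NR ^+ 2 - 4 * NR - 3) / 16)%:E
     * Hint (fun x => u x ^+ 2 / sinh (r x) ^+ 4)%R)%E.

End poincare_rellich.

(* Main.v *)
(* Write D for the distance to the pole, S = sinh D, k = (N-1)/2, m = k^2 - k,
   Z for the radial derivative and L = Z + k coth D, which is antisymmetric for
   the volume measure.  The radial part of the Laplacian is
   R u = L (L u) - (k^2 + m / S^2) u, and (Delta u)^2 >= 2 (Delta u) (R u) - (R u)^2.
   Integrating by parts, the integral of (Delta u) (R u) splits into that of
   (R u)^2 and an angular term, bounded below by a completion of squares based on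
   Z (q) = q(Z u, .) + q(., Z u) - 2 coth D q for the angular form q.  What remains,
   the integral of (R u)^2 - k^2 (Z u)^2, equals up to exact radial derivatives
   the four weights times u^2 plus the squares of L (L u) - L u / (2 D),
   L u - 3 u / (2 D), L u - u / (2 D) and L u - (coth D + 1 / (2 D)) u with
   nonnegative coefficients, where only S >= D is used.  This is proved for u
   supported off the pole; in general u is multiplied by a cutoff at scale e,
   which changes the integrals by O(e^(N-4)), and Fatou's lemma concludes.

   For c > k^2 take u = S^(-k) Phi(D / l - a / l) with Phi a plateau of length 3:
   the derivatives of Phi cost O(1 / l^2) whereas (c - k^2) k^2 u^2 is lost on the
   plateau, so that for large l and a the left-hand side is negative while the
   right-hand side is nonnegative. *)

Require Import Defs.
From HB Require Import structures.
From mathcomp Require Import all_boot all_order all_algebra.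
From mathcomp Require Import all_classical all_reals all_analysis.
From mathcomp Require Import measurable_realfun.
From mathcomp Require Import ring lra.
Import Order.TTheory GRing.Theory Num.Theory.
Import numFieldNormedType.Exports.

Set Implicit Arguments.
Unset Strict Implicit.
Unset Printing Implicit Defensive.

Local Open Scope classical_set_scope.
Local Open Scope ring_scope.

(** All radial calculus takes place in the Cartesian coordinates of the ball. The gradient of cosh D
    is there a polynomial field whose Jacobian is a multiple of the identity plus an antisymmetric
    matrix; it is conformal for the hyperbolic metric. Its divergence N cosh D gives the
    antisymmetry of L, and its action on the metric gives the derivative of the angular form. The
    bound of (Delta u)^2 by 2 (Delta u) (R u) - (R u)^2 does the work of a decomposition into
    spherical modes: it needs only the pairing of Delta u with R u, which Green's formula provides.
    The obstacle is the pole, where D is not smooth and the weights blow up. A cutoff at scale e has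
    second derivatives of size 1 / e^2; their squares, integrated over a volume of size e^N, tend to
    0 because N > 4. The same hypothesis reads k >= 2, which makes the weights and the angular
    remainder nonnegative. The distance of the statement is an infimum over curves. It is bounded
    below by the closed form D, and the integrals that contain it are compared by a monotonicity
    that holds without measurability. *)

Lemma differentiable_near {R : numFieldType} (V W : normedModType R) (f g : V -> W) (x : V) :
  (\near x, f x = g x) -> differentiable f x -> differentiable g x.
Proof.
move=> fg df.
have fgx : f x = g x := nbhs_singleton fg.
have cf : continuous ('d f x) by exact: diff_continuous.
have [_ /eqaddoP fo] := (diff_locallyP x f).1 df.
have go : g \o shift x = cst (g x) + 'd f x +o_ (0 : V) id.
  have fg0 : \forall y \near (0 : V), f (y + x) = g (y + x).
    by move: fg; rewrite (near_shift 0 x) subr0.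
  apply/eqaddoP => e e0; move: fg0 (fo e e0); apply: filterS2 => y /= fgy.
  by rewrite !fctE /= -fgx -fgy.
apply/diff_locallyP; rewrite (diff_unique cf go); split => //.
Qed.

(** * Partial derivatives and smooth functions on an open set of R^n *)

Section partial_calculus.
Context {R : realType} {n : nat}.
Local Notation point := 'rV[R]_n.
Implicit Types (U : set point) (u v f g : point -> R) (x : point) (i j : 'I_n).

Lemma partial_near f g x i : (\near x, f x = g x) -> partial i f x = partial i g x.
Proof. exact: near_eq_derive. Qed.

Lemma partialD f g x i : differentiable f x -> differentiable g x ->
  partial i (fun y => f y + g y) x = partial i f x + partial i g x.
Proof. by move=> df dg; rewrite /partial (deriveD (f := f) (g := g))//; exact: diff_derivable. Qed.

Lemma partialB f g x i : differentiable f x -> differentiable g x ->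
  partial i (fun y => f y - g y) x = partial i f x - partial i g x.
Proof. by move=> df dg; rewrite /partial (deriveB (f := f) (g := g))//; exact: diff_derivable. Qed.

Lemma partialN f x i : differentiable f x ->
  partial i (fun y => - f y) x = - partial i f x.
Proof. by move=> df; rewrite /partial (deriveN (f := f))//; exact: diff_derivable. Qed.

Lemma partialM f g x i : differentiable f x -> differentiable g x ->
  partial i (fun y => f y * g y) x = partial i f x * g x + f x * partial i g x.
Proof.
move=> df dg; rewrite /partial (deriveM (f := f) (g := g)); try exact: diff_derivable.
by rewrite addrC; congr (_ + _); rewrite mulrC.
Qed.

Lemma partial_cst c x i : partial i (fun=> c) x = 0.
Proof. by rewrite /partial; exact: derive_cst. Qed.

Lemma partialZ c f x i : differentiable f x ->
  partial i (fun y => c * f y) x = c * partial i f x.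
Proof.
by move=> df; rewrite partialM// partial_cst mul0r add0r.
Qed.

Lemma partialV f x i : differentiable f x -> f x != 0 ->
  partial i (fun y => (f y)^-1) x = - (partial i f x / f x ^+ 2).
Proof.
move=> df f0; rewrite /partial deriveV//; last exact: diff_derivable.
by rewrite scaleNr mulrC.
Qed.

Lemma partial_coord x i j : partial i (fun y : point => y 0 j) x = (i == j)%:R.
Proof.
rewrite /partial deriveE; last exact: differentiable_coord.
have @f : {linear point -> R}.
  by exists (fun y : point => y 0 j); do 2![eexists]; do ?[constructor];
     rewrite ?mxE// => ? *; rewrite ?mxE//; move=> ?; rewrite !mxE.
rewrite (_ : (fun y : point => y 0 j) = f)// diff_lin; last exact: coord_continuous.
by rewrite /f/= mxE eqxx eq_sym.
Qed.

Lemma differentiable_bigsum (I : Type) (r : seq I) (f : I -> point -> R) x :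
  (forall k, differentiable (f k) x) ->
  differentiable (fun y => \sum_(k <- r) f k y) x.
Proof.
move=> df; elim: r => [|k r IH].
  by under eq_fun do rewrite big_nil; exact: differentiable_cst.
under eq_fun do rewrite big_cons; exact: differentiableD.
Qed.

Lemma partial_sum (I : Type) (r : seq I) (f : I -> point -> R) x i :
  (forall k, differentiable (f k) x) ->
  partial i (fun y => \sum_(k <- r) f k y) x = \sum_(k <- r) partial i (f k) x.
Proof.
move=> df; elim: r => [|k r IH].
  by under eq_fun do rewrite big_nil; rewrite partial_cst big_nil.
under eq_fun do rewrite big_cons.
by rewrite partialD ?big_cons ?IH//; exact: differentiable_bigsum.
Qed.

Lemma partial_comp1 (g : R -> R) d f x : differentiable f x -> is_derive (f x) 1 g d ->
  differentiable (fun y => g (f y)) x /\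
  forall i, partial i (fun y => g (f y)) x = d * partial i f x.
Proof.
move=> df [gd gE].
have dg : differentiable g (f x) by exact/derivable1_diffP.
split; first exact: (differentiable_comp df dg).
move=> i; rewrite /partial !deriveE//; last exact: (differentiable_comp df dg).
rewrite (diff_comp df dg)/=.
have -> : 'd f x (delta_mx 0 i) = ('d f x (delta_mx 0 i)) *: (1:R) by rewrite -[RHS]/(_ * 1) mulr1.
by rewrite linearZ/= -(deriveE _ dg) gE -[LHS]/(_ * _) mulrC -[X in _ * X = _]mulr1.
Qed.

Lemma partial_open U f g x i : open U -> U x -> (forall y, U y -> f y = g y) ->
  partial i f x = partial i g x.
Proof.
move=> oU Ux fg; apply: partial_near.
by apply: filterS (open_nbhs_nbhs (conj oU Ux)) => y; exact: fg.
Qed.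

(** Finite-order form of [smooth_on]. Products and compositions are handled by induction on the
    order with the functions generalized, which a quantification over lists of directions does not
    offer. Level [k] asks that the derivatives of order at most [k] be differentiable. *)
Fixpoint times_diff U (k : nat) (f : point -> R) : Prop :=
  (forall x, U x -> differentiable f x) /\
  (if k is k'.+1 then forall i, times_diff U k' (partial i f) else True).

Lemma times_diff_differentiable U k f x : times_diff U k f -> U x -> differentiable f x.
Proof. by case: k => [|k] [+ _] => /[apply]. Qed.

Lemma times_diffW U k f : times_diff U k.+1 f -> times_diff U k f.
Proof.
elim: k f => [|k IH] f [df /= pf]; first by split.
by split => // i; apply: IH; exact: pf.
Qed.

Lemma times_diff_ext U k f g : open U -> (forall x, U x -> f x = g x) ->
  times_diff U k f -> times_diff U k g.
Proof.
move=> oU; have nfg h h' : (forall x, U x -> h x = h' x) ->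
    forall x, U x -> \near x, h x = h' x.
  by move=> hh x Ux; apply: filterS (open_nbhs_nbhs (conj oU Ux)).
elim: k f g => [|k IH] f g fg [df pf]; split => //.
- by move=> x Ux; apply: differentiable_near (df x Ux); exact: nfg.
- by move=> x Ux; apply: differentiable_near (df x Ux); exact: nfg.
- by move=> i; apply: IH (pf i) => x Ux; exact: partial_open Ux fg.
Qed.

Lemma times_diff_cst U k c : times_diff U k (fun=> c).
Proof.
elim: k c => [|k IH] c; split => //; try by move=> x _; exact: differentiable_cst.
move=> i; have -> : partial i (fun=> c) = fun=> 0 by apply/funext => x; exact: partial_cst.
exact: IH.
Qed.

Lemma times_diff_coord U k i : times_diff U k (fun x : point => x 0 i).
Proof.
case: k => [|k]; split => //; try by move=> x _; exact: differentiable_coord.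
move=> j; have -> : partial j (fun x : point => x 0 i) = fun=> (j == i)%:R.
  by apply/funext => x; exact: partial_coord.
exact: times_diff_cst.
Qed.

Lemma times_diffD U k f g : open U -> times_diff U k f -> times_diff U k g ->
  times_diff U k (fun x => f x + g x).
Proof.
move=> oU; elim: k f g => [|k IH] f g [df pf] [dg pg]; split => //;
  try by move=> x Ux; apply: differentiableD; [exact: df|exact: dg].
move=> i; apply: (@times_diff_ext _ _ (fun x => partial i f x + partial i g x)) => //.
  by move=> x Ux; rewrite partialD//; [exact: df|exact: dg].
by apply: IH; [exact: pf|exact: pg].
Qed.

Lemma times_diffM U k f g : open U -> times_diff U k f -> times_diff U k g ->
  times_diff U k (fun x => f x * g x).
Proof.
move=> oU; elim: k f g => [|k IH] f g sf sg; move: (sf) (sg) => [df pf] [dg pg]; split => //;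
  try by move=> x Ux; apply: differentiableM; [exact: df|exact: dg].
move=> i; apply: (@times_diff_ext _ _ (fun x => partial i f x * g x + f x * partial i g x)) => //.
  by move=> x Ux; rewrite partialM//; [exact: df|exact: dg].
apply: times_diffD => //; apply: IH; [exact: pf|exact: times_diffW|exact: times_diffW|exact: pg].
Qed.

(** Smoothness of the outer function is expressed by a family [Fam] closed under derivation on [I]:
    the chain rule yields a member of the family composed with [f], times a derivative of [f], and
    the induction applies to both factors. *)
Lemma times_diff_comp (I : set R) (Fam : (R -> R) -> Prop) U k f (g : R -> R) :
  (forall g : R -> R, Fam g -> exists2 h, Fam h & forall t, I t -> is_derive t 1 g (h t)) ->
  open U -> (forall x, U x -> I (f x)) -> Fam g ->
  times_diff U k f -> times_diff U k (fun x => g (f x)).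
Proof.
move=> Fd oU UI; elim: k g => [|k IH] g Fg sf; have [h Fh gh] := Fd _ Fg.
  split => // x Ux; have /= := partial_comp1 (times_diff_differentiable sf Ux) (gh _ (UI _ Ux)).
  by case.
split => [x Ux|i].
  by have [] := partial_comp1 (times_diff_differentiable sf Ux) (gh _ (UI _ Ux)).
apply: (@times_diff_ext _ _ (fun x => h (f x) * partial i f x)) => //.
  by move=> x Ux; have [_ ->] := partial_comp1 (times_diff_differentiable sf Ux) (gh _ (UI _ Ux)).
apply: times_diffM => //; last by case: sf => _; exact.
by apply: IH => //; exact: times_diffW.
Qed.

Lemma smooth_onP U f : smooth_on U f <-> forall k, times_diff U k f.
Proof.
split=> [sf k|sf s].
  elim: k f sf => [|k IH] f sf; split => //; try exact: (sf [::]).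
  move=> i; apply: IH => s x Ux; have := sf (rcons s i) x Ux.
  by rewrite foldr_rcons.
elim/last_ind: s f sf => [|s i IH] f sf x Ux; first exact: (times_diff_differentiable (sf 0%N) Ux).
by rewrite foldr_rcons; apply: IH => // k; case: (sf k.+1) => _; exact.
Qed.

Lemma smooth_on_diff U f x : smooth_on U f -> U x -> differentiable f x.
Proof. by move=> /(_ [::] x). Qed.

Lemma smooth_on_partial U f i : smooth_on U f -> smooth_on U (partial i f).
Proof. by move=> sf s x Ux; have := sf (rcons s i) x Ux; rewrite foldr_rcons. Qed.

Lemma smooth_on_ext U f g : open U -> (forall x, U x -> f x = g x) ->
  smooth_on U f -> smooth_on U g.
Proof. by move=> oU fg /smooth_onP sf; apply/smooth_onP => k; exact: times_diff_ext (sf k). Qed.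

Lemma smooth_on_sub U U' f : U' `<=` U -> smooth_on U f -> smooth_on U' f.
Proof. by move=> UU sf s x /UU; exact: sf. Qed.

Lemma smooth_on_cst U c : smooth_on U (fun=> c).
Proof. by apply/smooth_onP => k; exact: times_diff_cst. Qed.

Lemma smooth_on_coord U i : smooth_on U (fun x : point => x 0 i).
Proof. by apply/smooth_onP => k; exact: times_diff_coord. Qed.

Lemma smooth_onD U f g : open U -> smooth_on U f -> smooth_on U g ->
  smooth_on U (fun x => f x + g x).
Proof. by move=> oU /smooth_onP sf /smooth_onP sg; apply/smooth_onP => k; exact: times_diffD. Qed.

Lemma smooth_onM U f g : open U -> smooth_on U f -> smooth_on U g ->
  smooth_on U (fun x => f x * g x).
Proof. by move=> oU /smooth_onP sf /smooth_onP sg; apply/smooth_onP => k; exact: times_diffM. Qed.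

Lemma smooth_onN U f : open U -> smooth_on U f -> smooth_on U (fun x => - f x).
Proof.
move=> oU sf; apply: (@smooth_on_ext _ (fun x => -1 * f x)) => //.
  by move=> x _; rewrite mulN1r.
by apply: smooth_onM => //; exact: smooth_on_cst.
Qed.

Lemma smooth_onB U f g : open U -> smooth_on U f -> smooth_on U g ->
  smooth_on U (fun x => f x - g x).
Proof. by move=> oU sf sg; apply: smooth_onD => //; exact: smooth_onN. Qed.

Lemma smooth_onX U f k : open U -> smooth_on U f -> smooth_on U (fun x => f x ^+ k).
Proof.
move=> oU sf; elim: k => [|k IH]; first exact: smooth_on_cst.
by under eq_fun do rewrite exprS; exact: smooth_onM.
Qed.

Lemma smooth_on_sum U (I : Type) (r : seq I) (f : I -> point -> R) : open U ->
  (forall k, smooth_on U (f k)) -> smooth_on U (fun x => \sum_(k <- r) f k x).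
Proof.
move=> oU sf; elim: r => [|k r IH].
  by under eq_fun do rewrite big_nil; exact: smooth_on_cst.
by under eq_fun do rewrite big_cons; exact: smooth_onD.
Qed.

Lemma smooth_on_comp (I : set R) (Fam : (R -> R) -> Prop) U f (g : R -> R) :
  (forall g : R -> R, Fam g -> exists2 h, Fam h & forall t, I t -> is_derive t 1 g (h t)) ->
  open U -> (forall x, U x -> I (f x)) -> Fam g ->
  smooth_on U f -> smooth_on U (fun x => g (f x)).
Proof.
move=> Fd oU UI Fg /smooth_onP sf; apply/smooth_onP => k.
exact: (times_diff_comp Fd oU UI Fg).
Qed.

Lemma smooth_on_expR U f : open U -> smooth_on U f -> smooth_on U (fun x => expR (f x)).
Proof.
move=> oU; apply: (@smooth_on_comp setT (eq expR)) => // _ <-.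
by exists expR => // t _; exact: is_derive_expR.
Qed.

(** A derivation turns 1/f into - f' / f^2, where 1/f occurs at the previous order. The function [f]
    stays fixed, so its smoothness at all orders remains available along the induction. *)
Lemma smooth_onV U f : open U -> (forall x, U x -> f x != 0) ->
  smooth_on U f -> smooth_on U (fun x => (f x)^-1).
Proof.
move=> oU f0 /smooth_onP sf; apply/smooth_onP; elim=> [|k IH]; split => //;
  try by move=> x Ux; apply: differentiableV; [exact: times_diff_differentiable (sf 0%N) Ux|exact: f0].
move=> i; apply: (@times_diff_ext _ _ (fun x => -1 * (partial i f x * ((f x)^-1 * (f x)^-1)))) => //.
  move=> x Ux; rewrite partialV ?f0//; last exact: times_diff_differentiable (sf 0%N) Ux.
  by rewrite mulN1r -invfM expr2.
apply: times_diffM => //; first exact: times_diff_cst.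
apply: times_diffM => //; last exact: times_diffM.
by case: (sf k.+1) => _; exact.
Qed.

(** The last element of the list is the first derivative taken; it turns ln f into f' / f, which is
    smooth by [smooth_onV]. *)
Lemma smooth_on_ln U f : open U -> (forall x, U x -> 0 < f x) ->
  smooth_on U f -> smooth_on U (fun x => ln (f x)).
Proof.
move=> oU f0 sf s.
have dl x : U x -> differentiable (fun x => ln (f x)) x /\
    forall i, partial i (fun y => ln (f y)) x = (f x)^-1 * partial i f x.
  by move=> Ux; apply: partial_comp1; [exact: smooth_on_diff sf Ux|exact/is_derive1_ln/f0].
case/lastP: s => [|s i] x Ux; first by case: (dl x Ux).
rewrite foldr_rcons; apply: (@smooth_on_ext _ (fun x => (f x)^-1 * partial i f x)) Ux => //.
  by move=> y Uy; case: (dl y Uy) => _ ->.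
apply: smooth_onM => //; last exact: smooth_on_partial.
by apply: smooth_onV => // y Uy; rewrite gt_eqF// f0.
Qed.

End partial_calculus.

#[export] Hint Resolve smooth_on_cst smooth_on_coord : core.

(** * Symmetry of second derivatives *)

Section schwarz.
Context {R : realType} {n : nat}.
Local Notation point := 'rV[R]_n.
Implicit Types (U : set point) (u v f g : point -> R) (x : point) (i j : 'I_n).

Lemma is_derive_line f (y v : point) (t : R) : differentiable f (y + t *: v) ->
  is_derive t 1 (fun s : R => f (y + s *: v)) ('D_v f (y + t *: v)).
Proof.
move=> df.
have dl : differentiable (fun s : R => y + s *: v) t.
  by apply: differentiableD; [exact: differentiable_cst|exact: differentiableZl].
have dfl : differentiable (fun s : R => f (y + s *: v)) t.
  exact: (@differentiable_comp _ _ _ _ (fun s : R => y + s *: v) f).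
apply: DeriveDef; first exact/derivable1_diffP.
rewrite /derive.
have -> : (fun h : R => h^-1 *: (f (y + (h *: 1 + t) *: v) - f (y + t *: v))) =
          (fun h : R => h^-1 *: (f (h *: v + (y + t *: v)) - f (y + t *: v))) => [|//].
apply/funext => h; rewrite [h *: 1]mulr1 scalerDl; congr (_ *: (f _ - _)).
by rewrite addrCA.
Qed.

Local Opaque partial.

(** Two applications of the mean value theorem: to the increment of [f] in direction [j] as a
    function of the position along [i], then to [partial i f] along [j]. The left-hand side is
    symmetric in [i] and [j], which is what [partialC] exploits. *)
Lemma second_difference U f x i j (h : R) : 0 < h ->
  (forall s t, 0 <= s <= h -> 0 <= t <= h ->
     U (x + s *: delta_mx 0 i + t *: delta_mx 0 j)) ->
  smooth_on U f ->
  exists s t, [/\ 0 <= s <= h, 0 <= t <= h &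
   f (x + h *: delta_mx 0 i + h *: delta_mx 0 j) - f (x + h *: delta_mx 0 i) -
     f (x + h *: delta_mx 0 j) + f x =
   h ^+ 2 * partial j (partial i f) (x + s *: delta_mx 0 i + t *: delta_mx 0 j)].
Proof.
move=> h0 hU sf.
set ei := delta_mx 0 i; set ej := delta_mx 0 j.
have h0h : 0 <= h <= h by rewrite lexx ltW.
have z0h : (0 : R) <= 0 <= h by apply/andP; split; [exact: lexx|exact: ltW].
pose phi t := f (x + h *: ej + t *: ei) - f (x + t *: ei).
have dphi t : 0 <= t <= h -> is_derive t 1 phi
    (partial i f (x + h *: ej + t *: ei) - partial i f (x + t *: ei)).
  move=> th; apply: is_deriveB; apply: is_derive_line; apply: (smooth_on_diff sf).
    by rewrite addrAC; exact: hU.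
  by have := hU t 0 th z0h; rewrite scale0r addr0.
have [s] : exists2 s, s \in `]0, h[ & phi h - phi 0 =
    (partial i f (x + h *: ej + s *: ei) - partial i f (x + s *: ei)) * (h - 0).
  apply: (@MVT _ phi (fun s => partial i f (x + h *: ej + s *: ei) - partial i f (x + s *: ei)) 0 h h0).
    by move=> t; rewrite in_itv/= => /andP[? ?]; apply: dphi; rewrite !ltW.
  apply: derivable_within_continuous => t; rewrite in_itv/= => th.
  by have [] := dphi t th.
rewrite in_itv/= => /andP[s0 sh]; have sh' : 0 <= s <= h by rewrite !ltW.
pose psi t := partial i f (x + s *: ei + t *: ej).
have dpsi t : 0 <= t <= h -> is_derive t 1 psi
    (partial j (partial i f) (x + s *: ei + t *: ej)).
  move=> th; apply: is_derive_line; apply: (smooth_on_diff (smooth_on_partial i sf)).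
  exact: hU.
have [t] : exists2 t, t \in `]0, h[ & psi h - psi 0 =
    partial j (partial i f) (x + s *: ei + t *: ej) * (h - 0).
  apply: (@MVT _ psi (fun t => partial j (partial i f) (x + s *: ei + t *: ej)) 0 h h0).
    by move=> t; rewrite in_itv/= => /andP[? ?]; apply: dpsi; rewrite !ltW.
  apply: derivable_within_continuous => t; rewrite in_itv/= => th.
  by have [] := dpsi t th.
rewrite in_itv/= => /andP[t0 th] psiE phiE.
exists s, t; split; rewrite ?ltW//.
move: phiE psiE; rewrite /phi /psi !scale0r !addr0 !subr0 => phiE psiE.
rewrite [x + h *: ej + s *: ei]addrAC psiE in phiE.
by rewrite [x + h *: ei + h *: ej]addrAC opprB in phiE *; rewrite expr2 mulrC mulrA -phiE; ring.
Qed.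

(** The second difference over a small square equals h^2 times either mixed derivative, each at some
    point of the square; continuity brings both points back to [x]. *)
Lemma partialC U f x i j : open U -> U x -> smooth_on U f ->
  partial j (partial i f) x = partial i (partial j f) x.
Proof.
move=> oU Ux sf; apply/eqP; rewrite -subr_eq0 -normr_le0; apply/ler_addgt0Pl => e e0; rewrite addr0.
pose a := partial j (partial i f); pose b := partial i (partial j f).
have ca : {for x, continuous a}.
  by apply: differentiable_continuous; apply: smooth_on_diff Ux; do 2 apply: smooth_on_partial.
have cb : {for x, continuous b}.
  by apply: differentiable_continuous; apply: smooth_on_diff Ux; do 2 apply: smooth_on_partial.
have e2 : 0 < e / 2 by rewrite divr_gt0.
have : \forall y \near x, [/\ U y, `|a x - a y| < e / 2 & `|b x - b y| < e / 2].
  have nU := open_nbhs_nbhs (conj oU Ux).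
  move/cvgrPdist_lt : ca => /(_ _ e2) na; move/cvgrPdist_lt : cb => /(_ _ e2) nb.
  by apply: filterS3 nU na nb => y Uy ay b_y; exact: And3 Uy ay b_y.
move=> /nbhs_normP[d /= d0 dP].
set ei := delta_mx 0 i : point; set ej := delta_mx 0 j : point.
(* The side [h] is such that h c = d / 2, so the whole square lies in the ball of radius [d]; the
   summand 1 keeps [c] positive. *)
pose c := `|ei| + `|ej| + 1; have c0 : 0 < c by rewrite ltr_wpDl.
pose h := d / 2 / c; have h0 : 0 < h by rewrite !divr_gt0.
have hd : h * c < d by rewrite mulrVK ?unitfE ?gt_eqF// ltr_pdivrMr// mulr_natr mulr2n ltrDl.
have hball s t : 0 <= s <= h -> 0 <= t <= h -> `|x - (x + s *: ei + t *: ej)| < d.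
  move=> /andP[s0 sh] /andP[t0 th]; apply: le_lt_trans hd.
  rewrite -addrA opprD addrA subrr sub0r normrN (le_trans (ler_normD _ _))// !normrZ !ger0_norm//.
  by rewrite /c !mulrDr -[leLHS]addr0 lerD ?lerD ?ler_wpM2r// mulr1 ltW.
have [s [t [s0 t0 E1]]] := @second_difference U f x i j h h0
  (fun s t s0 t0 => let: And3 u _ _ := dP _ (hball s t s0 t0) in u) sf.
have hball' s' t' : 0 <= s' <= h -> 0 <= t' <= h -> `|x - (x + s' *: ej + t' *: ei)| < d.
  by move=> s'0 t'0; rewrite addrAC hball.
have [s' [t' [s'0 t'0 E2]]] := @second_difference U f x j i h h0
  (fun s t s0 t0 => let: And3 u _ _ := dP _ (hball' s t s0 t0) in u) sf.
have E : a (x + s *: ei + t *: ej) = b (x + s' *: ej + t' *: ei).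
  have h2 : h ^+ 2 != 0 by rewrite expf_neq0// gt_eqF.
  apply: (mulfI h2); apply: etrans (esym E1) _; apply: etrans _ E2.
  by rewrite [x + h *: delta_mx 0 j + h *: delta_mx 0 i]addrAC [X in X + f x]addrAC.
have [_ Ea _] := dP _ (hball s t s0 t0).
have [_ _ Eb] := dP _ (hball' s' t' s'0 t'0).
have E' : a x - b x = (a x - a (x + s *: ei + t *: ej)) + (b (x + s' *: ej + t' *: ei) - b x).
  by rewrite E subrKA.
change (`|a x - b x| <= e); rewrite E'; apply: le_trans (ler_normD _ _) _.
rewrite (splitr e); apply: lerD (ltW Ea) _.
by rewrite distrC; exact: (ltW Eb).
Qed.

Local Transparent partial.

Lemma deriveE_partial f x (v : point) : differentiable f x ->
  'D_v f x = \sum_i v 0 i * partial i f x.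
Proof.
move=> df; rewrite deriveE// [v in LHS]row_sum_delta linear_sum; apply: eq_bigr => i _.
by rewrite linearZ/= -deriveE.
Qed.

End schwarz.

(** * Product Lebesgue measure: measurability of open sets and Fubini along lines *)

Section lebesgue_tuple_theory.
Context {R : realType}.
Local Notation T := (measurableTypeR R).

(** An open set is the countable union of the balls with rational centre and radius 1/(k+1) that it
    contains. As the norm on row vectors is the sup norm, such a ball is a finite intersection of
    conditions on single coordinates. *)
Lemma measurable_point_open n (O : set 'rV[R]_n) : open O ->
  measurable (@point_of_tuple R n @^-1` O).
Proof.
move=> oO.
pose c (q : 'rV[rat]_n * nat) : 'rV[R]_n := map_mx ratr q.1.
pose B (q : 'rV[rat]_n * nat) := if `[< ball (c q) q.2.+1%:R^-1 `<=` O >]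
  then @point_of_tuple R n @^-1` ball (c q) q.2.+1%:R^-1 else set0.
rewrite (_ : _ @^-1` _ = \bigcup_q B q).
  apply: countable_bigcupT_measurable; first exact: countableP.
  move=> [q k]; rewrite /B; case: asboolP => // _.
  rewrite (_ : _ @^-1` _ = \bigcap_(i in [set: 'I_n])
     ((@tnth n T)^~ i @^-1` ball (ratr (q 0 i) : R) k.+1%:R^-1)).
    apply: fin_bigcap_measurable => [|i _]; first exact: finite_finset.
    rewrite -[X in measurable X]setTI; apply: measurable_tnth => //.
    exact: measurable_ball.
  apply/seteqP; split => [t [_ /= h] i _ /=|t h /=].
    by have := h 0 i; rewrite !mxE.
  split=> [|i j]; first by rewrite invr_gt0.
  by have := h j I; rewrite /= ord1 !mxE.
apply/seteqP; split => [t /= Ot|t [q _]]; last first.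
  rewrite /B; case: asboolP => // sO /= h; exact: sO.
have /nbhs_ballP[e /= e0 eO] := open_nbhs_nbhs (conj oO Ot).
have [k ke] : exists k, k.+1%:R^-1 < e / 2.
  have [k _ /(_ k (leqnn k))] := near_infty_natSinv_lt (PosNum (divr_gt0 e0 (@ltr0n R 2))).
  by exists k.
have k0 : 0 < k.+1%:R^-1 :> R by rewrite invr_gt0.
have /fin_all_exists[q qP] (i : 'I_n) : exists q : rat, ball (ratr q : R) k.+1%:R^-1 (tnth t i).
  have : tnth t i - k.+1%:R^-1 < tnth t i + k.+1%:R^-1 :> R by rewrite ltrBlDr -addrA ltrDl addr_gt0.
  move=> /rat_in_itvoo[q]; rewrite in_itv/= => /andP[q1 q2]; exists q.
  by rewrite /ball/= ltr_distl q1.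
exists (\row_i q i, k) => //; rewrite /B.
have tq : ball (c (\row_i q i, k)) k.+1%:R^-1 (point_of_tuple t).
  by split => // i j; rewrite !mxE; exact: qP.
case: asboolP => [//|[]] y yq; apply: eO.
apply: (@le_ball _ _ _ (k.+1%:R^-1 + k.+1%:R^-1)).
  by rewrite (splitr e) ltW// ltrD.
by apply: ball_triangle yq; exact: ball_sym.
Qed.

Lemma measurable_point n (f : 'rV[R]_n -> R) : continuous f ->
  measurable_fun setT (fun t : n.-tuple T => f (point_of_tuple t)).
Proof.
move=> /continuousP cf.
apply: (measurability _ (RGenOpens.measurableE R)) => _ [_ [a [b ->] <-]].
have oi : open `]a, b[%classic by exact: interval_open.
rewrite setTI; exact: (measurable_point_open (cf _ oi)).
Qed.

Definition tuple_box n (c : n.-tuple T) (M : R) : set (n.-tuple T) :=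
  [set t | forall i, `|tnth t i - tnth c i| <= M].

Lemma measurable_tuple_box n c M : measurable (@tuple_box n c M).
Proof.
rewrite (_ : tuple_box c M = \bigcap_(i in [set: 'I_n])
   ((@tnth n T)^~ i @^-1` `[tnth c i - M, tnth c i + M]%classic)).
  apply: fin_bigcap_measurable => [|i _]; first exact: finite_finset.
  rewrite -[X in measurable X]setTI; exact: measurable_tnth.
apply/seteqP; split => [t h i _ /=|t h i].
  by have := h i; rewrite in_itv/= ler_distl.
by have := h i I; rewrite /= in_itv/= ler_distl.
Qed.

Lemma lebesgue_tuple_box n (c : n.-tuple T) (M : R) : 0 <= M ->
  lebesgue_tuple R n (tuple_box c M) = ((2 * M) ^+ n)%:E.
Proof.
move=> M0; elim: n c => [|n IH] c.
  rewrite (_ : tuple_box c M = setT) ?expr0; last by apply/seteqP; split => // t _ [].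
  by rewrite /= diracT.
rewrite /= /measure_cons /pushforward.
rewrite (_ : _ @^-1` _ = `[thead c - M, thead c + M]%classic `*`
    tuple_box [tuple of behead c] M); last first.
  apply/seteqP; split => -[x t] /=.
    move=> h; split.
      by have := h ord0; rewrite in_itv/= tnth0 -ler_distl.
    move=> i; have := h (lift ord0 i).
    by rewrite tnthS tnth_behead (_ : inord _ = lift ord0 i)//; apply/val_inj; rewrite /= inordK// ltnS.
  move=> [h1 h2] i; case: (unliftP ord0 i) => [j ->|->].
    have := h2 j; rewrite tnthS tnth_behead (_ : inord _ = lift ord0 j)//.
    by apply/val_inj; rewrite /= inordK// ltnS.
  by move: h1; rewrite in_itv/= tnth0 -ler_distl.
rewrite product_measure1E//; last exact: measurable_tuple_box.
rewrite IH.
rewrite [X in (X * _)%E](_ : _ = (2 * M)%:E); last first.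
  apply: etrans (@lebesgue_measure_itv R `[thead c - M, thead c + M]) _.
  rewrite /= lte_fin -EFinB; have -> : thead c + M - (thead c - M) = 2 * M by ring.
  case: ltP => // h; congr (_%:E).
  have -> : M = 0 by lra.
  by rewrite mulr0.
by rewrite -EFinM exprS.
Qed.

(** A class stable under fixing the first coordinate, and whose members are integrable, so that
    Fubini applies at each stage of an induction on the dimension. *)
Definition bddsupp n (g : n.-tuple T -> R) := [/\ measurable_fun setT g,
  exists B : R, forall t, `|g t| <= B & exists M : R, forall t i, M < `|tnth t i| -> g t = 0].

Definition tuple_upd n (t : n.-tuple T) (i : 'I_n) (s : R) : n.-tuple T :=
  [tuple (if j == i then s else tnth t j) | j < n].

Definition const_tuple n (a : R) : n.-tuple T := [tuple a | _ < n].

Lemma bddsupp_integrable n (g : n.-tuple T -> R) : bddsupp g ->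
  (lebesgue_tuple R n).-integrable setT (EFin \o g).
Proof.
move=> [mg [B gB] [M gM]].
pose K := tuple_box (const_tuple n 0) `|M|.
have mK : measurable K by exact: measurable_tuple_box.
have gK : EFin \o g = (EFin \o g) \_ K.
  apply/funext => t; rewrite patchE; case: ifPn => //; rewrite notin_setE => nK.
  have [i] : exists i, M < `|tnth t i|.
    apply: contrapT => /forallNP h; apply: nK => i; rewrite tnth_mktuple subr0.
    by move/negP: (h i); rewrite -leNgt => /le_trans; apply; exact: ler_norm.
  by move=> /gM /= ->.
rewrite gK -(integrable_mkcond _ mK).
apply: measurable_bounded_integrable => //.
- suff : (lebesgue_tuple R n K < +oo)%E by [].
  by rewrite lebesgue_tuple_box// ltry.
- exact: measurable_funTS.
- by exists B; split; [exact: num_real|move=> x Bx t _ /=; rewrite (le_trans (gB t))// ltW].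
Qed.

Lemma bddsupp_slice n (g : n.+1.-tuple T -> R) (x : T) : bddsupp g ->
  bddsupp (fun t => g (tuple_cons (x, t))).
Proof.
move=> [mg [B gB] [M gM]]; split.
- apply: measurableT_comp => //.
  apply: (measurableT_comp (@measurable_tuple_cons _ T n)).
  exact: measurable_pair1.
- by exists B => t; exact: gB.
- exists M => t i Mi; apply: (gM _ (lift ord0 i)).
  by rewrite /tuple_cons tnthS.
Qed.

Lemma integral_measure_cons n (g : n.+1.-tuple T -> R) : bddsupp g ->
  (\int[lebesgue_tuple R n.+1]_t (g t)%:E =
   \int[(@lebesgue_measure R) \x (lebesgue_tuple R n)]_p (g (tuple_cons p))%:E)%E /\
  ((@lebesgue_measure R) \x (lebesgue_tuple R n))%E.-integrable setT
     (fun p => (g (tuple_cons p))%:E).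
Proof.
move=> bg; have [mg [B gB] [M gM]] := bg.
pose K := tuple_box (const_tuple n.+1 0) `|M|.
have mK : measurable K by exact: measurable_tuple_box.
have mK' : measurable (@tuple_cons _ T n @^-1` K).
  by rewrite -[X in measurable X]setTI; exact: measurable_tuple_cons.
have mgc : measurable_fun setT (fun p => g (@tuple_cons _ T n p)).
  exact: measurableT_comp mg (@measurable_tuple_cons _ T n).
have gK : (fun p => (g (tuple_cons p))%:E) =
    (EFin \o (fun p => g (tuple_cons p))) \_ (@tuple_cons _ T n @^-1` K).
  apply/funext => t; rewrite patchE; case: ifPn => //; rewrite notin_setE => nK.
  have [i] : exists i, M < `|tnth (tuple_cons t) i|.
    apply: contrapT => /forallNP h; apply: nK => i; rewrite tnth_mktuple subr0.
    by move/negP: (h i); rewrite -leNgt => /le_trans; apply; exact: ler_norm.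
  by move=> /gM /= ->.
have ig : ((@lebesgue_measure R) \x (lebesgue_tuple R n))%E.-integrable setT
     (fun p => (g (tuple_cons p))%:E).
  rewrite gK -(integrable_mkcond _ mK').
  apply: measurable_bounded_integrable => //.
  - suff : (lebesgue_tuple R n.+1 K < +oo)%E by [].
    by rewrite lebesgue_tuple_box// ltry.
  - exact: measurable_funTS.
  - by exists B; split; [exact: num_real|move=> x Bx t _ /=; rewrite (le_trans (gB _))// ltW].
split => //.
have mEg : measurable_fun setT (EFin \o g) by exact/measurable_EFinP.
exact: (integral_pushforward (@measurable_tuple_cons _ T n) mEg ig measurableT).
Qed.

(** Fubini, by induction on the dimension. If [i] is the head coordinate it is integrated innermost;
    otherwise the head is integrated outermost and every slice satisfies the hypothesis for the
    shifted index. *)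
Lemma integral_line_eq0 n (i : 'I_n) (g : n.-tuple T -> R) : bddsupp g ->
  (forall t, \int[lebesgue_measure]_s (g (tuple_upd t i s))%:E = 0)%E ->
  (\int[lebesgue_tuple R n]_t (g t)%:E = 0)%E.
Proof.
elim: n i g => [[]//|n IH] i g bg g0.
have [-> ig] := integral_measure_cons bg.
case: (unliftP ord0 i) => [j|] iE.
  rewrite -(integral12_prod_meas1 ig) /fubini_F integral0_eq// => x _.
  apply: (IH j); first exact: bddsupp_slice.
  move=> t; rewrite -(g0 (tuple_cons (x, t))); apply: eq_integral => s _.
  congr (g _)%:E; apply: eq_from_tnth => k; rewrite tnth_mktuple iE.
  case: (unliftP ord0 k) => [l ->|->]; last by rewrite /tuple_cons !tnth0.
  by rewrite /tuple_cons !tnthS tnth_mktuple (inj_eq (@lift_inj _ _)).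
rewrite -(integral21_prod_meas1 ig) /fubini_G integral0_eq// => t _.
(* The head of the tuple is arbitrary, since the update at [i] overwrites it. *)
pose z : T := 0 : R; rewrite -(g0 (@tuple_cons _ T n (z, t))); apply: eq_integral => s _.
congr (g _)%:E; apply: eq_from_tnth => k; rewrite tnth_mktuple iE.
case: (unliftP ord0 k) => [l ->|->]; last by rewrite /tuple_cons !tnth0.
by rewrite /tuple_cons !tnthS.
Qed.

End lebesgue_tuple_theory.

(** * Integrals of continuous functions with bounded support, and integration by parts *)

Section integral_of_compactly_supported.
Context {R : realType} {n : nat}.
Local Notation T := (measurableTypeR R).
Local Notation point := 'rV[R]_n.
Implicit Types (f g : point -> R) (i : 'I_n).

Definition cc f := continuous f /\ exists M : R, forall (x : point) i, M < `|x 0 i| -> f x = 0.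

Definition Int f : R := Rintegral (lebesgue_tuple R n) setT (fun t => f (point_of_tuple t)).

Lemma cc_bounded f : cc f -> exists B, forall x, `|f x| <= B.
Proof.
move=> [cf [M fM]].
pose A : set point := [set v | forall i, `[- `|M|, `|M|]%classic (v ord0 i)].
have cA : compact A by apply: (@rV_compact R n (fun=> `[- `|M|, `|M|]%classic)) => i; exact: segment_compact.
have cf' : {within A, continuous (fun x => `|f x|)}.
  apply: continuous_subspaceT => x; apply: continuous_comp; [exact: cf|exact: norm_continuous].
have A0 : A 0 by move=> i; rewrite /= in_itv/= mxE -ler_norml normr0.
have [c _ cP] := @EVT_max_rV R n (fun x => `|f x|) A (ex_intro _ 0 A0) cA cf'.
exists `|f c| => x; have [Ax|nA] := pselect (A x); first by have /= := cP x; rewrite inE; apply.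
have [i] : exists i, M < `|x 0 i|.
  apply: contrapT => /forallNP h; apply: nA => i; rewrite /= in_itv/= -ler_norml.
  by move/negP: (h i); rewrite -leNgt => /le_trans; apply; exact: ler_norm.
by move=> /fM ->; rewrite normr0.
Qed.

Lemma cc_bddsupp f : cc f -> bddsupp (fun t : n.-tuple T => f (point_of_tuple t)).
Proof.
move=> ccf; have [B fB] := cc_bounded ccf; case: ccf => cf [M fM]; split.
- exact: measurable_point.
- by exists B.
- by exists M => t i Mi; apply: (fM _ i); rewrite mxE.
Qed.

Lemma cc_integrable f : cc f ->
  (lebesgue_tuple R n).-integrable setT (EFin \o (fun t => f (point_of_tuple t))).
Proof. by move=> ccf; apply: bddsupp_integrable; exact: cc_bddsupp. Qed.

Lemma Int_EFin f : cc f ->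
  (\int[lebesgue_tuple R n]_t (f (point_of_tuple t))%:E)%E = (Int f)%:E.
Proof.
move=> ccf; rewrite /Int /Rintegral fineK//.
by apply: integrable_fin_num => //; exact: cc_integrable.
Qed.

Lemma ccM f g : continuous f -> cc g -> cc (fun x => f x * g x).
Proof.
move=> cf [cg [M gM]]; split; first by move=> x; exact: (cvgM (cf x) (cg x)).
by exists M => x i /gM ->; rewrite mulr0.
Qed.

Lemma ccD f g : cc f -> cc g -> cc (fun x => f x + g x).
Proof.
move=> [cf [M fM]] [cg [M' gM']]; split; first by move=> x; exact: (cvgD (cf x) (cg x)).
exists (Num.max M M') => x i; rewrite gt_max => /andP[/fM -> /gM' ->]; exact: addr0.
Qed.

Lemma ccZ c f : cc f -> cc (fun x => c * f x).
Proof. by move=> ccf; apply: (@ccM (cst c)) => //; exact: cst_continuous. Qed.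

Lemma ccN f : cc f -> cc (fun x => - f x).
Proof.
move=> /(ccZ (-1)); rewrite (_ : (fun x => -1 * f x) = fun x => - f x)//.
by apply/funext => x; rewrite mulN1r.
Qed.

Lemma cc0 : cc (fun=> 0).
Proof. by split; [exact: cst_continuous|exists 0]. Qed.

Lemma cc_sum (I : Type) (r : seq I) (F : I -> point -> R) :
  (forall k, cc (F k)) -> cc (fun x => \sum_(k <- r) F k x).
Proof.
move=> cF; elim: r => [|k r IH].
  by under eq_fun do rewrite big_nil; exact: cc0.
by under eq_fun do rewrite big_cons; exact: ccD.
Qed.

Lemma IntD f g : cc f -> cc g -> Int (fun x => f x + g x) = Int f + Int g.
Proof. by move=> cf cg; rewrite /Int RintegralD//; exact: cc_integrable. Qed.

Lemma IntZ c f : cc f -> Int (fun x => c * f x) = c * Int f.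
Proof. by move=> cf; rewrite /Int RintegralZl//; exact: cc_integrable. Qed.

Lemma IntN f : cc f -> Int (fun x => - f x) = - Int f.
Proof.
move=> cf; rewrite -mulN1r -IntZ//; congr Int; apply/funext => x; exact: esym (mulN1r _).
Qed.

Lemma Int0 : Int (fun=> 0) = 0.
Proof. by rewrite /Int /Rintegral integral0. Qed.

Lemma Int_sum (I : Type) (r : seq I) (F : I -> point -> R) :
  (forall k, cc (F k)) -> Int (fun x => \sum_(k <- r) F k x) = \sum_(k <- r) Int (F k).
Proof.
move=> cF; elim: r => [|k r IH].
  by under eq_fun do rewrite big_nil; rewrite Int0 big_nil.
under eq_fun do rewrite big_cons.
by rewrite IntD ?IH ?big_cons//; exact: cc_sum.
Qed.

Lemma le_Int f g : cc f -> cc g -> (forall x, f x <= g x) -> Int f <= Int g.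
Proof. by move=> cf cg fg; apply: le_Rintegral => //; exact: cc_integrable. Qed.

Lemma point_tuple_upd (t : n.-tuple T) i (s : R) :
  point_of_tuple (tuple_upd t i s) =
  point_of_tuple (tuple_upd t i 0) + s *: delta_mx 0 i.
Proof.
apply/rowP => j; rewrite !mxE !tnth_mktuple ?eqxx /=.
by case: eqP => _; rewrite ?mulr1 ?add0r// mulr0 addr0.
Qed.

Lemma cc_partial f i : cc f -> continuous (partial i f) -> cc (partial i f).
Proof.
move=> [cf [M fM]] cpf; split=> //; exists M => x j Mj.
rewrite -(@partial_cst R n 0 x i); apply: partial_near.
have cn : {for x, continuous (fun y : point => `|y 0 j|)}.
  by apply: (@continuous_comp _ _ _ (fun y : point => y 0 j) (fun z : R => `|z|)); [exact: coord_continuous|exact: norm_continuous].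
have h : nbhs x [set y : point | M < `|y 0 j|] by exact: (cn _ (lt_nbhsr Mj)).
by near=> y; apply: (fM y j); near: y.
Unshelve. all: by end_near.
Qed.

(** By [integral_line_eq0] it suffices to integrate along lines of direction [i], where the
    fundamental theorem of calculus gives a difference of two values of [f] outside its support. *)
Lemma Int_partial f i : (forall x, differentiable f x) -> cc f ->
  continuous (partial i f) -> Int (partial i f) = 0.
Proof.
move=> df ccf cpf.
have ccp := cc_partial ccf cpf.
suff H : (\int[lebesgue_tuple R n]_t (partial i f (point_of_tuple t))%:E)%E = 0%E.
  by rewrite /Int /Rintegral H.
apply: (integral_line_eq0 (i := i) (cc_bddsupp ccp)) => t.
pose y := point_of_tuple (tuple_upd t i 0).
pose phi (s : R) := f (y + s *: delta_mx 0 i).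
pose dphi (s : R) := partial i f (y + s *: delta_mx 0 i).
have phiD (s : R) : is_derive s 1 phi (dphi s) by exact: is_derive_line.
under eq_integral do rewrite point_tuple_upd -/(dphi _).
have [_ [M fM]] := ccf; have [_ [M' fM']] := ccp.
(* The interval [-L, L] reaches strictly beyond the bounds for the supports of [f] and of its
   derivative, and the summand 1 makes it nondegenerate. *)
pose L := `|M| + `|M'| + 1.
have L0 : - L < L by rewrite /L; have := normr_ge0 M; have := normr_ge0 M'; lra.
have yL s : (y + s *: delta_mx 0 i) 0 i = s.
  by rewrite !mxE tnth_mktuple !eqxx/= add0r mulr1.
have dphi0 s : ~~ (s \in `[- L, L]) -> dphi s = 0.
  rewrite in_itv/= -ler_norml -ltNge => Ls; apply: (fM' _ i); rewrite yL.
  by apply: le_lt_trans Ls; rewrite /L; have := normr_ge0 M; have := ler_norm M'; lra.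
have phi0 s : `|s| = L -> phi s = 0.
  move=> sL; apply: (fM _ i); rewrite yL sL /L.
  by have := normr_ge0 M'; have := ler_norm M; lra.
have -> : (fun s => (dphi s)%:E) = (fun s => (dphi s)%:E) \_ `[- L, L].
  apply/funext => s; rewrite patchE; case: ifPn => //; rewrite mem_setE => h.
  by rewrite dphi0.
rewrite -integral_mkcond.
have cdphi : continuous dphi.
  move=> s; apply: continuous_comp; last exact: cpf.
  apply: differentiable_continuous.
  by apply: differentiableD; [exact: differentiable_cst|exact: differentiableZl].
have cw : {within `[- L, L], continuous dphi} by exact: continuous_subspaceT.
have cphi (s : R) : phi z @[z --> s] --> phi s.
  by apply: differentiable_continuous; apply/derivable1_diffP; case: (phiD s).
have dw : derivable_oo_LRcontinuous phi (- L) L.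
  split; [by move=> s _; case: (phiD s)|exact: cvg_at_right_filter|exact: cvg_at_left_filter].
have ew : {in `]- L, L[, phi^`()%classic =1 dphi}.
  by move=> s _; rewrite derive1E; case: (phiD s).
have LL : `|L| = L by rewrite ger0_norm//; move: L0; lra.
by rewrite (continuous_FTC2 L0 cw dw ew) !phi0 ?normrN// subee.
Qed.

End integral_of_compactly_supported.

(** * Smooth functions with compact support in an open set *)

Section smooth_compact_support.
Context {R : realType} {n : nat}.
Local Notation point := 'rV[R]_n.
Implicit Types (V : set point) (f g a : point -> R) (x : point) (i : 'I_n).

(** The function vanishes off [K] also outside [V], so it is differentiable everywhere although
    smoothness is only asked on [V]. This lets it be multiplied by coefficients that are singular at
    the pole or on the boundary sphere. *)
Definition tf V f := smooth_on V f /\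
  exists K, [/\ compact K, K `<=` V & forall x, ~ K x -> f x = 0].

Lemma tf_out V f x : tf V f -> ~ V x -> f x = 0.
Proof. by move=> [_ [K [_ KV Kf]]] nV; apply: Kf => /KV. Qed.

Lemma compact_complement_near (K : set point) x : compact K -> ~ K x -> \near x, ~ K x.
Proof.
move=> cK nK; have oK : open (~` K).
  by apply: closed_openC; apply: compact_closed => //; exact: norm_hausdorff.
exact: (open_nbhs_nbhs (conj oK nK)).
Qed.

Lemma tf_differentiable V f x : tf V f -> differentiable f x.
Proof.
move=> [sf [K [cK KV Kf]]]; have [/KV Vx|nK] := pselect (K x).
  exact: smooth_on_diff Vx.
apply: (@differentiable_near _ _ _ (cst 0)); last exact: differentiable_cst.
by apply: filterS (compact_complement_near cK nK) => y /Kf.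
Qed.

Lemma tf_continuous V f : tf V f -> continuous f.
Proof. by move=> tff x; apply: differentiable_continuous; exact: tf_differentiable tff. Qed.

Lemma tf_partial V f i : tf V f -> tf V (partial i f).
Proof.
move=> [sf [K [cK KV Kf]]]; split; first exact: smooth_on_partial.
exists K; split => // x nK; rewrite -[RHS](@partial_cst R n 0 x i); apply: partial_near.
by apply: filterS (compact_complement_near cK nK) => y /Kf.
Qed.

Lemma tf_cc V f : tf V f -> cc f.
Proof.
move=> tff; split; first exact: tf_continuous tff.
have [_ [K [cK _ Kf]]] := tff.
have [M [_ /(_ (M + 1)) MK]] := compact_bounded cK.
have {}MK y : K y -> `|y| <= M + 1 by move=> Ky; apply: MK => //; rewrite ltrDl.
exists (M + 1) => x i Mx; apply: Kf => /MK /=.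
apply/negP; rewrite -ltNge; apply: lt_le_trans Mx _.
rewrite [leRHS]mx_normrE.
exact: (le_bigmax 0 (fun k : 'I_1 * 'I_n => `|x k.1 k.2|) (0, i)).
Qed.

Lemma tfM V a f : open V -> smooth_on V a -> tf V f -> tf V (fun x => a x * f x).
Proof.
move=> oV sa [sf [K [cK KV Kf]]]; split; first exact: smooth_onM.
by exists K; split => // x /Kf ->; rewrite mulr0.
Qed.

Lemma tfMr V a f : open V -> smooth_on V a -> tf V f -> tf V (fun x => f x * a x).
Proof.
move=> oV sa [sf [K [cK KV Kf]]]; split; first exact: smooth_onM.
by exists K; split => // x /Kf ->; rewrite mul0r.
Qed.

Lemma tfD V f g : open V -> tf V f -> tf V g -> tf V (fun x => f x + g x).
Proof.
move=> oV [sf [K [cK KV Kf]]] [sg [L [cL LV Lg]]]; split; first exact: smooth_onD.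
exists (K `|` L); split; first exact: compactU; first by rewrite subUset.
by move=> x /not_orP[/Kf -> /Lg ->]; rewrite addr0.
Qed.

Lemma tfN V f : open V -> tf V f -> tf V (fun x => - f x).
Proof.
move=> oV [sf [K [cK KV Kf]]]; split; first exact: smooth_onN.
by exists K; split => // x /Kf ->; rewrite oppr0.
Qed.

Lemma tf_sum V (I : Type) (r : seq I) (F : I -> point -> R) : open V ->
  (forall k, tf V (F k)) -> tf V (fun x => \sum_(k <- r) F k x).
Proof.
move=> oV tF; elim: r => [|k r IH].
  under eq_fun do rewrite big_nil; split; first exact: smooth_on_cst.
  by exists set0; split => //; exact: compact0.
by under eq_fun do rewrite big_cons; exact: tfD.
Qed.

Lemma tf_Int_partial V f i : tf V f -> Int (partial i f) = 0.
Proof.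
move=> tff; apply: Int_partial; [|exact: tf_cc tff|exact: tf_continuous (tf_partial i tff)].
by move=> x; exact: tf_differentiable tff.
Qed.

(** All iterated derivatives of [f] keep their support in a compact subset of the smaller set, so
    each of them is differentiable everywhere. *)
Lemma tf_sub V V' f : V' `<=` V -> tf V' f -> open V' -> open V -> tf V f.
Proof.
move=> VV tff oV' oV; have [sf [K [cK KV Kf]]] := tff; split; last first.
  by exists K; split => //; exact: subset_trans VV.
move=> s x Vx; suff tfs : tf V' (foldr partial f s) by exact: tf_differentiable tfs.
by elim: s => //= i s IH; exact: tf_partial.
Qed.

End smooth_compact_support.

(** * The ball model: cosh of the distance to the pole and its gradient field *)

Section hyperbolic_geometry.
Context {R : realType} {N : nat}.
Local Notation point := 'rV[R]_N.
Implicit Types (f g u v : point -> R) (x y : point) (i j : 'I_N).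
Local Notation U := (@Hspace R N).

Definition dot x y : R := \sum_i x 0 i * y 0 i.

Definition rho x : R := 2 / (1 - sqnorm x).

Lemma smooth_sqnorm V : smooth_on V (@sqnorm R N) .
Proof.
apply: (@smooth_on_sub _ _ setT) => //.
apply: smooth_on_sum => [|i]; first exact: openT.
by apply: smooth_onX; [exact: openT|exact: smooth_on_coord].
Qed.

Lemma open_Hspace : open U.
Proof.
rewrite (_ : U = @sqnorm R N @^-1` [set t | t < 1])//.
apply: open_comp; last exact: open_lt.
by move=> x _; apply: differentiable_continuous; exact: (smooth_on_diff (smooth_sqnorm (V := setT))).
Qed.
Hint Resolve open_Hspace : core.

Lemma smooth_dot V y : smooth_on V (fun x => dot x y).
Proof.
apply: (@smooth_on_sub _ _ setT) => //.
apply: smooth_on_sum => [|i]; first exact: openT.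
by apply: smooth_onM; [exact: openT|exact: smooth_on_coord|exact: smooth_on_cst].
Qed.

Hint Resolve smooth_sqnorm smooth_dot : core.

Lemma Hspace_gt0 x : U x -> 0 < 1 - sqnorm x.
Proof. by rewrite subr_gt0. Qed.

Lemma Hspace_neq0 x : U x -> 1 - sqnorm x != 0.
Proof. by move=> /Hspace_gt0 /gt_eqF ->. Qed.

Lemma rho_gt0 x : U x -> 0 < rho x.
Proof. by move=> Ux; rewrite divr_gt0// Hspace_gt0. Qed.

Lemma rho_neq0 x : U x -> rho x != 0.
Proof. by move=> /rho_gt0 /gt_eqF ->. Qed.

Lemma smooth_rho : smooth_on U rho.
Proof.
apply: smooth_onM => //.
apply: smooth_onV => // [x|]; first exact: Hspace_neq0.
apply: smooth_onB => //.
Qed.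

Lemma partial_sqnorm i x : partial i (@sqnorm R N) x = 2 * x 0 i.
Proof.
rewrite /sqnorm partial_sum; last first.
  by move=> k; apply: (@differentiableM _ _ (fun y : point => y 0 k)); exact: differentiable_coord.
rewrite (bigD1 i)//= big1 => [|j ji].
  rewrite addr0 (@partialM _ _ (fun y => y 0 i)) ?partial_coord ?eqxx; try exact: differentiable_coord.
  by rewrite mul1r mulr1 mulr_natl mulr2n.
rewrite (@partialM _ _ (fun y => y 0 j)) ?partial_coord; try exact: differentiable_coord.
by rewrite eq_sym (negbTE ji) mul0r mulr0 addr0.
Qed.

Lemma partial_dot i x y : partial i (fun z => dot z y) x = y 0 i.
Proof.
rewrite /dot partial_sum; last first.
  by move=> k; apply: differentiableM; [exact: differentiable_coord|exact: differentiable_cst].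
rewrite (bigD1 i)//= big1 => [|j ji].
  rewrite addr0 partialM ?partial_coord ?eqxx ?partial_cst ?mulr0 ?mul1r ?addr0//.
  exact: differentiable_coord.
rewrite partialM ?partial_coord ?partial_cst ?mulr0 ?addr0//; last exact: differentiable_coord.
by rewrite eq_sym (negbTE ji) mul0r.
Qed.

Lemma partial_rho i x : U x -> partial i rho x = rho x ^+ 2 * x 0 i.
Proof.
move=> Ux; have ds : differentiable (@sqnorm R N) x.
  exact: (smooth_on_diff (smooth_sqnorm (V := setT))).
have d1 : differentiable (fun y => 1 - sqnorm y) x.
  by apply: differentiableB => //; exact: differentiable_cst.
rewrite /rho partialZ; last by apply: differentiableV => //; exact: Hspace_neq0.
rewrite partialV//; last exact: Hspace_neq0.
have dc : differentiable (fun _ : point => (1 : R)) x by exact: differentiable_cst.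
rewrite partialB// partial_cst partial_sqnorm.
by move: (Hspace_neq0 Ux) => ?; field.
Qed.

Section pole.
Variable x0 : point.

(* cosh of the hyperbolic distance to [x0] *)
Definition chF x : R := ((1 + sqnorm x) * (1 + sqnorm x0) - 4 * dot x x0) /
  ((1 - sqnorm x) * (1 - sqnorm x0)).

(* The hyperbolic gradient of [chF], a vector field with polynomial coordinates
   in the ball model. *)
Definition Yc i x : R :=
  ((1 + sqnorm x0 - 2 * dot x x0) * x 0 i - (1 - sqnorm x) * x0 0 i) / (1 - sqnorm x0).

(** Conformal factor of [Yc] for the Euclidean metric: the Jacobian of [Yc] is [kap] times the
    identity plus an antisymmetric matrix. *)
Definition kap x : R := (1 + sqnorm x0 - 2 * dot x x0) / (1 - sqnorm x0).

Hypothesis hx0 : U x0.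

Lemma smooth_chF : smooth_on U chF.
Proof.
apply: smooth_onM => //.
  apply: smooth_onB => //; apply: smooth_onM => //.
  by apply: smooth_onD => //.
apply: smooth_onV => // [x Ux|]; first by rewrite mulf_neq0// Hspace_neq0.
apply: smooth_onM => //.
by apply: smooth_onB => //.
Qed.

Lemma smooth_Yc V i : open V -> smooth_on V (Yc i).
Proof.
move=> oV; apply: smooth_onM => //.
apply: smooth_onB => //; apply: smooth_onM => //.
  apply: smooth_onB => //.
  by apply: smooth_onM => //.
by apply: smooth_onB => //.
Qed.

Lemma partial_chF i x : U x -> partial i chF x = rho x ^+ 2 * Yc i x.
Proof.
move=> Ux.
have ds : differentiable (@sqnorm R N) x.
  exact: (smooth_on_diff (smooth_sqnorm (V := setT))).
have dd : differentiable (fun y => dot y x0) x.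
  exact: (smooth_on_diff (smooth_dot (V := setT) x0)).
have dc (c : R) : differentiable (fun _ : point => c) x by exact: differentiable_cst.
have d1 : differentiable (fun y => 1 - sqnorm y) x by exact: differentiableB.
have d2 : differentiable (fun y => 1 + sqnorm y) x by exact: differentiableD.
have d3 : differentiable (fun y => (1 + sqnorm y) * (1 + sqnorm x0)) x by exact: differentiableM.
have d4 : differentiable (fun y => 4 * dot y x0) x by exact: differentiableM.
have d5 : differentiable (fun y => (1 - sqnorm y) * (1 - sqnorm x0)) x by exact: differentiableM.
have n5 : (1 - sqnorm x) * (1 - sqnorm x0) != 0 by rewrite mulf_neq0// Hspace_neq0.
have d6 : differentiable (fun y => (1 + sqnorm y) * (1 + sqnorm x0) - 4 * dot y x0) x.
  exact: differentiableB.
have d7 : differentiable (fun y => ((1 - sqnorm y) * (1 - sqnorm x0))^-1) x.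
  exact: (differentiableV d5 n5).
rewrite /chF partialM// partialV// partialB// !partialM// partialB// partialD// !partial_cst partial_sqnorm partial_dot.
by rewrite /rho /Yc; move: (Hspace_neq0 Ux) (Hspace_neq0 hx0) => ? ?; field; rewrite ?andbT; apply/andP.
Qed.

Lemma partial_Yc i j x : partial i (Yc j) x =
  ((i == j)%:R * (1 + sqnorm x0 - 2 * dot x x0) - 2 * x0 0 i * x 0 j + 2 * x 0 i * x0 0 j)
   / (1 - sqnorm x0).
Proof.
have ds : differentiable (@sqnorm R N) x.
  exact: (smooth_on_diff (smooth_sqnorm (V := setT))).
have dd : differentiable (fun y => dot y x0) x.
  exact: (smooth_on_diff (smooth_dot (V := setT) x0)).
have dc (c : R) : differentiable (fun _ : point => c) x by exact: differentiable_cst.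
have dx : differentiable (fun y : point => y 0 j) x by exact: differentiable_coord.
have d0 : differentiable (fun y => 2 * dot y x0) x by exact: differentiableM.
have d1 : differentiable (fun y => 1 + sqnorm x0 - 2 * dot y x0) x by exact: differentiableB.
have d2 : differentiable (fun y => 1 - sqnorm y) x by exact: differentiableB.
have d3 : differentiable (fun y => (1 + sqnorm x0 - 2 * dot y x0) * y 0 j) x by exact: differentiableM.
have d4 : differentiable (fun y => (1 - sqnorm y) * x0 0 j) x by exact: differentiableM.
rewrite /Yc partialM//; last exact: differentiableB.
rewrite partialB// !partialM// !partialB// !partialM// !partial_cst partial_sqnorm partial_dot partial_coord.
by move: (Hspace_neq0 hx0) => ?; field.
Qed.

Lemma dotDl x y z : dot (x + y) z = dot x z + dot y z.
Proof. by rewrite /dot -big_split/=; apply: eq_bigr => i _; rewrite mxE mulrDl. Qed.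

Lemma dotC x y : dot x y = dot y x.
Proof. by apply: eq_bigr => i _; rewrite mulrC. Qed.

Lemma dotZl c x y : dot (c *: x) y = c * dot x y.
Proof. by rewrite /dot mulr_sumr; apply: eq_bigr => i _; rewrite mxE mulrA. Qed.

Lemma dotxx x : dot x x = sqnorm x.
Proof. by apply: eq_bigr => i _; rewrite expr2. Qed.

(** This is |grad cosh r|^2 = sinh^2 r; the left-hand side is the hyperbolic squared norm of
    [Yc]. *)
Lemma sum_Yc_sqr x : U x -> rho x ^+ 2 * \sum_i Yc i x ^+ 2 = chF x ^+ 2 - 1.
Proof.
move=> Ux.
have -> : \sum_i Yc i x ^+ 2 = sqnorm (((1 + sqnorm x0 - 2 * dot x x0) / (1 - sqnorm x0)) *: x +
    (- ((1 - sqnorm x) / (1 - sqnorm x0))) *: x0).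
  by apply: eq_bigr => i _; rewrite !mxE /Yc; congr (_ ^+ 2); ring.
rewrite -dotxx dotDl !dotZl ![dot _ (_ + _)]dotC !dotDl !dotZl !dotxx [dot x0 x]dotC.
by rewrite /rho /chF; move: (Hspace_neq0 Ux) (Hspace_neq0 hx0) => ? ?; field; rewrite ?andbT; apply/andP.
Qed.

(** The trace of Hess (cosh r) = cosh r g in the chart. Along [Yc] the Euclidean metric is dilated
    at rate [kap], and since the partial derivatives of [rho] are rho^2 x_i, the logarithm of the
    conformal factor grows at rate rho times the sum of x_i Yc_i. *)
Lemma kap_rho x : U x -> kap x + rho x * \sum_i x 0 i * Yc i x = chF x.
Proof.
move=> Ux.
have -> : \sum_i x 0 i * Yc i x = ((1 + sqnorm x0 - 2 * dot x x0) / (1 - sqnorm x0)) * sqnorm x -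
    ((1 - sqnorm x) / (1 - sqnorm x0)) * dot x x0.
  rewrite /Yc; move: (1 + sqnorm x0 - _) (1 - sqnorm x0) (1 - sqnorm x) => a b c.
  by rewrite /sqnorm /dot !mulr_sumr -sumrB; apply: eq_bigr => i _; ring.
by rewrite /rho /chF /kap; move: (Hspace_neq0 Ux) (Hspace_neq0 hx0) => ? ?; field; rewrite ?andbT; apply/andP.
Qed.

(** The usual formula for cosh r - 1 in the ball; it shows positivity off the pole and relates [chF]
    to the Euclidean distance to the pole. *)
Lemma chF_sub1 x : U x -> chF x - 1 = 2 * sqnorm (x - x0) / ((1 - sqnorm x) * (1 - sqnorm x0)).
Proof.
move=> Ux; have -> : sqnorm (x - x0) = sqnorm x - 2 * dot x x0 + sqnorm x0.
  rewrite -!dotxx -scaleN1r dotDl !dotZl ![dot _ (_ + _)]dotC !dotDl !dotZl [dot x0 x]dotC; ring.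
by rewrite /chF; move: (Hspace_neq0 Ux) (Hspace_neq0 hx0) => ? ?; field; rewrite ?andbT; apply/andP.
Qed.

Lemma sqnorm_gt0 x : x != 0 -> 0 < sqnorm x.
Proof.
move=> xn0; rewrite lt_neqAle sumr_ge0 ?andbT; last by move=> i _; exact: sqr_ge0.
apply: contra xn0 => /eqP/esym/eqP; rewrite psumr_eq0; last by move=> i _; exact: sqr_ge0.
by move=> /allP h; apply/eqP/rowP => i; apply/eqP; rewrite mxE -sqrf_eq0; exact: (h i (mem_index_enum i)).
Qed.

Lemma sqnorm_ge0 x : 0 <= sqnorm x.
Proof. by rewrite /sqnorm sumr_ge0// => i _; exact: sqr_ge0. Qed.

Lemma chF_gt1 x : U x -> x != x0 -> 1 < chF x.
Proof.
move=> Ux xn; rewrite -subr_gt0 chF_sub1// divr_gt0// ?mulr_gt0 ?Hspace_gt0//.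
by rewrite sqnorm_gt0// subr_eq0.
Qed.

Lemma chF_ge1 x : U x -> 1 <= chF x.
Proof.
move=> Ux; rewrite -subr_ge0 chF_sub1// divr_ge0// ?mulr_ge0 ?sqnorm_ge0//; apply: ltW; exact: Hspace_gt0.
Qed.

Lemma chF_pole : chF x0 = 1.
Proof.
apply/eqP; rewrite -subr_eq0 chF_sub1// subrr.
by rewrite /sqnorm big1 ?mulr0 ?mul0r// => i _; rewrite mxE expr2 mulr0.
Qed.

End pole.
End hyperbolic_geometry.

#[export] Hint Resolve smooth_sqnorm smooth_dot open_Hspace : core.

Lemma sum_cauchy_schwarz (R : realType) (I : finType) (a b : I -> R) :
  (\sum_i a i * b i) ^+ 2 <= (\sum_i a i ^+ 2) * (\sum_i b i ^+ 2).
Proof.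
pose A := \sum_i a i ^+ 2; pose B := \sum_i b i ^+ 2; pose C := \sum_i a i * b i.
(* Lagrange's identity. *)
have E : \sum_i \sum_j (a i * b j - a j * b i) ^+ 2 = 2 * (A * B - C ^+ 2).
  have -> : 2 * (A * B - C ^+ 2) = A * B + B * A - 2 * (C * C) by ring.
  rewrite [A * B]mulr_suml [B * A]mulr_suml [C * C]mulr_suml mulr_sumr -sumrN -!big_split/=.
  apply: eq_bigr => i _; rewrite /A /B /C !mulr_sumr -sumrN -!big_split/=.
  by apply: eq_bigr => j _; ring.
have : 0 <= \sum_i \sum_j (a i * b j - a j * b i) ^+ 2.
  by apply: sumr_ge0 => i _; apply: sumr_ge0 => j _; exact: sqr_ge0.
by rewrite E -/A -/B -/C pmulr_rge0// subr_ge0.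
Qed.

(** * Gradient product, Laplacian, Green's formula and the conformal field of the pole *)

Section hyperbolic_operators.
Context {R : realType} {N : nat}.
Local Notation point := 'rV[R]_N.
Implicit Types (f g u v : point -> R) (x y : point) (i j : 'I_N) (W V : set point).
Local Notation U := (@Hspace R N).
Local Opaque partial.

(* The scalar product of the gradients of f and g; the metric is the conformal
   one, rho^2 |dx|^2. *)
Definition gp f g x : R := rho x ^- 2 * \sum_i partial i f x * partial i g x.

(** Divergence form for the metric rho^2 |dx|^2: rho^N is the volume density and rho^(-2) raises the
    index. The factors are kept apart so that rho^N cancels against the density in [hInt]. *)
Definition hlap u x : R :=
  rho x ^- N * \sum_i partial i (fun y => rho y ^+ N * (rho y ^- 2 * partial i u y)) x.

Lemma smooth_rhoX k W : W `<=` U -> smooth_on W (fun x => rho x ^+ k).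
Proof. by move=> WU; apply: (smooth_on_sub WU); apply: smooth_onX => //; exact: smooth_rho. Qed.

Lemma smooth_rhoXV k W : W `<=` U -> smooth_on W (fun x => rho x ^- k).
Proof.
move=> WU; apply: (smooth_on_sub WU); apply: smooth_onV => // [x Ux|].
  by rewrite expf_neq0// rho_neq0.
by apply: smooth_onX => //; exact: smooth_rho.
Qed.

Lemma differentiable_rhoX k x : U x -> differentiable (fun y : point => rho y ^+ k) x.
Proof. by move=> Ux; apply: smooth_on_diff Ux; apply: smooth_rhoX. Qed.

Lemma partial_rhoX k i x : U x ->
  partial i (fun y => rho y ^+ k) x = k%:R * rho x ^+ k.+1 * x 0 i.
Proof.
move=> Ux; elim: k => [|k IH]; first by rewrite partial_cst mul0r mul0r.
have dr : differentiable (@rho R N) x by exact: smooth_on_diff (@smooth_rho R N) Ux.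
have drk : differentiable (fun y => rho y ^+ k) x by exact: differentiable_rhoX.
have -> : (fun y => rho y ^+ k.+1) = fun y : point => rho y * rho y ^+ k.
  by apply/funext => y; rewrite exprS.
by rewrite partialM// IH partial_rho// -natr1 !exprS; ring.
Qed.

Lemma partial_rhoV2 i x : U x ->
  partial i (fun y => rho y ^- 2) x = - 2 * (rho x)^-1 * x 0 i.
Proof.
move=> Ux; have r0 := rho_neq0 Ux.
rewrite (@partialV _ _ (fun y => rho y ^+ 2)) ?expf_neq0//; last first.
  exact: differentiable_rhoX.
by rewrite partial_rhoX//; field.
Qed.

Lemma smooth_gp W f g : open W -> W `<=` U -> smooth_on W f -> smooth_on W g ->
  smooth_on W (gp f g).
Proof.
move=> oW WU sf sg; apply: smooth_onM => //; first exact: smooth_rhoXV.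
by apply: smooth_on_sum => // i; apply: smooth_onM => //; exact: smooth_on_partial.
Qed.

Lemma smooth_hlap W u : open W -> W `<=` U -> smooth_on W u -> smooth_on W (hlap u).
Proof.
move=> oW WU su; apply: smooth_onM => //; first exact: smooth_rhoXV.
apply: smooth_on_sum => // i; apply: smooth_on_partial.
apply: smooth_onM => //; first exact: smooth_rhoX.
by apply: smooth_onM => //; [exact: smooth_rhoXV|exact: smooth_on_partial].
Qed.

Lemma tf_hlap V u : open V -> V `<=` U -> tf V u -> tf V (hlap u).
Proof.
move=> oV VU [su [K [cK KV Ku]]]; split; first exact: smooth_hlap.
exists K; split => // x nK; rewrite /hlap big1 ?mulr0// => i _.
rewrite -[RHS](@partial_cst R N 0 x i); apply: partial_near.
apply: filterS (compact_complement_near cK nK) => y nKy.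
suff -> : partial i u y = 0 by rewrite !mulr0.
rewrite -[RHS](@partial_cst R N 0 y i); apply: partial_near.
by apply: filterS (compact_complement_near cK nKy) => z /Ku.
Qed.

Lemma tf_rho V f : open V -> V `<=` U -> tf V f -> tf V (fun x => rho x ^+ N * f x).
Proof. by move=> oV VU; apply: tfM => //; exact: smooth_rhoX. Qed.

Definition hInt f : R := Int (fun x => rho x ^+ N * f x).

Lemma hInt_green V u f : open V -> V `<=` U -> smooth_on V u -> tf V f ->
  hInt (fun x => hlap u x * f x) = - hInt (gp u f).
Proof.
move=> oV VU su tff.
pose G i y := rho y ^+ N * (rho y ^- 2 * partial i u y).
have sG i : smooth_on V (G i).
  apply: smooth_onM => //; first exact: smooth_rhoX.
  by apply: smooth_onM => //; [exact: smooth_rhoXV|exact: smooth_on_partial].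
have tGf i : tf V (fun y => G i y * f y) by exact: tfM.
have tp g : smooth_on V g -> tf V (gp g f).
  move=> sg; apply: tfM => //; first exact: smooth_rhoXV.
  by apply: tf_sum => // i; apply: tfM => //; [exact: smooth_on_partial|exact: tf_partial].
have t1 : tf V (fun x => rho x ^+ N * (hlap u x * f x)).
  by apply: tf_rho => //; apply: tfM => //; exact: smooth_hlap.
have t2 : tf V (fun x => rho x ^+ N * gp u f x) by apply: tf_rho => //; exact: tp.
apply/eqP; rewrite -addr_eq0 -IntD; [|exact: tf_cc t1|exact: tf_cc t2].
apply/eqP.
(* The two integrands add up to the Euclidean divergence of the field [G] multiplied by [f], which
   has compact support. *)
transitivity (Int (fun x => \sum_i partial i (fun y => G i y * f y) x)); last first.
  rewrite Int_sum; last by move=> i; exact: tf_cc (tf_partial i (tGf i)).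
  by rewrite big1// => i _; exact: tf_Int_partial (tGf i).
congr Int; apply/funext => x.
have [Vx|nV] := pselect (V x); last first.
  rewrite (tf_out t1 nV) (tf_out t2 nV) addr0 big1// => i _.
  exact: tf_out (tf_partial i (tGf i)) nV.
have Ux := VU _ Vx; have r0 := rho_neq0 Ux.
rewrite /hlap /gp !mulrA mulfV ?expf_neq0// mul1r mulr_suml mulr_sumr -big_split/=.
apply: eq_bigr => i _; rewrite [in RHS]partialM; first by rewrite /G; ring.
  exact: smooth_on_diff (sG i) Vx.
exact: tf_differentiable tff.
Qed.

Lemma tf_gpr V f g : open V -> V `<=` U -> smooth_on V f -> tf V g -> tf V (gp f g).
Proof.
move=> oV VU sf tg; apply: tfM => //; first exact: smooth_rhoXV.
by apply: tf_sum => // i; apply: tfM => //; [exact: smooth_on_partial|exact: tf_partial].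
Qed.

Lemma gpC f g x : gp f g x = gp g f x.
Proof. by rewrite /gp; congr (_ * _); apply: eq_bigr => i _; rewrite mulrC. Qed.

Lemma gp_ge0 f x : 0 <= gp f f x.
Proof.
rewrite mulr_ge0 ?invr_ge0 ?sqr_ge0//; apply: sumr_ge0 => i _.
by rewrite -expr2 sqr_ge0.
Qed.

Lemma gpDr f g h x : differentiable g x -> differentiable h x ->
  gp f (fun y => g y + h y) x = gp f g x + gp f h x.
Proof.
move=> dg dh; rewrite /gp -mulrDr -big_split/=; congr (_ * _).
by apply: eq_bigr => i _; rewrite partialD// mulrDr.
Qed.

Lemma gpMr f g h x : differentiable g x -> differentiable h x ->
  gp f (fun y => g y * h y) x = g x * gp f h x + h x * gp f g x.
Proof.
move=> dg dh; rewrite /gp ![_ * (rho x ^- 2 * _)]mulrCA -mulrDr; congr (_ * _).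
rewrite !mulr_sumr -big_split/=.
by apply: eq_bigr => i _; rewrite partialM//; ring.
Qed.

Section pole.
Variable x0 : point.
Hypothesis hx0 : U x0.
Local Notation Y := (Yc x0).
Local Notation F := (chF x0).

Definition Yop f x : R := \sum_i Y i x * partial i f x.

Lemma smooth_Yop W f : open W -> smooth_on W f -> smooth_on W (Yop f).
Proof.
move=> oW sf; apply: smooth_on_sum => // i; apply: smooth_onM => //; last exact: smooth_on_partial.
exact: smooth_Yc.
Qed.

Lemma tf_Yop V f : open V -> tf V f -> tf V (Yop f).
Proof.
move=> oV tff; apply: tf_sum => // i; apply: tfM => //; last exact: tf_partial.
exact: smooth_Yc.
Qed.

Lemma YopE f x : U x -> Yop f x = gp F f x.
Proof.
move=> Ux; rewrite /gp mulr_sumr; apply: eq_bigr => i _.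
by rewrite partial_chF//; have := rho_neq0 Ux => r0; field.
Qed.

Lemma Yop_chF x : U x -> Yop F x = F x ^+ 2 - 1.
Proof.
move=> Ux; rewrite -(sum_Yc_sqr hx0 Ux) mulr_sumr; apply: eq_bigr => i _.
by rewrite partial_chF//; ring.
Qed.

(** Cauchy-Schwarz in the hyperbolic metric, with sinh^2 r for the squared length of the field. It
    is the source of the nonnegativity of the angular form. *)
Lemma Yop_gp_sqr f x : U x -> Yop f x ^+ 2 <= (F x ^+ 2 - 1) * gp f f x.
Proof.
move=> Ux; rewrite -Yop_chF// !YopE// /gp; move: (rho x ^- 2) => c.
have := sum_cauchy_schwarz (fun i => partial i F x) (fun i => partial i f x).
rewrite /=; under [X in _ <= X * _]eq_bigr do rewrite expr2.
under [X in _ <= _ * X]eq_bigr do rewrite expr2.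
move: (\sum_i partial i F x * partial i f x) (\sum_i partial i F x * partial i F x).
move: (\sum_i partial i f x * partial i f x) => d a b abd.
have -> : c * b * (c * d) = c ^+ 2 * (b * d) by ring.
by rewrite exprMn ler_wpM2l// sqr_ge0.
Qed.

Lemma sum_sym_partial_Yc (a b : 'I_N -> R) x :
  \sum_i \sum_j partial i (Y j) x * (a j * b i + b j * a i) =
  2 * kap x0 x * \sum_i a i * b i.
Proof.
pose w i j := (2 * x 0 i * x0 0 j - 2 * x0 0 i * x 0 j) / (1 - sqnorm x0).
have E i j : partial i (Y j) x = (i == j)%:R * kap x0 x + w i j.
  by rewrite partial_Yc// /kap /w; ring.
(* The antisymmetric part of the Jacobian cancels against an expression symmetric in [i] and [j]. *)
have W0 : \sum_i \sum_j w i j * (a j * b i + b j * a i) = 0.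
  set S := LHS; suff : S + S = 0 by move: S => S ?; lra.
  rewrite {2}/S exchange_big /= -big_split/=.
  rewrite big1// => i _; rewrite -big_split/= big1// => j _.
  by rewrite /w; ring.
rewrite -[RHS]addr0 -[X in _ = _ + X]W0 mulr_sumr -big_split/=; apply: eq_bigr => i _.
rewrite (bigD1 i)//= [X in _ + X = _](_ : _ =
  \sum_(j | j != i) w i j * (a j * b i + b j * a i)); last first.
  apply: eq_bigr => j ji; rewrite E eq_sym (negbTE ji) mul0r add0r//.
rewrite [in RHS](bigD1 i)//= addrA; congr (_ + _).
by rewrite E eqxx mul1r; ring.
Qed.

Lemma sum_partial_Yc x : \sum_i partial i (Y i) x = N%:R * kap x0 x.
Proof.
have -> : N%:R * kap x0 x = \sum_(i < N) kap x0 x by rewrite sumr_const card_ord mulr_natl.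
by apply: eq_bigr => i _; rewrite partial_Yc// eqxx /kap; congr (_ / _); rewrite mul1r; ring.
Qed.

(** The field has hyperbolic divergence N cosh r: its Euclidean divergence is N [kap], the density
    rho^N contributes N rho times the sum of x_i Yc_i, and [kap_rho] adds them up. *)
Lemma hInt_Yop V f : open V -> V `<=` U -> tf V f ->
  hInt (Yop f) = - N%:R * hInt (fun x => F x * f x).
Proof.
move=> oV VU tff.
have sF : smooth_on V F by apply: (smooth_on_sub VU); exact: smooth_chF.
have t1 : tf V (fun x => rho x ^+ N * Yop f x) by apply: tf_rho => //; exact: tf_Yop.
have t2 : tf V (fun x => rho x ^+ N * (F x * f x)).
  by apply: tf_rho => //; exact: tfM.
have sG i : smooth_on V (fun y => rho y ^+ N * Y i y).
  by apply: smooth_onM => //; [exact: smooth_rhoX|exact: smooth_Yc].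
have tG i : tf V (fun y => (rho y ^+ N * Y i y) * f y) by exact: tfM.
apply/eqP; rewrite mulNr -addr_eq0 -IntZ; last exact: tf_cc t2.
rewrite -IntD; [|exact: tf_cc t1|by apply: ccZ; exact: tf_cc t2].
apply/eqP.
transitivity (Int (fun x => \sum_i partial i (fun y => (rho y ^+ N * Y i y) * f y) x)); last first.
  rewrite Int_sum; last by move=> i; exact: tf_cc (tf_partial i (tG i)).
  by rewrite big1// => i _; exact: tf_Int_partial (tG i).
congr Int; apply/funext => x.
have [Vx|nV] := pselect (V x); last first.
  rewrite (tf_out t1 nV) (tf_out t2 nV) mulr0 addr0 big1// => i _.
  exact: tf_out (tf_partial i (tG i)) nV.
have Ux := VU _ Vx; have r0 := rho_neq0 Ux.
have dY i : differentiable (Y i) x by exact: smooth_on_diff (smooth_Yc _ i oV) Vx.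
have dr : differentiable (fun y => rho y ^+ N) x by exact: smooth_on_diff (smooth_rhoX N VU) Vx.
have E i : partial i (fun y => (rho y ^+ N * Y i y) * f y) x =
   rho x ^+ N * (Y i x * partial i f x) + rho x ^+ N * f x * partial i (Y i) x
   + N%:R * rho x ^+ N * f x * rho x * (x 0 i * Y i x).
  rewrite partialM//; [|exact: smooth_on_diff (sG i) Vx|exact: tf_differentiable tff].
  by rewrite partialM// partial_rhoX// exprS; ring.
rewrite (eq_bigr _ (fun i _ => E i)) !big_split/= -!mulr_sumr sum_partial_Yc -(kap_rho hx0 Ux).
by rewrite /Yop; ring.
Qed.

(** Conformality: the Lie derivative of the metric along the field is 2 cosh r times the metric,
    hence -2 cosh r times the product of covectors. In coordinates, the antisymmetric part of the
    Jacobian drops out and [partialC] exchanges the second derivatives. *)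
Lemma Yop_gp u f W x : open W -> W `<=` U -> W x -> smooth_on W u -> smooth_on W f ->
  gp (Yop u) f x + gp u (Yop f) x = Yop (gp u f) x + 2 * F x * gp u f x.
Proof.
move=> oW WU Wx su sf.
have Ux := WU _ Wx; have r0 := rho_neq0 Ux.
have dY i : differentiable (Y i) x by exact: smooth_on_diff (smooth_Yc _ i oW) Wx.
have dp g i : smooth_on W g -> differentiable (partial i g) x.
  by move=> sg; exact: smooth_on_diff (smooth_on_partial i sg) Wx.
have pY g i : smooth_on W g -> partial i (Yop g) x =
   \sum_j (partial i (Y j) x * partial j g x + Y j x * partial i (partial j g) x).
  move=> sg; rewrite partial_sum; last by move=> j; apply: differentiableM => //; exact: dp.
  by apply: eq_bigr => j _; rewrite partialM//; exact: dp.
have pg j : partial j (gp u f) x = - 2 * (rho x)^-1 * x 0 j * (\sum_i partial i u x * partial i f x) +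
   rho x ^- 2 * \sum_i (partial i (partial j u) x * partial i f x + partial i u x * partial i (partial j f) x).
  rewrite partialM; last 2 first.
  - exact: smooth_on_diff (smooth_rhoXV 2 WU) Wx.
  - by apply: differentiable_bigsum => i; apply: differentiableM; exact: dp.
  rewrite partial_rhoV2//; congr (_ + _ * _).
  rewrite partial_sum; last by move=> i; apply: differentiableM; exact: dp.
  apply: eq_bigr => i _; rewrite partialM; [|exact: dp|exact: dp].
  by rewrite (partialC i j oW Wx su) (partialC i j oW Wx sf).
transitivity (rho x ^- 2 * (2 * kap x0 x * (\sum_i partial i u x * partial i f x) +
  \sum_j Y j x * \sum_i (partial i (partial j u) x * partial i f x +
           partial i u x * partial i (partial j f) x))).
  rewrite -sum_sym_partial_Yc /gp -mulrDr; congr (_ * _).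
  rewrite [X in _ = _ + X](eq_bigr _ (fun j _ => mulr_sumr _ _ _ _)).
  rewrite [X in _ = _ + X]exchange_big/= -!big_split/=; apply: eq_bigr => i _.
  rewrite (pY u i su) (pY f i sf) mulr_suml mulr_sumr -!big_split/=; apply: eq_bigr => j _.
  generalize (partial i (Y j) x), (partial j (Y i) x), (partial i (partial j u) x), (partial i (partial j f) x).
  generalize (partial i u x), (partial j u x), (partial i f x), (partial j f x), (Y j x) => *; ring.
rewrite -(kap_rho hx0 Ux) /Yop.
under [in RHS]eq_bigr do rewrite pg mulrDr.
rewrite big_split/=.
have -> : \sum_i Y i x * (- 2 * (rho x)^-1 * x 0 i * (\sum_i0 partial i0 u x * partial i0 f x)) =
   - 2 * (rho x)^-1 * (\sum_i x 0 i * Y i x) * (\sum_i0 partial i0 u x * partial i0 f x).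
  move: (\sum_i0 _ * partial _ f x) => Q.
  by rewrite mulr_sumr mulr_suml; apply: eq_bigr => i _; ring.
have -> : \sum_j Y j x * (rho x ^- 2 * \sum_i (partial i (partial j u) x * partial i f x +
           partial i u x * partial i (partial j f) x)) =
   rho x ^- 2 * \sum_j Y j x * \sum_i (partial i (partial j u) x * partial i f x +
           partial i u x * partial i (partial j f) x).
  by rewrite mulr_sumr; apply: eq_bigr => j _; rewrite mulrCA.
rewrite /gp; field; exact: r0.
Qed.

End pole.
End hyperbolic_operators.

(** * Radial derivative and angular form on the punctured ball *)

Section off_pole.
Context {R : realType} {N : nat}.
Local Notation point := 'rV[R]_N.
Implicit Types (f g u v h : point -> R) (x y : point) (i j : 'I_N) (W : set point).
Local Notation U := (@Hspace R N).
Local Opaque partial.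

Lemma YopD (x0 : point) f g x : differentiable f x -> differentiable g x ->
  Yop x0 (fun y => f y + g y) x = Yop x0 f x + Yop x0 g x.
Proof.
move=> df dg; rewrite /Yop -big_split; apply: eq_bigr => i _.
by rewrite partialD// mulrDr.
Qed.

Lemma YopM (x0 : point) f g x : differentiable f x -> differentiable g x ->
  Yop x0 (fun y => f y * g y) x = Yop x0 f x * g x + f x * Yop x0 g x.
Proof.
move=> df dg; rewrite /Yop mulr_suml mulr_sumr -big_split; apply: eq_bigr => i _.
by rewrite partialM//=; ring.
Qed.

Lemma YopV (x0 : point) f x : differentiable f x -> f x != 0 ->
  Yop x0 (fun y => (f y)^-1) x = - (Yop x0 f x / f x ^+ 2).
Proof.
move=> df f0; rewrite /Yop mulr_suml -sumrN; apply: eq_bigr => i _.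
by rewrite partialV// mulrN mulrA.
Qed.

Lemma Yop_cst (x0 : point) c x : Yop x0 (fun=> c) x = 0.
Proof. by rewrite /Yop big1// => i _; rewrite partial_cst mulr0. Qed.

Lemma Yop_open (x0 : point) W f g x : open W -> W x -> (forall y, W y -> f y = g y) ->
  Yop x0 f x = Yop x0 g x.
Proof. by move=> oW Wx fg; apply: eq_bigr => i _; congr (_ * _); exact: partial_open Wx fg. Qed.

Definition punctured (x0 : point) : set point := U `&` [set x | x != x0].

Lemma open_punctured x0 : open (punctured x0).
Proof.
apply: openI => //; rewrite (_ : [set x | x != x0] = ~` [set x0]).
  apply: closed_openC; exact: accessible_closed_set1 (hausdorff_accessible (@norm_hausdorff R _)) _.
by apply/seteqP; split => x /= /eqP.
Qed.
Hint Resolve open_punctured : core.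

Lemma puncturedW x0 : punctured x0 `<=` U.
Proof. by move=> x []. Qed.
Hint Resolve puncturedW : core.

Lemma tf_punctured x0 f : tf (punctured x0) f -> tf U f.
Proof. by move=> tff; apply: tf_sub tff _ _. Qed.

Section pole.
Variable x0 : point.
Hypothesis hx0 : U x0.
Local Notation F := (chF x0).
Local Notation V := (punctured x0).

(* sinh of the distance to [x0]; the exponential, unlike [Num.sqrt], keeps it
   positive at the pole as well (junk value). *)
Definition shS x : R := expR (ln (F x ^+ 2 - 1) / 2).
Local Notation S := shS.

Lemma shS_gt0 x : 0 < S x. Proof. exact: expR_gt0. Qed.

Lemma shS_neq0 x : S x != 0. Proof. by rewrite gt_eqF// shS_gt0. Qed.

Lemma chF2_sub1_gt0 x : V x -> 0 < F x ^+ 2 - 1.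
Proof. by move=> [Ux xx0]; have := chF_gt1 hx0 Ux xx0; nra. Qed.

Lemma shS_sqr x : V x -> S x ^+ 2 = F x ^+ 2 - 1.
Proof.
move=> Vx; rewrite /shS -expRM_natl mulrCA divff// mulr1 lnK//.
by rewrite posrE chF2_sub1_gt0.
Qed.

Lemma smoothV_chF : smooth_on V F.
Proof. exact: smooth_on_sub (smooth_chF hx0). Qed.

Lemma smoothV_shS : smooth_on V S.
Proof.
apply: smooth_on_expR => //; apply: smooth_onM => //.
apply: smooth_on_ln => //; first exact: chF2_sub1_gt0.
by apply: smooth_onB => //; apply: smooth_onX => //; exact: smoothV_chF.
Qed.

Lemma smoothV_shSV : smooth_on V (fun x => (S x)^-1).
Proof. by apply: smooth_onV => // [x _|]; [exact: shS_neq0|exact: smoothV_shS]. Qed.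

(* The distance to [x0], in closed form.  Only [logD x <= Hdist x x0] is needed:
   the weights of the inequality decrease in the distance. *)
Definition logD x : R := ln (F x + S x).
Local Notation D := logD.

Lemma chF_add_shS_gt1 x : V x -> 1 < F x + S x.
Proof. by move=> [Ux xx0]; have := chF_gt1 hx0 Ux xx0; have := shS_gt0 x; lra. Qed.

Lemma smoothV_logD : smooth_on V D.
Proof.
apply: smooth_on_ln => // [x Vx|]; first by have := chF_add_shS_gt1 Vx; lra.
by apply: smooth_onD => //; [exact: smoothV_chF|exact: smoothV_shS].
Qed.

Lemma logD_gt0 x : V x -> 0 < D x.
Proof. by move=> Vx; rewrite ln_gt0// chF_add_shS_gt1. Qed.

Lemma smoothV_logDV : smooth_on V (fun x => (D x)^-1).
Proof.
by apply: smooth_onV => // [x Vx|]; [rewrite gt_eqF// logD_gt0|exact: smoothV_logD].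
Qed.

Lemma expR_logD x : V x -> expR (D x) = F x + S x.
Proof. by move=> Vx; rewrite lnK// posrE; have := chF_add_shS_gt1 Vx; lra. Qed.

Lemma sinh_logD x : V x -> sinh (D x) = S x.
Proof.
move=> Vx; rewrite /sinh expRN expR_logD//.
have := chF_add_shS_gt1 Vx; have := shS_sqr Vx; move: (S x) (F x) => s c sc cs.
have -> : (c + s)^-1 = c - s.
  have c0 : c + s != 0 by rewrite gt_eqF//; lra.
  by apply: (mulfI c0); rewrite mulfV//; nra.
by field.
Qed.

(* The radial derivative. *)
Definition Zop f x : R := Yop x0 f x / S x.

Lemma YopZ f x : Yop x0 f x = S x * Zop f x.
Proof. by rewrite /Zop mulrCA divff ?mulr1// shS_neq0. Qed.

Lemma smooth_Zop f : smooth_on V f -> smooth_on V (Zop f).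
Proof.
by move=> sf; apply: smooth_onM => //; [exact: smooth_Yop|exact: smoothV_shSV].
Qed.

Lemma tf_Zop f : tf V f -> tf V (Zop f).
Proof. by move=> tff; apply: tfMr => //; [exact: smoothV_shSV|exact: tf_Yop]. Qed.

Lemma ZopD f g x : differentiable f x -> differentiable g x ->
  Zop (fun y => f y + g y) x = Zop f x + Zop g x.
Proof. by move=> df dg; rewrite /Zop YopD// mulrDl. Qed.

Lemma ZopM f g x : differentiable f x -> differentiable g x ->
  Zop (fun y => f y * g y) x = Zop f x * g x + f x * Zop g x.
Proof. by move=> df dg; rewrite /Zop YopM//; ring. Qed.

Lemma ZopV f x : differentiable f x -> f x != 0 ->
  Zop (fun y => (f y)^-1) x = - (Zop f x / f x ^+ 2).
Proof. by move=> df f0; rewrite /Zop YopV//; ring. Qed.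

Lemma Zop_cst c x : Zop (fun=> c) x = 0.
Proof. by rewrite /Zop Yop_cst mul0r. Qed.

Lemma Zop_chF x : V x -> Zop F x = S x.
Proof.
move=> Vx; rewrite /Zop Yop_chF//; last by case: Vx.
by rewrite -shS_sqr// expr2 mulfK// shS_neq0.
Qed.

Lemma partial_shS i x : V x -> partial i S x = F x / S x * partial i F x.
Proof.
move=> Vx.
have dS : differentiable S x by exact: smooth_on_diff smoothV_shS Vx.
have dF : differentiable F x by exact: smooth_on_diff smoothV_chF Vx.
(* Differentiating the relation S^2 = F^2 - 1, valid on an open set, bypasses the exponential and
   the logarithm of the definition of [shS]. *)
have : partial i (fun y => S y * S y) x = partial i (fun y => F y * F y - 1) x.
  apply: (@partial_open _ _ V) => // y Vy; by rewrite -!expr2 shS_sqr.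
rewrite partialB; [|exact: differentiableM|exact: differentiable_cst].
rewrite partial_cst (partialM i dS dS) (partialM i dF dF) => E; apply: (mulIf (shS_neq0 x)).
have -> : F x / S x * partial i F x * S x = F x * partial i F x.
  by move: (shS_neq0 x) => ?; field.
lra.
Qed.

Lemma Zop_shS x : V x -> Zop S x = F x.
Proof.
move=> Vx; have -> : Zop S x = F x / S x * Zop F x.
  rewrite /Zop /Yop mulrA mulr_sumr; congr (_ / _); apply: eq_bigr => i _.
  by rewrite partial_shS//; ring.
by rewrite Zop_chF// divfK// shS_neq0.
Qed.

Lemma partial_logD i x : V x -> partial i D x = partial i F x / S x.
Proof.
move=> Vx.
have dS : differentiable S x by exact: smooth_on_diff smoothV_shS Vx.
have dF : differentiable F x by exact: smooth_on_diff smoothV_chF Vx.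
have p0 : 0 < F x + S x by have := chF_add_shS_gt1 Vx; lra.
have dFS : differentiable (fun y => F y + S y) x by exact: differentiableD.
have [_ ->] := partial_comp1 dFS (is_derive1_ln p0).
rewrite partialD// partial_shS//.
by move: (shS_neq0 x) => ?; field; rewrite (gt_eqF p0) andbT.
Qed.

Lemma Zop_logD x : V x -> Zop D x = 1.
Proof.
move=> Vx; have -> : Zop D x = Zop F x / S x.
  rewrite /Zop /Yop; congr (_ / _); rewrite mulr_suml; apply: eq_bigr => i _.
  by rewrite partial_logD//; ring.
by rewrite Zop_chF// divff// shS_neq0.
Qed.

Lemma hInt_ext f g : (forall x, V x -> f x = g x) -> tf V f -> tf V g -> hInt f = hInt g.
Proof.
move=> fg tff tfg; congr Int; apply/funext => x.
have [Vx|nV] := pselect (V x); first by rewrite fg.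
by rewrite (tf_out tff nV) (tf_out tfg nV).
Qed.

Lemma hIntD f g : tf V f -> tf V g -> hInt (fun x => f x + g x) = hInt f + hInt g.
Proof.
move=> tff tfg; rewrite /hInt -IntD; last 2 first.
- exact: tf_cc (tf_rho (@open_punctured x0) (@puncturedW x0) tff).
- exact: tf_cc (tf_rho (@open_punctured x0) (@puncturedW x0) tfg).
by congr Int; apply/funext => x; rewrite mulrDr.
Qed.

Lemma hIntZ c f : tf V f -> hInt (fun x => c * f x) = c * hInt f.
Proof.
move=> tff; rewrite /hInt -IntZ; last first.
  exact: tf_cc (tf_rho (@open_punctured x0) (@puncturedW x0) tff).
by congr Int; apply/funext => x; rewrite mulrCA.
Qed.

Lemma hIntN f : tf V f -> hInt (fun x => - f x) = - hInt f.
Proof.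
move=> tff; rewrite -mulN1r -hIntZ//; congr hInt; apply/funext => x.
by rewrite mulN1r.
Qed.

Lemma le_hInt f g : tf V f -> tf V g -> (forall x, V x -> f x <= g x) -> hInt f <= hInt g.
Proof.
move=> tff tfg fg; apply: le_Int.
- exact: tf_cc (tf_rho (@open_punctured x0) (@puncturedW x0) tff).
- exact: tf_cc (tf_rho (@open_punctured x0) (@puncturedW x0) tfg).
move=> x; have [Vx|nV] := pselect (V x); last by rewrite (tf_out tff nV) (tf_out tfg nV).
by rewrite ler_wpM2l ?fg// exprn_ge0// ltW// rho_gt0//; exact: puncturedW Vx.
Qed.

Lemma tf_cothM f : tf V f -> tf V (fun x => F x / S x * f x).
Proof.
move=> tff; apply: tfM => //.
by apply: smooth_onM => //; [exact: smoothV_chF|exact: smoothV_shSV].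
Qed.

(** The unit radial field has divergence (N - 1) coth r. This is [hInt_Yop] applied to f / S, whose
    derivative along the field is Z f - coth r f. *)
Lemma hInt_Zop f : tf V f ->
  hInt (Zop f) = (1 - N%:R) * hInt (fun x => F x / S x * f x).
Proof.
move=> tff.
have tg : tf V (fun x => f x * (S x)^-1) by apply: tfMr => //; exact: smoothV_shSV.
have tFf : tf V (fun x => F x / S x * f x) by exact: tf_cothM.
have := hInt_Yop hx0 (@open_punctured x0) (@puncturedW x0) tg.
have -> : hInt (fun x => F x * (f x * (S x)^-1)) = hInt (fun x => F x / S x * f x).
  by congr hInt; apply/funext => x; ring.
have -> : hInt (Yop x0 (fun x => f x * (S x)^-1)) = hInt (fun x => Zop f x + - 1 * (F x / S x * f x)).
  apply: hInt_ext.
  - move=> x Vx; have dS : differentiable S x by exact: smooth_on_diff smoothV_shS Vx.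
    rewrite YopM; [|exact: tf_differentiable tff|by apply: differentiableV => //; exact: shS_neq0].
    rewrite YopV ?shS_neq0// [Yop x0 S x]YopZ Zop_shS// /Zop.
    by move: (shS_neq0 x) => ?; field.
  - exact: tf_Yop.
  - by apply: tfD => //; [exact: tf_Zop|apply: tfM => //; exact: smooth_on_cst].
rewrite hIntD; [|exact: tf_Zop|by apply: tfM => //; exact: smooth_on_cst].
by rewrite hIntZ// => E; lra.
Qed.

Definition hdim : R := (N%:R - 1) / 2.
Local Notation k := hdim.

(* [Lop] is [Zop] conjugated by S^k, the square root of the density of the
   volume in polar coordinates; hence it is antisymmetric for [hInt]. *)
Definition Lop f x : R := Zop f x + k * (F x / S x * f x).

Lemma smoothV_coth : smooth_on V (fun x => F x / S x).
Proof. by apply: smooth_onM => //; [exact: smoothV_chF|exact: smoothV_shSV]. Qed.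

Lemma tf_Lop f : tf V f -> tf V (Lop f).
Proof.
move=> tff; apply: tfD => //; first exact: tf_Zop.
by apply: tfM => //; exact: tf_cothM.
Qed.

(** Z(h) + 2 k coth r h integrates to zero. With h = H f g, [Lop] shares the term 2 k coth r equally
    between [f] and [g], so [H] alone is differentiated by [Zop]. *)
Lemma hInt_exact H f g : smooth_on V H -> tf V f -> tf V g ->
  hInt (fun x => Zop H x * f x * g x + H x * (Lop f x * g x + f x * Lop g x)) = 0.
Proof.
move=> sH tff tfg.
have t1 : tf V (fun x => H x * f x) by exact: tfM.
have t2 : tf V (fun x => H x * f x * g x) by apply: tfM => //; case: t1.
have E := hInt_Zop t2.
have -> : hInt (fun x => Zop H x * f x * g x + H x * (Lop f x * g x + f x * Lop g x)) =
   hInt (fun x => Zop (fun y => H y * f y * g y) x + 2 * k * (F x / S x * (H x * f x * g x))).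
  apply: hInt_ext.
  - move=> x Vx; have dH : differentiable H x by exact: smooth_on_diff sH Vx.
    rewrite ZopM; [|exact: tf_differentiable t1|exact: tf_differentiable tfg].
    rewrite ZopM//; last exact: tf_differentiable tff.
    by rewrite /Lop; ring.
  - have sLg := (tf_Lop tfg).1; have sg := tfg.1.
    apply: tfD => //.
      by apply: tfMr => //; apply: tfM => //; exact: smooth_Zop.
    apply: tfM => //; apply: tfD => //; first by apply: tfMr => //; exact: tf_Lop.
    by apply: tfMr.
  - apply: tfD => //; first exact: tf_Zop.
    by apply: tfM => //; exact: tf_cothM.
rewrite hIntD; [|exact: tf_Zop|by apply: tfM => //; exact: tf_cothM].
rewrite hIntZ; last exact: tf_cothM.
by rewrite E /hdim; field.
Qed.

(* The angular part of [gp]. *)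
Definition qh f g x : R := gp f g x - Zop f x * Zop g x.

Lemma qhC f g x : qh f g x = qh g f x.
Proof. by rewrite /qh gpC [Zop f x * _]mulrC. Qed.

Lemma tf_qh f g : smooth_on V f -> tf V g -> tf V (qh f g).
Proof.
move=> sf tfg; apply: tfD => //; first exact: tf_gpr.
by apply: tfN => //; apply: tfM => //; [exact: smooth_Zop|exact: tf_Zop].
Qed.

Lemma qh_ge0 f x : V x -> 0 <= qh f f x.
Proof.
move=> Vx; have Ux := puncturedW Vx.
rewrite /qh subr_ge0 /Zop mulrACA -!expr2 exprVn ler_pdivrMr ?exprn_gt0 ?shS_gt0//.
by rewrite shS_sqr// mulrC; exact: Yop_gp_sqr.
Qed.

Lemma gp_chF f x : V x -> gp f F x = S x * Zop f x.
Proof. by move=> Vx; rewrite gpC -YopE ?YopZ//; exact: puncturedW Vx. Qed.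

(** Dependence on the distance alone, phrased on gradients: proportionality to the gradient of
    [chF]. Products and compositions then need only the product and chain rules. *)
Definition radial h := exists c : point -> R, forall i x, V x -> partial i h x = c x * partial i F x.

Lemma qh_radial f h x : V x -> radial h -> qh f h x = 0.
Proof.
move=> Vx [c hc].
have -> : qh f h x = c x * qh f F x.
  rewrite /qh mulrBr; congr (_ - _).
    rewrite /gp mulrCA; congr (_ * _); rewrite mulr_sumr; apply: eq_bigr => i _.
    by rewrite hc//; ring.
  rewrite [RHS]mulrCA; congr (_ * _); rewrite /Zop /Yop mulrA; congr (_ / _).
  by rewrite mulr_sumr; apply: eq_bigr => i _; rewrite hc//; ring.
by rewrite /qh gp_chF// Zop_chF// [Zop f x * _]mulrC subrr mulr0.
Qed.

Lemma qhMr f h g x : differentiable h x -> differentiable g x -> V x -> radial h ->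
  qh f (fun y => h y * g y) x = h x * qh f g x.
Proof.
move=> dh dg Vx rh; have := qh_radial f Vx rh; rewrite /qh gpMr// ZopM// => E.
have -> : gp f h x = Zop f x * Zop h x by lra.
ring.
Qed.

Lemma qhDr f h g x : differentiable h x -> differentiable g x ->
  qh f (fun y => h y + g y) x = qh f h x + qh f g x.
Proof. by move=> dh dg; rewrite /qh gpDr// ZopD//; ring. Qed.

Lemma radial_shS : radial S.
Proof. by exists (fun x => F x / S x) => i x; exact: partial_shS. Qed.

Lemma radial_coth : radial (fun x => F x / S x).
Proof.
have [c hc] := radial_shS.
exists (fun x => (S x)^-1 - F x * c x / S x ^+ 2) => i x Vx.
have dF : differentiable F x by exact: smooth_on_diff smoothV_chF Vx.
have dS : differentiable S x by exact: smooth_on_diff smoothV_shS Vx.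
have dV : differentiable (fun y => (S y)^-1) x by exact: smooth_on_diff smoothV_shSV Vx.
rewrite partialM// partialV ?shS_neq0// hc//; move: (shS_neq0 x) => ?; by field.
Qed.

(** Divide [Yop_gp] by [S]. Since [S] varies, the sum of the products of Z f with g and of f with Z
    g acquires the term -2 coth r (Z f) (Z g), which turns 2 coth r times the full product into 2
    coth r times its angular part. *)
Lemma Zop_qh f g x : V x -> smooth_on V f -> smooth_on V g ->
  Zop (qh f g) x = qh (Zop f) g x + qh f (Zop g) x - 2 * (F x / S x) * qh f g x.
Proof.
move=> Vx sf sg.
have dd h : smooth_on V h -> differentiable h x by move=> sh; exact: smooth_on_diff sh Vx.
have gpZ f' g' : smooth_on V f' -> smooth_on V g' ->
    gp f' (Zop g') x = (S x)^-1 * gp f' (Yop x0 g') x - F x / S x * (Zop f' x * Zop g' x).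
  move=> sf' sg'; rewrite gpMr; [|exact/dd/smooth_Yop|exact/dd/smoothV_shSV].
  have -> : gp f' (fun y => (S y)^-1) x = - (F x / S x ^+ 3) * gp f' F x.
    rewrite /gp mulrCA; congr (_ * _); rewrite mulr_sumr; apply: eq_bigr => i _.
    rewrite partialV ?shS_neq0//; last exact/dd/smoothV_shS.
    by rewrite partial_shS//; move: (shS_neq0 x) => ?; field.
  by rewrite gp_chF// YopZ; move: (shS_neq0 x) => ?; field.
have E := Yop_gp hx0 (@open_punctured x0) (@puncturedW x0) Vx sf sg.
rewrite /qh ZopD; [|exact/dd/smooth_gp|]; last first.
  by apply/dd/smooth_onN => //; apply: smooth_onM => //; exact: smooth_Zop.
have -> : Zop (fun y => - (Zop f y * Zop g y)) x = - (Zop (Zop f) x * Zop g x + Zop f x * Zop (Zop g) x).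
  rewrite -ZopM; [|exact/dd/smooth_Zop|exact/dd/smooth_Zop].
  rewrite /Zop -mulNr; congr (_ / _); rewrite /Yop -sumrN; apply: eq_bigr => i _.
  rewrite partialN ?mulrN//; apply: differentiableM; exact/dd/smooth_Zop.
rewrite [gp (Zop f) g x]gpC !gpZ// [gp g (Yop x0 f) x]gpC.
have -> : gp (Yop x0 f) g x = Yop x0 (gp f g) x + 2 * F x * gp f g x - gp f (Yop x0 g) x by lra.
have -> : Zop (gp f g) x = (S x)^-1 * Yop x0 (gp f g) x by rewrite /Zop mulrC.
move: (shS_neq0 x) (Zop (Zop f) x) (Zop (Zop g) x) (Zop f x) (Zop g x).
move: (Yop x0 (gp f g) x) (gp f (Yop x0 g) x) (gp f g x) (F x) (S x) => a1 a2 a3 c s s0 z1 z2 z3 z4.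
by field.
Qed.

End pole.
End off_pole.

#[export] Hint Resolve open_punctured puncturedW : core.

Lemma le_sinh (R : realType) (s : R) : 0 <= s -> s <= sinh s.
Proof.
move=> s0; pose g (r : R) := expR r - expR (- r) - 2 * r.
have dg (r : R) : is_derive r 1 g (expR r + expR (- r) - 2).
  have d1 : is_derive r 1 (fun r : R => expR (- r)) (expR (- r) * -1).
    exact: (@is_derive1_comp _ expR -%R).
  rewrite /g; apply: is_derive_eq.
  by rewrite /GRing.scale/=; ring.
have h1 (r : R) : r \in `]0, +oo[ -> derivable g r 1 by move=> _; case: (dg r).
have h2 (r : R) : r \in `]0, +oo[ -> 0 <= g^`()%classic r.
  move=> _; rewrite derive1E; case: (dg r) => _ ->.
  (* The derivative of twice (sinh r - r) is a square. *)
  have -> : expR r + expR (- r) - 2 = (expR (r / 2) - expR (- (r / 2))) ^+ 2.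
    rewrite sqrrB -!expRM_natl -expRD subrr expR0.
    have -> : 2 * (r / 2) = r by field.
    have -> : 2 * - (r / 2) = - r by field.
    by rewrite mulr2n; ring.
  exact: sqr_ge0.
have h3 : {within `[0, +oo[, continuous g}.
  by apply: derivable_within_continuous => r _; case: (dg r).
have := ger0_derive1_ndecry h1 h2 h3 (lexx 0) s0.
rewrite /g oppr0 subrr mulr0 subr0 /sinh => gs.
by rewrite ler_pdivlMr//; lra.
Qed.

(** * The radial inequality for functions supported off the pole *)

Section rellich_off_pole.
Context {R : realType} {N : nat}.
Local Notation point := 'rV[R]_N.
Implicit Types (f g u v h e : point -> R) (x y : point) (i j : 'I_N).
Local Notation U := (@Hspace R N).
Local Opaque partial.
Variable x0 : point.
Hypothesis hx0 : U x0.
Local Notation F := (chF x0).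
Local Notation V := (punctured x0).
Local Notation S := (shS x0).
Local Notation D := (logD x0).
Local Notation Z := (Zop x0).
Local Notation L := (Lop x0).
Local Notation k := (@hdim R N).
Local Notation m := (k ^+ 2 - k).

Definition rlogD x : R := (D x)^-1.
Definition rshS x : R := (S x)^-1.
Definition cothD x : R := F x / S x.
Local Notation t := rlogD.
Local Notation p := rshS.
Local Notation w := cothD.

Lemma smooth_rlogD : smooth_on V t. Proof. exact: smoothV_logDV. Qed.
Lemma smooth_rshS : smooth_on V p. Proof. exact: smoothV_shSV. Qed.
Lemma smooth_cothD : smooth_on V w. Proof. exact: smoothV_coth. Qed.

Lemma cothD_sqr x : V x -> w x ^+ 2 = 1 + p x ^+ 2.
Proof.
move=> Vx; rewrite /cothD /rshS exprMn exprVn.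
have -> : F x ^+ 2 = S x ^+ 2 + 1 by rewrite shS_sqr//; ring.
by move: (shS_neq0 x0 x) => s0; field.
Qed.

Lemma Zop_rlogD x : V x -> Z t x = - t x ^+ 2.
Proof.
move=> Vx; rewrite /rlogD ZopV; first by rewrite Zop_logD// div1r exprVn.
  exact: smooth_on_diff (smoothV_logD hx0) Vx.
by rewrite gt_eqF// logD_gt0.
Qed.

Lemma Zop_rshS x : V x -> Z p x = - (w x * p x).
Proof.
move=> Vx; rewrite /rshS ZopV ?shS_neq0//; last exact: smooth_on_diff (smoothV_shS hx0) Vx.
by rewrite Zop_shS// /cothD; move: (shS_neq0 x0 x) => s0; field.
Qed.

Lemma Zop_cothD x : V x -> Z w x = - p x ^+ 2.
Proof.
move=> Vx; rewrite /cothD ZopM; last 2 first.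
- exact: smooth_on_diff (smoothV_chF hx0) Vx.
- exact: smooth_on_diff smooth_rshS Vx.
rewrite Zop_chF// (Zop_rshS Vx).
have -> : F x * - (w x * p x) = - w x ^+ 2 by rewrite /cothD /rshS; ring.
by rewrite cothD_sqr// /rshS; move: (shS_neq0 x0 x) => s0; field.
Qed.

(** The exact terms of the proof. Integrals are compared through [hInt_mod] and [le_hInt_mod]: a
    pointwise relation between integrands modulo such terms, which reduces each integration by parts
    to an algebraic identity. *)
Definition Null e := tf V e /\ hInt e = 0.

Lemma NullD e e' : Null e -> Null e' -> Null (fun x => e x + e' x).
Proof. by move=> [te e0] [te' e'0]; split; [exact: tfD|rewrite (hIntD te te') e0 e'0 addr0]. Qed.

Lemma NullZ c e : Null e -> Null (fun x => c * e x).
Proof.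
move=> [te e0]; split; last by rewrite (hIntZ _ te) e0 mulr0.
by apply: tfM => //.
Qed.

Lemma Null_Z f : tf V f -> Null (fun x => Z f x + 2 * k * (w x * f x)).
Proof.
move=> tff; have t1 : tf V (Z f) by exact: tf_Zop.
have t2 : tf V (fun x => w x * f x) by exact: tf_cothM.
have t3 : tf V (fun x => 2 * k * (w x * f x)) by apply: tfM => //.
by split; [exact: tfD|rewrite (hIntD t1 t3) (hIntZ _ t2) (hInt_Zop hx0 tff) /cothD /hdim; field].
Qed.

Lemma Null_exact H f g : smooth_on V H -> tf V f -> tf V g ->
  Null (fun x => Z H x * f x * g x + H x * (L f x * g x + f x * L g x)).
Proof.
move=> sH tff tfg; split; last exact: hInt_exact.
have sg := tfg.1; apply: tfD => //.
  by apply: tfMr => //; apply: tfM => //; exact: smooth_Zop.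
apply: tfM => //; apply: tfD => //; first by apply: tfMr => //; exact: tf_Lop.
by apply: tfM => //; [exact: tff.1|exact: tf_Lop].
Qed.

Lemma hInt_mod f g e : tf V f -> tf V g -> Null e ->
  (forall x, V x -> f x = g x + e x) -> hInt f = hInt g.
Proof.
move=> tff tfg [te e0] fge; rewrite -[RHS]addr0 -e0 -(hIntD tfg te).
by apply: (hInt_ext fge) => //; exact: tfD.
Qed.

Lemma le_hInt_mod f g e : tf V f -> tf V g -> Null e ->
  (forall x, V x -> f x <= g x + e x) -> hInt f <= hInt g.
Proof.
move=> tff tfg [te e0] fge; rewrite -[leRHS]addr0 -e0 -(hIntD tfg te).
by apply: (le_hInt _ _ fge) => //; exact: tfD.
Qed.

(* The radial part Z^2 + 2 k coth D Z of the Laplacian. *)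
Definition Rop u x : R := L (L u) x - (k ^+ 2 + m * p x ^+ 2) * u x.

Lemma smooth_q : smooth_on V (fun x => k ^+ 2 + m * p x ^+ 2).
Proof.
apply: smooth_onD => //.
apply: smooth_onM => //.
by apply: smooth_onX => //; exact: smooth_rshS.
Qed.

Lemma tf_Rop u : tf V u -> tf V (Rop u).
Proof.
move=> tu; apply: tfD => //; first by do 2 apply: tf_Lop => //.
by apply: tfN => //; apply: tfM => //; exact: smooth_q.
Qed.

(** As Z coth = -p^2 and coth^2 = 1 + p^2, the zero-order part of L (L u) is (k^2 + m p^2) u,
    exactly what the definition of [Rop] subtracts. *)
Lemma RopE u x : smooth_on V u -> V x -> Rop u x = Z (Z u) x + 2 * k * (w x * Z u x).
Proof.
move=> su Vx.
have dd h : smooth_on V h -> differentiable h x by move=> sh; exact: smooth_on_diff sh Vx.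
have sZu : smooth_on V (Z u) by exact: smooth_Zop.
have swu : smooth_on V (fun y => w y * u y) by apply: smooth_onM => //; exact: smooth_cothD.
rewrite /Rop {1}/Lop; have -> : Z (L u) x = Z (Z u) x + k * (- p x ^+ 2 * u x + w x * Z u x).
  rewrite /Lop ZopD; [|exact: dd|apply/dd/smooth_onM => //; exact: smooth_on_cst].
  rewrite ZopM ?Zop_cst ?mul0r ?add0r; [|exact/dd/smooth_on_cst|exact: dd].
  by rewrite ZopM ?Zop_cothD//; [exact/dd/smooth_cothD|exact: dd].
rewrite /Lop -/(w x); have := cothD_sqr Vx => ww.
have -> : k * (w x * (Z u x + k * (w x * u x))) = k * w x * Z u x + k ^+ 2 * u x * w x ^+ 2 by ring.
by rewrite ww; ring.
Qed.

Lemma ZopX f n x : V x -> smooth_on V f -> Z (fun y => f y ^+ n) x = n%:R * f x ^+ n.-1 * Z f x.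
Proof.
move=> Vx sf; elim: n => [|n IH]; first by rewrite Zop_cst mul0r mul0r.
under [fun y => _]eq_fun do rewrite exprS.
rewrite ZopM; [|exact: smooth_on_diff sf Vx|exact: smooth_on_diff (smooth_onX n (@open_punctured R N x0) sf) Vx].
rewrite IH -natr1 /=; case: n {IH} => [|n]; first by rewrite expr0; ring.
by rewrite /= exprS; ring.
Qed.

Lemma ZopZ c f x : V x -> smooth_on V f -> Z (fun y => c * f y) x = c * Z f x.
Proof.
move=> Vx sf; rewrite ZopM ?Zop_cst ?mul0r ?add0r//.
exact: smooth_on_diff sf Vx.
Qed.

Lemma Zop_q x : V x -> Z (fun x => k ^+ 2 + m * p x ^+ 2) x = - 2 * m * (w x * p x ^+ 2).
Proof.
move=> Vx; have sp2 : smooth_on V (fun x => p x ^+ 2) by apply: smooth_onX => //; exact: smooth_rshS.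
rewrite ZopD ?Zop_cst ?add0r; last 2 first.
- exact: differentiable_cst.
- by apply: smooth_on_diff Vx; apply: smooth_onM => //.
by rewrite ZopZ// ZopX//; [rewrite Zop_rshS//=; ring|exact: smooth_rshS].
Qed.

Lemma smooth_cothD_rshS2 : smooth_on V (fun x => w x * p x ^+ 2).
Proof. by apply: smooth_onM => //; [exact: smooth_cothD|apply: smooth_onX => //; exact: smooth_rshS]. Qed.

Lemma Zop_cothD_rshS2 x : V x -> Z (fun x => w x * p x ^+ 2) x = - 2 * p x ^+ 2 - 3 * p x ^+ 4.
Proof.
move=> Vx; have sp2 : smooth_on V (fun x => p x ^+ 2) by apply: smooth_onX => //; exact: smooth_rshS.
rewrite ZopM; [|exact: smooth_on_diff smooth_cothD Vx|exact: smooth_on_diff sp2 Vx].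
rewrite ZopX ?Zop_rshS ?Zop_cothD//=; last exact: smooth_rshS.
have ww := cothD_sqr Vx.
have -> : w x * (2 * p x ^+ 1 * - (w x * p x)) = - 2 * p x ^+ 2 * w x ^+ 2 by ring.
by rewrite ww; ring.
Qed.

Lemma hInt_Rop_sqr c u : tf V u ->
  hInt (fun x => Rop u x ^+ 2 - c * Z u x ^+ 2) =
  hInt (fun x => L (L u) x ^+ 2 + (2 * (k ^+ 2 + m * p x ^+ 2) - c) * L u x ^+ 2 +
    ((k ^+ 2 + m * p x ^+ 2) * (k ^+ 2 + m * p x ^+ 2 - c) - m * (4 * p x ^+ 2 + 6 * p x ^+ 4)) * u x ^+ 2).
Proof.
move=> tu; have tLu : tf V (L u) by exact: tf_Lop.
have sw2 : smooth_on V (fun x => - 2 * m * (w x * p x ^+ 2)).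
  by apply: smooth_onM => //; exact: smooth_cothD_rshS2.
(* The term [n1] removes u L(L u) from the expanded square and leaves a multiple of u L u, which
   [n2] turns into a multiple of u^2; [n3] does the same for the cross term of (Z u)^2 = (L u - k
   coth u)^2. *)
have n1 := NullZ (- 2) (Null_exact smooth_q tu tLu).
have n2 := Null_exact sw2 tu tu.
have n3 := NullZ (c * k) (Null_exact smooth_cothD tu tu).
have sp n : smooth_on V (fun x => p x ^+ n) by apply: smooth_onX => //; exact: smooth_rshS.
have tsq h : tf V h -> tf V (fun x => h x ^+ 2).
  by move=> th; under eq_fun do rewrite expr2; apply: tfM => //; exact: th.1.
apply: (hInt_mod _ _ (NullD (NullD n1 n2) n3)).
- apply: tfD => //; first by apply: tsq; exact: tf_Rop.
  apply: tfN => //; apply: tfM => //.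
  by apply: tsq; exact: tf_Zop.
- apply: tfD => //; first apply: tfD => //.
  + by apply: tsq; exact: tf_Lop.
  + apply: tfM => //; last exact: tsq.
    apply: smooth_onB => //.
    by apply: smooth_onM => //; exact: smooth_q.
  + apply: tfM => //; last exact: tsq.
    apply: smooth_onB => //.
      apply: smooth_onM => //; first exact: smooth_q.
      by apply: smooth_onB => //; exact: smooth_q.
    apply: smooth_onM => //.
    by apply: smooth_onD => //; apply: smooth_onM => //.
move=> x Vx; rewrite Zop_q// ZopZ//; last exact: smooth_cothD_rshS2.
rewrite Zop_cothD_rshS2// Zop_cothD// /Rop.
have -> : Z u x = L u x - k * (w x * u x) by rewrite /Lop -/(w x); ring.
have ww := cothD_sqr Vx; move: (L (L u) x) (L u x) (u x) (w x) (p x) ww => a2 a1 a W P ww.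
have -> : c * (a1 - k * (W * a)) ^+ 2 = c * a1 ^+ 2 - 2 * c * k * W * a * a1 + c * k ^+ 2 * a ^+ 2 * W ^+ 2 by ring.
by rewrite ww; ring.
Qed.

Lemma hInt_radial_ge u : tf V u -> 2 <= k ->
  hInt (fun x => (k ^+ 2 / 4 * t x ^+ 2 + 9 / 16 * t x ^+ 4 + m * (k ^+ 2 - 2) * p x ^+ 2 +
     m * (m - 3 / 2) * p x ^+ 4) * u x ^+ 2) <=
  hInt (fun x => Rop u x ^+ 2 - k ^+ 2 * Z u x ^+ 2).
Proof.
move=> tu k2; rewrite hInt_Rop_sqr//.
have tLu : tf V (L u) by exact: tf_Lop.
have st n : smooth_on V (fun x => t x ^+ n) by apply: smooth_onX => //; exact: smooth_rlogD.
have sp n : smooth_on V (fun x => p x ^+ n) by apply: smooth_onX => //; exact: smooth_rshS.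
have tsq h : tf V h -> tf V (fun x => h x ^+ 2).
  by move=> th; under eq_fun do rewrite expr2; apply: tfM => //; exact: th.1.
have stp : smooth_on V (fun x => t x * p x ^+ 2) by apply: smooth_onM => //; exact: smooth_rlogD.
have sH : smooth_on V (fun x => w x * p x ^+ 2 + 1 / 2 * (t x * p x ^+ 2)).
  apply: smooth_onD => //; first exact: smooth_cothD_rshS2.
  by apply: smooth_onM => //.
(* Four Hardy inequalities, each with its square. [n1]: (L L u)^2 yields t^2 (L u)^2 / 4. [n2]: this
   in turn, with the shift 3 t / 2 suited to the weight t^2, yields 9/16 t^4 u^2. [n3]: k^2 (L u)^2
   yields k^2 t^2 u^2 / 4. [n4]: 2 m p^2 (L u)^2, with the shift coth + t / 2, yields (2 m p^2 + 4 m
   p^4 + m t^2 p^2 / 2) u^2. *)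
have n1 := NullZ (- (1 / 2)) (Null_exact smooth_rlogD tLu tLu).
have n2 := NullZ (- (3 / 8)) (Null_exact (st 3%N) tu tu).
have n3 := NullZ (- (k ^+ 2 / 2)) (Null_exact smooth_rlogD tu tu).
have n4 := NullZ (- (2 * m)) (Null_exact sH tu tu).
apply: (le_hInt_mod _ _ (NullD (NullD n1 n2) (NullD n3 n4))).
- apply: tfM => //; last exact: tsq.
  by do ![apply: smooth_onD => //]; apply: smooth_onM => //.
- apply: tfD => //; first apply: tfD => //.
  + by apply: tsq; exact: tf_Lop.
  + apply: tfM => //; last exact: tsq.
    apply: smooth_onB => //.
    by apply: smooth_onM => //; exact: smooth_q.
  + apply: tfM => //; last exact: tsq.
    apply: smooth_onB => //.
      apply: smooth_onM => //; first exact: smooth_q.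
      by apply: smooth_onB => //; exact: smooth_q.
    apply: smooth_onM => //.
    by apply: smooth_onD => //; apply: smooth_onM => //.
move=> x Vx; rewrite Zop_rlogD// ZopX//; last exact: smooth_rlogD.
rewrite Zop_rlogD//= ZopD; last 2 first.
- exact: smooth_on_diff smooth_cothD_rshS2 Vx.
- by apply: smooth_on_diff Vx; apply: smooth_onM => //.
rewrite Zop_cothD_rshS2// ZopZ// ZopM; [|exact: smooth_on_diff smooth_rlogD Vx|exact: smooth_on_diff (sp 2%N) Vx].
rewrite Zop_rlogD// ZopX//; last exact: smooth_rshS.
rewrite Zop_rshS//=.
have ww := cothD_sqr Vx.
have pt : p x <= t x.
  by rewrite lef_pV2 ?posrE ?shS_gt0 ?logD_gt0// -sinh_logD// le_sinh// ltW// logD_gt0.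
have p0 : 0 < p x by rewrite invr_gt0 shS_gt0.
move: k2 ww pt p0; move: (L (L u) x) (L u x) (u x) (w x) (p x) (t x) => a2 a1 a W P T.
move: k => K K2 ww PT P0.
rewrite -subr_ge0; set X := (X in 0 <= X).
(* The term m t^2 p^2 / 2 is lowered to m p^4 / 2. The coefficients of m p^2 and m p^4 left by
   [hInt_Rop_sqr], k^2 - 4 and m - 6, thus become k^2 - 4 + 2 and m - 6 + 4 + 1/2. The last summand
   vanishes by coth^2 = 1 + p^2. *)
have -> : X = (a2 - T * a1 / 2) ^+ 2 + 1 / 4 * T ^+ 2 * (a1 - 3 / 2 * T * a) ^+ 2 +
   K ^+ 2 * (a1 - T * a / 2) ^+ 2 + 2 * (K ^+ 2 - K) * P ^+ 2 * (a1 - (W + T / 2) * a) ^+ 2 +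
   (K ^+ 2 - K) / 2 * P ^+ 2 * a ^+ 2 * (T ^+ 2 - P ^+ 2)
   - 2 * (K ^+ 2 - K) * P ^+ 2 * a ^+ 2 * (W ^+ 2 - (1 + P ^+ 2)).
  by rewrite /X; field.
rewrite ww subrr mulr0 subr0.
have m0 : 0 <= K ^+ 2 - K by nra.
have TP : 0 <= T ^+ 2 - P ^+ 2 by nra.
have mul_sqr_ge0 (c y : R) : 0 <= c -> 0 <= c * y ^+ 2 by move=> c0; rewrite mulr_ge0// sqr_ge0.
do ![apply: addr_ge0]; rewrite ?sqr_ge0//.
- by do 2!apply: (mul_sqr_ge0 _ _).
- by apply: (mul_sqr_ge0 _ _); exact: sqr_ge0.
- by do 2!apply: (mul_sqr_ge0 _ _); rewrite mulr_ge0.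
- by apply: mulr_ge0 => //; do 2!apply: (mul_sqr_ge0 _ _); rewrite divr_ge0.
Qed.

End rellich_off_pole.

(** * The angular part of the Laplacian and the inequality off the pole *)

Section angular_part.
Context {R : realType} {N : nat}.
Local Notation point := 'rV[R]_N.
Implicit Types (f g u v h e : point -> R) (x y : point) (i j : 'I_N).
Local Notation U := (@Hspace R N).
Local Opaque partial.
Variable x0 : point.
Hypothesis hx0 : U x0.
Local Notation V := (punctured x0).
Local Notation Z := (Zop x0).
Local Notation k := (@hdim R N).
Local Notation m := (k ^+ 2 - k).
Local Notation t := (rlogD x0).
Local Notation p := (rshS x0).
Local Notation w := (cothD x0).
Local Notation Rop := (Rop x0).
Local Notation qh := (qh x0).

Lemma tf_sqr f : tf V f -> tf V (fun x => f x ^+ 2).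
Proof. by move=> tff; under eq_fun do rewrite expr2; apply: tfM => //; exact: tff.1. Qed.

Lemma hInt_Zop_Zop_Rop u f : tf V u -> tf V f ->
  hInt (fun x => Z u x * Z f x) = - hInt (fun x => Rop u x * f x).
Proof.
move=> tu tf_f; have tZu : tf V (Z u) by exact: tf_Zop.
have tZuf : tf V (fun x => Z u x * f x) by apply: tfM => //; exact: tZu.1.
have tRf : tf V (fun x => Rop u x * f x) by apply: tfM => //; exact: (tf_Rop hx0 tu).1.
rewrite -(hIntN tRf); apply: (hInt_mod _ _ (Null_Z hx0 tZuf)).
- by apply: tfM => //; [exact: tZu.1|exact: tf_Zop].
- exact: tfN.
move=> x Vx; rewrite RopE//; last exact: tu.1.
rewrite ZopM; [|exact: tf_differentiable tZu|exact: tf_differentiable tf_f].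
by ring.
Qed.

Lemma hInt_hlap u f : tf V u -> tf V f ->
  hInt (fun x => hlap u x * f x) = hInt (fun x => Rop u x * f x) - hInt (qh u f).
Proof.
move=> tu tf_f; rewrite (hInt_green _ _ tu.1 tf_f)//.
have tZf : tf V (fun x => Z u x * Z f x).
  by apply: tfM => //; [exact: (tf_Zop hx0 tu).1|exact: tf_Zop].
have -> : hInt (gp u f) = hInt (fun x => qh u f x + Z u x * Z f x).
  by congr hInt; apply/funext => x; rewrite /qh subrK.
rewrite (hIntD (tf_qh hx0 tu.1 tf_f) tZf) hInt_Zop_Zop_Rop//; ring.
Qed.

Lemma hInt_angular_ge u : tf V u -> 2 <= k ->
  k ^+ 2 * hInt (qh u u) <= - 2 * hInt (qh u (Rop u)).
Proof.
move=> tu k2.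
have su := tu.1; have sF := smoothV_chF hx0; have sS := smoothV_shS hx0.
have tZu : tf V (Z u) by exact: tf_Zop.
have tZZu : tf V (Z (Z u)) by exact: tf_Zop.
have tR : tf V (Rop u) by exact: tf_Rop.
have sw := smooth_cothD hx0.
have dd h x : V x -> smooth_on V h -> differentiable h x by move=> Vx sh; exact: smooth_on_diff sh Vx.
pose Q0 := qh u u; pose Q1 := qh u (Z u); pose Q2 := qh (Z u) (Z u).
have tQ0 : tf V Q0 by apply: tf_qh.
have tQ1 : tf V Q1 by apply: tf_qh.
have tQ2 : tf V Q2 by apply: tf_qh => //; exact: tZu.1.
have twQ0 : tf V (fun x => w x * Q0 x) by exact: tfM.
have twQ1 : tf V (fun x => w x * Q1 x) by exact: tfM.
have tZf c f : tf V f -> tf V (fun x => c * f x) by move=> tff; apply: tfM => //.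
have tQR : tf V (qh u (Rop u)) by exact: tf_qh.
rewrite -(hIntZ _ tQ0) -(hIntZ _ tQR).
(* The first exact term trades q(u, Z Z u) for q(Z u, Z u); the second supplies the multiple of coth
   q(u, Z u) that completes the square, together with (4 k^2 - 4 k) coth^2 q(u, u). *)
apply: (le_hInt_mod _ _ (NullD (NullZ 2 (Null_Z hx0 tQ1)) (NullZ (2 * k) (Null_Z hx0 twQ0)))).
- exact: tZf.
- exact: tZf.
move=> x Vx.
have -> : qh u (Rop u) x = qh u (Z (Z u)) x + 2 * k * w x * Q1 x.
  have -> : qh u (Rop u) x = qh u (fun y => Z (Z u) y + 2 * k * (w y * Z u y)) x.
    have RE : forall y, V y -> Rop u y = Z (Z u) y + 2 * k * (w y * Z u y) by move=> y Vy; exact: RopE.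
    have oV := @open_punctured R N x0.
    rewrite /qh /gp /Zop (Yop_open _ oV Vx RE).
    congr (_ * _ - _); apply: eq_bigr => i _; congr (_ * _).
    exact: (partial_open _ oV Vx RE).
  have s1 : smooth_on V (fun y => w y * Z u y) by apply: smooth_onM => //; exact: tZu.1.
  have s2 : smooth_on V (fun y => 2 * k * (w y * Z u y)).
    by apply: smooth_onM => //.
  rewrite qhDr; [|exact: dd Vx tZZu.1|exact: dd Vx s2].
  rewrite qhMr//; [|exact: dd Vx s1|by exists (fun=> 0) => i y _; rewrite partial_cst mul0r].
  rewrite qhMr//; [by rewrite mulrA|exact: dd Vx sw|exact: dd Vx tZu.1|exact: radial_coth].
have ZQ1 := Zop_qh hx0 Vx su tZu.1.
have ZQ0 := Zop_qh hx0 Vx su su.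
have dQ0 : differentiable Q0 x by exact: tf_differentiable tQ0.
rewrite [Z (fun y => w y * Q0 y) x]ZopM//; last exact: dd Vx sw.
rewrite Zop_cothD//.
(* The value of the angular form at Z u + (k - 1) coth u: coth is radial, so it comes out of the
   form as a factor. *)
have pos : 0 <= Q2 x + 2 * ((k - 1) * w x) * Q1 x + ((k - 1) * w x) ^+ 2 * Q0 x.
  pose c y := (k - 1) * w y.
  have sc : smooth_on V c by apply: smooth_onM => //.
  have rc : radial x0 c.
    have [b hb] := radial_coth hx0; exists (fun y => (k - 1) * b y) => i y Vy.
    by rewrite partialZ ?hb ?mulrA//; exact: dd Vy sw.
  have scu : smooth_on V (fun y => c y * u y) by exact: smooth_onM.
  have := qh_ge0 hx0 (fun y => Z u y + c y * u y) Vx.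
  have dcu := dd _ _ Vx scu; have dZu := dd _ _ Vx tZu.1; have dc := dd _ _ Vx sc; have du := dd _ _ Vx su.
  rewrite qhDr// (qhMr hx0 _ dc du Vx rc) ![qh (fun y => Z u y + c y * u y) _ x]qhC !qhDr// !(qhMr hx0 _ dc du Vx rc).
  rewrite [qh (Z u) u x]qhC -/(Q0 x) -/(Q1 x) -/(Q2 x) /c => h.
  by apply: le_trans h _; rewrite le_eqVlt; apply/orP; left; apply/eqP; ring.
move: ZQ0 ZQ1; rewrite -/(Q0 x) -/(Q1 x) -/(Q2 x) -/(cothD x0 x) [qh (Z u) u x]qhC -/(Q1 x).
move=> -> ->.
have Q0ge : 0 <= Q0 x by exact: qh_ge0.
have ww := cothD_sqr hx0 Vx.
have PW : 0 <= p x ^+ 2 by exact: sqr_ge0.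
move: k2 pos Q0ge ww PW.
move: (Q0 x) (Q1 x) (Q2 x) (qh u (Z (Z u)) x) (w x) (p x) k => q0 q1 q2 q3 W P K K2 pos q0g ww PW.
rewrite -subr_ge0; set X := (X in 0 <= X).
have -> : X = 2 * (q2 + 2 * ((K - 1) * W) * q1 + ((K - 1) * W) ^+ 2 * q0) +
   q0 * ((2 * K ^+ 2 - 2) * W ^+ 2 - 2 * K * P ^+ 2 - K ^+ 2).
  by rewrite /X; ring.
apply: addr_ge0; first by rewrite mulr_ge0.
apply: mulr_ge0 => //; rewrite ww.
have -> : (2 * K ^+ 2 - 2) * (1 + P ^+ 2) - 2 * K * P ^+ 2 - K ^+ 2 =
   (K ^+ 2 - 2) + (2 * K ^+ 2 - 2 * K - 2) * P ^+ 2 by ring.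
by rewrite addr_ge0//; [nra|rewrite mulr_ge0//; nra].
Qed.

(** The four weights of the statement, with [logD] for the distance and with coefficients rewritten
    through N = 2 k + 1. *)
Definition hweight x : R := k ^+ 2 / 4 * t x ^+ 2 + 9 / 16 * t x ^+ 4 + m * (k ^+ 2 - 2) * p x ^+ 2 +
     m * (m - 3 / 2) * p x ^+ 4.

Lemma rellich_off_pole u : tf V u -> 2 <= k ->
  hInt (fun x => hweight x * u x ^+ 2) <=
  hInt (fun x => hlap u x ^+ 2) - k ^+ 2 * hInt (gp u u).
Proof.
move=> tu k2.
have tZu : tf V (Z u) by exact: tf_Zop.
have tR : tf V (Rop u) by exact: tf_Rop.
have tl : tf V (hlap u) by exact: tf_hlap.
have tZf c f : tf V f -> tf V (fun x => c * f x) by move=> tff; apply: tfM => //.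
have tlR : tf V (fun x => hlap u x * Rop u x) by apply: tfM => //; exact: tl.1.
(* The integral of the square of Delta u - R u is nonnegative. *)
have h1 : 2 * hInt (fun x => hlap u x * Rop u x) - hInt (fun x => Rop u x ^+ 2) <=
    hInt (fun x => hlap u x ^+ 2).
  rewrite -(hIntZ _ tlR) -(hIntN (tf_sqr tR)).
  rewrite -(hIntD (tZf 2 _ tlR) (tfN (@open_punctured R N x0) (tf_sqr tR))).
  apply: (@le_hInt _ _ x0); [|exact: tf_sqr|].
    by apply: tfD => //; [exact: tZf|apply: tfN => //; exact: tf_sqr].
  move=> x _; rewrite -subr_ge0.
  have -> : hlap u x ^+ 2 - (2 * (hlap u x * Rop u x) + - Rop u x ^+ 2) = (hlap u x - Rop u x) ^+ 2 by ring.
  exact: sqr_ge0.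
have h2 := hInt_hlap tu tR.
have h3 := hInt_angular_ge tu k2.
have h4 := hInt_radial_ge hx0 tu k2.
have h5 : hInt (gp u u) = hInt (qh u u) + hInt (fun x => Z u x ^+ 2).
  rewrite -(hIntD (tf_qh hx0 tu.1 tu) (tf_sqr tZu)).
  by congr hInt; apply/funext => x; rewrite /qh expr2 subrK.
have h6 : hInt (fun x => Rop u x ^+ 2 - k ^+ 2 * Z u x ^+ 2) =
   hInt (fun x => Rop u x ^+ 2) - k ^+ 2 * hInt (fun x => Z u x ^+ 2).
  have tkZ := tZf (k ^+ 2) _ (tf_sqr tZu).
  by rewrite -(hIntZ _ (tf_sqr tZu)) -(hIntN tkZ) -(hIntD (tf_sqr tR) (tfN (@open_punctured R N x0) tkZ)).
have h7 : hInt (fun x => Rop u x * Rop u x) = hInt (fun x => Rop u x ^+ 2).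
  by congr hInt; apply/funext => x; rewrite expr2.
rewrite h5; rewrite h7 in h2; rewrite h6 in h4.
apply: le_trans h4 _.
move: h1 h2 h3.
move: (hInt (fun x => hlap u x * Rop u x)) (hInt (fun x => Rop u x ^+ 2)) (hInt (fun x => hlap u x ^+ 2)).
move: (hInt (qh u u)) (hInt (qh u (Rop u))) (hInt (fun x => Z u x ^+ 2)) => a b c d e f.
by move=> h1 h2 h3; nra.
Qed.

(** Delta u and R u have the same pairing with every test function, since the angular form of a
    radial function vanishes; testing against Delta u and then against R u gives the equality of the
    norms. *)
Lemma hInt_radial_hlap u : tf V u -> radial x0 u ->
  hInt (fun x => hlap u x ^+ 2) = hInt (fun x => Rop u x ^+ 2).
Proof.
move=> tu ru.
have tR : tf V (Rop u) by exact: tf_Rop.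
have tl : tf V (hlap u) by exact: tf_hlap.
have q0 f : tf V f -> hInt (qh u f) = 0.
  move=> tff; rewrite -(mul0r (hInt (qh u f))) -(hIntZ _ (tf_qh hx0 tu.1 tff)).
  apply: (@hInt_ext _ _ x0); last 2 first.
  - exact: tf_qh tu.1 tff.
  - by apply: tfM => //; exact: tf_qh tu.1 tff.
  by move=> x Vx; rewrite qhC (qh_radial hx0 f Vx ru) mul0r.
have E1 := hInt_hlap tu tl; have E2 := hInt_hlap tu tR.
rewrite q0// subr0 in E1; rewrite q0// subr0 in E2.
transitivity (hInt (fun x => hlap u x * hlap u x)); first by congr hInt; apply/funext => x; rewrite expr2.
rewrite E1; transitivity (hInt (fun x => hlap u x * Rop u x)).
  by congr hInt; apply/funext => x; rewrite mulrC.
by rewrite E2; congr hInt; apply/funext => x; rewrite expr2.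
Qed.

End angular_part.

(** * A smooth step function built from exp(-1/t) *)

Section flat_function.
Context {R : realType}.
Implicit Types (p q : {poly R}) (t y : R).

Lemma exprn_mul_expRN n y : 0 <= y -> y ^+ n * expR (- y) <= n`!%:R.
Proof.
move=> y0; rewrite expRN ler_pdivrMr ?expR_gt0//.
case: n => [|n]; first by rewrite expr0 fact0 mul1r -expR0 ler_expR.
have := expR_ge1Dxn n y0; rewrite -ler_pdivrMl ?ltr0n ?fact_gt0// [_^-1 * _]mulrC.
by apply: le_trans; rewrite lerDr.
Qed.

Lemma horner_mul_expRN_bounded p : exists C, forall y, 0 <= y -> `|p.[y]| * expR (- y) <= C.
Proof.
exists (\sum_(i < size p) `|p`_i| * (i`!)%:R) => y y0.
rewrite horner_coef; apply: (@le_trans _ _ ((\sum_(i < size p) `|p`_i * y ^+ i|) * expR (- y))).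
  by rewrite ler_wpM2r ?expR_ge0// ler_norm_sum.
rewrite mulr_suml; apply: ler_sum => i _.
by rewrite normrM (ger0_norm (exprn_ge0 _ y0)) -mulrA ler_wpM2l// exprn_mul_expRN.
Qed.

(** The polynomial in 1/t makes this a family closed under derivation, as [smooth_on_comp] requires;
    exp(-1/t) itself is [flat 1]. *)
Definition flat p t : R := if 0 < t then p.[t^-1] * expR (- t^-1) else 0.

Lemma is_derive_flat p t : is_derive t 1 (flat p) (flat ('X^2 * (p - p^`())) t).
Proof.
have [t0|t0|->] := ltgtP t 0.
- apply: (@near_eq_is_derive _ _ _ (cst 0)).
  + by near=> s; rewrite /flat ltNge (ltW _)//; near: s; exact: lt_nbhsl.
  + by rewrite /flat ltNge ltW//; exact: is_derive_cst.
- apply: (@near_eq_is_derive R R R (fun s : R => p.[s^-1] * expR (- s^-1) : R)).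
    by near=> s; rewrite /flat ifT//; near: s; exact: lt_nbhsr.
  have tn0 : t != 0 by rewrite gt_eqF.
  have dV : is_derive t 1 (fun s : R => s^-1) (- t ^- 2).
    apply: is_derive_eq; first exact: (is_deriveV tn0 (is_derive_id t 1)).
    by rewrite /GRing.scale/= mulr1.
  have dp : is_derive t^-1 1 (horner p) (p^`().[t^-1]).
    by apply: DeriveDef; [exact: derivable_horner|rewrite -derive1E -derivE].
  have d1 := is_derive1_comp dp dV.
  have d2 : is_derive t 1 (fun s : R => - s^-1) (- - t ^- 2) by exact: is_deriveN.
  have d3 := @is_derive1_comp R expR (fun s : R => - s^-1) t _ _ (is_derive_expR (- t^-1)) d2.
  have d4 : is_derive t 1 (fun s : R => p.[s^-1] * expR (- s^-1)) _ := is_deriveM d1 d3.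
  apply: (is_derive_eq d4).
  rewrite /flat t0 /GRing.scale/= !hornerE /=.
  by move: (expR _) (p^`().[_]) (p.[_]) => a b c; field.
(* At 0 the difference quotient at h > 0 is h times h^(-2) p(1/h) exp(-1/h), and the latter factor
   is bounded. *)
- have [C hC] := horner_mul_expRN_bounded ('X^2 * p).
  have flat0 q : flat q 0 = 0 by rewrite /flat ltxx.
  have cv : (fun h => h^-1 *: (flat p (h *: 1 + 0) - flat p 0)) @ 0^' --> (0 : R).
    apply/cvgrPdist_le => e e0.
    have C0 : 0 < `|C| + 1 by rewrite ltr_wpDl.
    near=> h; rewrite sub0r normrN flat0 subr0 addr0 [h *: 1]mulr1 normrM.
    rewrite /flat; case: ifPn => h0; last by rewrite normr0 mulr0 ltW.
    have hn0 : h != 0 by rewrite gt_eqF.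
    have hC' : h^-1 ^+ 2 * `|p.[h^-1]| * expR (- h^-1) <= C.
      have := hC h^-1; rewrite invr_ge0 ltW// => /(_ isT).
      by rewrite !hornerE normrM (ger0_norm (sqr_ge0 _)).
    have -> : `|h^-1| * `|p.[h^-1] * expR (- h^-1)| =
        h * (h^-1 ^+ 2 * `|p.[h^-1]| * expR (- h^-1)).
      have -> : `|h^-1| = h^-1 by rewrite ger0_norm// invr_ge0 ltW.
      by rewrite normrM (ger0_norm (expR_ge0 _)); move: `|p.[_]| (expR _) => a b; field.
    apply: (@le_trans _ _ (h * (`|C| + 1))).
      by rewrite ler_wpM2l ?ltW// (le_lt_trans hC')// (le_lt_trans (ler_norm _))// ltrDl.
    rewrite -ler_pdivlMr// ltW//; apply: le_lt_trans (ler_norm _) _.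
    near: h; apply: dnbhs0_lt; exact: divr_gt0.
  rewrite flat0; apply: DeriveDef; first by apply/cvg_ex; exists 0.
  exact: (cvg_lim (@norm_hausdorff _ _) cv).
Unshelve. all: by end_near. Qed.

Lemma smooth_on_flat n (W : set 'rV[R]_n) (f : 'rV[R]_n -> R) p : open W -> smooth_on W f ->
  smooth_on W (fun x => flat p (f x)).
Proof.
move=> oW; apply: (@smooth_on_comp _ _ setT (fun g => exists p, g = flat p)) => //.
  move=> _ [q ->]; exists (flat ('X^2 * (q - q^`()))); first by eexists.
  by move=> t _; exact: is_derive_flat.
by exists p.
Qed.

Lemma flat1_gt0 t : 0 < t -> 0 < flat 1 t.
Proof. by move=> t0; rewrite /flat t0 hornerE mul1r expR_gt0. Qed.

Lemma flat1_ge0 t : 0 <= flat 1 t.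
Proof. by rewrite /flat; case: ifPn => // _; rewrite hornerE mul1r expR_ge0. Qed.

Lemma flat_le0 p t : t <= 0 -> flat p t = 0.
Proof. by rewrite /flat ltNge => ->. Qed.

Lemma flat1_add_gt0 t : 0 < flat 1 t + flat 1 (1 - t).
Proof.
have [t0|t0] := ltP 0 t; first by rewrite ltr_pwDl ?flat1_gt0 ?flat1_ge0.
by rewrite ltr_wpDl ?flat1_ge0// flat1_gt0// subr_gt0; lra.
Qed.

(* A C^oo function of one variable, given with all its derivatives. *)
Definition derivatives (G : nat -> R -> R) := forall n t, is_derive t 1 (G n) (G n.+1 t).

Lemma smooth_on_derivatives n (W : set 'rV[R]_n) (f : 'rV[R]_n -> R) G k : open W ->
  derivatives G -> smooth_on W f -> smooth_on W (fun x => G k (f x)).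
Proof.
move=> oW dG; apply: (@smooth_on_comp _ _ setT (fun g => exists j, g = G j)) => //.
  by move=> _ [j ->]; exists (G j.+1) => [|t _]; [eexists|exact: dG].
by exists k.
Qed.

(** A function of one real variable is viewed on row vectors of length 1, so that its successive
    derivatives and their existence come from the several-variable [smooth_on]. *)
Definition derivs (g : R -> R) n t : R :=
  iter n (partial (0 : 'I_1)) (fun x : 'rV[R]_1 => g (x 0 0)) (0 + t *: delta_mx 0 0).

Lemma derivsP (g : R -> R) : smooth_on setT (fun x : 'rV[R]_1 => g (x 0 0)) -> derivatives (derivs g).
Proof.
move=> sg; have sn n : smooth_on setT (iter n (partial (0 : 'I_1)) (fun x : 'rV[R]_1 => g (x 0 0))).
  by elim: n => //= n IH; exact: smooth_on_partial.
move=> n t; rewrite /derivs iterS; apply: is_derive_line.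
exact: smooth_on_diff (sn n) I.
Qed.

Lemma derivs0 (g : R -> R) : derivs g 0 = g.
Proof. by apply/funext => t; rewrite /derivs/= !mxE /= add0r mulr1. Qed.

Lemma derivatives_continuous G n : derivatives G -> continuous (G n).
Proof.
by move=> dG t; apply: differentiable_continuous; apply/derivable1_diffP; case: (dG n t).
Qed.

(** The denominator is positive since one of t and 1 - t is. *)
Definition step t : R := flat 1 t / (flat 1 t + flat 1 (1 - t)).

Lemma smooth_on_step n (W : set 'rV[R]_n) (f : 'rV[R]_n -> R) : open W -> smooth_on W f ->
  smooth_on W (fun x => step (f x)).
Proof.
move=> oW sf; have s1f : smooth_on W (fun x => 1 - f x).
  by apply: smooth_onB => //.
apply: smooth_onM => //; first exact: smooth_on_flat.
apply: smooth_onV => // [x _|]; first by rewrite gt_eqF// flat1_add_gt0.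
by apply: smooth_onD => //; exact: smooth_on_flat.
Qed.

Definition step_derivs := derivs step.

Lemma step_derivsP : derivatives step_derivs.
Proof. by apply: derivsP; apply: smooth_on_step; [exact: openT|exact: smooth_on_coord]. Qed.

Lemma step_derivs0 : step_derivs 0 = step.
Proof. exact: derivs0. Qed.

Lemma step_le0 t : t <= 0 -> step t = 0.
Proof. by move=> t0; rewrite /step flat_le0// mul0r. Qed.

Lemma step_ge1 t : 1 <= t -> step t = 1.
Proof.
move=> t1; rewrite /step (@flat_le0 1 (1 - t)) ?subr_le0// addr0 divff// gt_eqF//.
by rewrite flat1_gt0//; lra.
Qed.

Lemma step_ge0 t : 0 <= step t.
Proof. by rewrite divr_ge0 ?flat1_ge0// ltW// flat1_add_gt0. Qed.

Lemma step_le1 t : step t <= 1.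
Proof. by rewrite ler_pdivrMr ?flat1_add_gt0// mul1r lerDl flat1_ge0. Qed.

Lemma step_derivs_continuous n : continuous (step_derivs n).
Proof. exact: derivatives_continuous step_derivsP. Qed.

(** From this form the derivative of [step] is seen to be nonnegative, positive on ]0, 1[ and zero
    outside. It later serves as a bump with a known primitive. *)
Lemma step_derivs1E t : step_derivs 1 t =
  (flat 'X^2 t * flat 1 (1 - t) + flat 1 t * flat 'X^2 (1 - t)) /
    (flat 1 t + flat 1 (1 - t)) ^+ 2.
Proof.
have d1 : is_derive t 1 (flat 1) (flat 'X^2 t).
  by apply: (is_derive_eq (is_derive_flat _ _)); rewrite derivC subr0 mulr1.
have dm : is_derive t 1 (fun s : R => 1 - s) (0 - 1).
  exact: (is_deriveB (is_derive_cst (1 : R) t 1) (is_derive_id t 1)).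
have d2 : is_derive t 1 (fun s => flat 1 (1 - s)) (flat 'X^2 (1 - t) * (0 - 1)).
  have d1' : is_derive (1 - t) 1 (flat 1) (flat 'X^2 (1 - t)).
    by apply: (is_derive_eq (is_derive_flat _ _)); rewrite derivC subr0 mulr1.
  exact: (@is_derive1_comp R (flat 1) (fun s : R => 1 - s) t _ _ d1' dm).
have n0 : flat 1 t + flat 1 (1 - t) != 0 by rewrite gt_eqF// flat1_add_gt0.
have d3 : is_derive t 1 (fun s : R => flat 1 s + flat 1 (1 - s)) _ := is_deriveD d1 d2.
have d4 := @is_deriveV R (fun s : R => flat 1 s + flat 1 (1 - s)) t _ 1 n0 d3.
have d5 : is_derive t 1 step _ := is_deriveM d1 d4.
have [_ <-] := step_derivsP 0 t; rewrite step_derivs0.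
by have [_ ->] := d5; rewrite /GRing.scale/=; field.
Qed.

Lemma flatX2_ge0 t : 0 <= flat 'X^2 t.
Proof. by rewrite /flat; case: ifPn => // t0; rewrite !hornerE mulr_ge0 ?sqr_ge0 ?expR_ge0. Qed.

Lemma step_derivs1_ge0 t : 0 <= step_derivs 1 t.
Proof.
by rewrite step_derivs1E divr_ge0 ?sqr_ge0// addr_ge0// mulr_ge0 ?flat1_ge0 ?flatX2_ge0.
Qed.

Lemma step_derivs1_gt0 t : 0 < t < 1 -> 0 < step_derivs 1 t.
Proof.
move=> /andP[t0 t1]; rewrite step_derivs1E divr_gt0 ?exprn_gt0 ?flat1_add_gt0//.
rewrite ltr_pwDl ?mulr_ge0 ?flat1_ge0 ?flatX2_ge0// mulr_gt0//.
  by rewrite /flat t0 !hornerE mulr_gt0 ?expR_gt0 ?exprn_gt0 ?invr_gt0.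
by rewrite flat1_gt0// subr_gt0.
Qed.

End flat_function.

(** The integral of a nonnegative function is a supremum over the simple functions below it, so it
    is monotone even for nonmeasurable functions. This serves for the weights containing [Hdist],
    whose measurability is not established here. *)
Lemma le_ge0_integral d (T : measurableType d) (R : realType) (mu : measure T R)
    (A : set T) (f g : T -> \bar R) :
  (forall x, A x -> 0 <= f x)%E -> (forall x, A x -> f x <= g x)%E ->
  (\int[mu]_(x in A) f x <= \int[mu]_(x in A) g x)%E.
Proof.
move=> f0 fg.
have neg (h : T -> \bar R) : (forall x, A x -> 0 <= h x)%E -> (h \_ A)^\-%E = cst 0%E.
  move=> h0; apply/funext => x; rewrite funenegE patchE; case: ifPn => [|_]; last by rewrite oppe0 maxxx.
  by rewrite inE => Ax; apply/max_idPr; rewrite leeNl oppe0 h0.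
have g0 x : A x -> (0 <= g x)%E by move=> Ax; exact: le_trans (f0 _ Ax) (fg _ Ax).
rewrite /integral (neg f f0) (neg g g0); apply: leeB => //.
apply: le_ereal_sup => _ [h hf <-]; exists h => // x; apply: le_trans (hf x) _.
rewrite !funeposE !patchE; case: ifPn => // ; rewrite inE => Ax.
by rewrite ge_max !le_max (fg _ Ax) lexx orbT.
Qed.

(** * The Riemannian definitions of the statement in terms of [gp], [hlap] and [hInt] *)

Section hyperbolic_integrals.
Context {R : realType} {N : nat}.
Local Notation point := 'rV[R]_N.
Implicit Types (f g u v : point -> R) (x y : point) (i j : 'I_N).
Local Notation U := (@Hspace R N).
Local Opaque partial.

Lemma vol_density_Hmetric x : U x -> vol_density Hmetric x = rho x ^+ N.
Proof.
move=> Ux; rewrite /vol_density det_scalar -exprM mulnC exprM sqrtr_sqr ger0_norm//.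
by rewrite exprn_ge0// ltW// rho_gt0.
Qed.

Lemma grad_Hmetric u x j : grad Hmetric u x 0 j = rho x ^- 2 * partial j u x.
Proof. by rewrite /grad invmx_scalar mul_mx_scalar !mxE. Qed.

Lemma Hgrad2E u x : U x -> Hgrad2 u x = gp u u x.
Proof.
move=> Ux; have r0 := rho_neq0 Ux.
rewrite /Hgrad2 /inner mul_mx_scalar -scalemxAl mxE -[_ / (1 - _)]/(rho x) mxE /gp !mulr_sumr.
apply: eq_bigr => i _; rewrite [_^T _ _]mxE !grad_Hmetric; field.
exact: r0.
Qed.

Lemma HlaplaceE u x : U x -> Hlaplace u x = hlap u x.
Proof.
move=> Ux; rewrite /Hlaplace /laplace_beltrami /divergence vol_density_Hmetric//; congr (_ * _).
apply: eq_bigr => i _; apply: (partial_open _ open_Hspace Ux) => y Uy.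
by rewrite vol_density_Hmetric// grad_Hmetric.
Qed.

Lemma Hint_hInt f g : tf U g -> (forall x, U x -> f x = g x) -> Hint f = (hInt g)%:E.
Proof.
move=> tg fg; have tg' := tf_rho open_Hspace (@subset_refl _ U) tg.
rewrite /hInt -(Int_EFin (tf_cc tg')) /Hint /vol_integral integral_mkcond.
apply: eq_integral => s _; rewrite patchE; case: ifPn.
  by rewrite inE => Us; rewrite vol_density_Hmetric// fg// mulrC.
by rewrite notin_setE => nU; rewrite (tf_out tg').
Qed.

End hyperbolic_integrals.

Lemma Int_le_box {R : realType} {n : nat} (f : 'rV[R]_n -> R) (c : 'rV[R]_n) (e M : R) :
  cc f -> 0 <= e -> 0 <= M -> (forall x : 'rV[R]_n, f x <= M) ->
  (forall (x : 'rV[R]_n) i, e < `|x 0 i - c 0 i| -> f x <= 0) -> Int f <= M * (2 * e) ^+ n.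
Proof.
move=> ccf e0 M0 fM f0.
pose K := @tuple_box R n [tuple c 0 i | i < n] e.
have mK : measurable K by exact: measurable_tuple_box.
have KE : lebesgue_tuple R n K = ((2 * e) ^+ n)%:E by exact: lebesgue_tuple_box.
have -> : M * (2 * e) ^+ n = Rintegral (lebesgue_tuple R n) setT ((cst M) \_ K).
  rewrite -Rintegral_mkcond Rintegral_cst//; congr (_ * _).
  exact: esym (congr1 fine KE).
rewrite /Int; apply: le_Rintegral => //; first exact: cc_integrable.
  have -> : EFin \o (cst M) \_ K = (EFin \o cst M) \_ K.
    by apply/funext => t; rewrite /= !patchE; case: ifP.
  rewrite -(integrable_mkcond _ mK); apply: measurable_bounded_integrable => //.
    suff : (lebesgue_tuple R n K < +oo)%E by [].
    by rewrite KE ltry.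
  by exists M; split; [exact: num_real|move=> y My t _ /=; rewrite ger0_norm// ltW].
move=> t _; case: ifPn => [_|]; first exact: fM.
rewrite notin_setE => nK.
have [i] : exists i, e < `|tnth t i - c 0 i|.
  apply: contrapT => /forallNP h; apply: nK => i; rewrite tnth_mktuple.
  by move/negP: (h i); rewrite -leNgt.
by move=> ei; apply: (f0 (point_of_tuple t) i); rewrite mxE.
Qed.

(** * Cutoff functions at the pole and their derivatives *)

Section cutoff.
Context {R : realType} {N : nat}.
Local Notation point := 'rV[R]_N.
Implicit Types (f g u v : point -> R) (x y : point) (i j : 'I_N) (e : R).
Local Notation U := (@Hspace R N).
Local Opaque partial.
Variable x0 : point.
Hypothesis hx0 : U x0.
Local Notation V := (punctured x0).

Definition sqdist x : R := sqnorm (x - x0).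

Lemma sqdistE x : sqdist x = sqnorm x - 2 * dot x x0 + sqnorm x0.
Proof.
by rewrite /sqdist -!dotxx -scaleN1r dotDl !dotZl ![dot _ (_ + _)]dotC !dotDl !dotZl [dot x0 x]dotC; ring.
Qed.

Lemma smooth_sqdist W : smooth_on W sqdist.
Proof.
apply: (@smooth_on_sub _ _ setT) => //.
apply: (smooth_on_ext openT (fun x _ => esym (sqdistE x))).
apply: smooth_onD; [exact: openT| |exact: smooth_on_cst].
apply: smooth_onB; [exact: openT|exact: smooth_sqnorm|].
by apply: smooth_onM; [exact: openT|exact: smooth_on_cst|exact: smooth_dot].
Qed.

Lemma partial_sqdist i x : partial i sqdist x = 2 * (x 0 i - x0 0 i).
Proof.
have ds : differentiable (@sqnorm R N) x by exact: smooth_on_diff (smooth_sqnorm (V := setT)) I.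
have dd : differentiable (fun y => dot y x0) x by exact: smooth_on_diff (smooth_dot (V := setT) x0) I.
have dc (c : R) : differentiable (fun _ : point => c) x by exact: differentiable_cst.
have d1 : differentiable (fun y => 2 * dot y x0) x by exact: differentiableM.
rewrite (@partial_open _ _ setT _ (fun y => sqnorm y - 2 * dot y x0 + sqnorm x0))//; first last.
- by move=> y _; rewrite sqdistE.
- exact: openT.
rewrite partialD//; last exact: differentiableB.
by rewrite partialB// partialZ// partial_sqnorm partial_dot partial_cst; ring.
Qed.

Lemma sqr_coord_le x i : (x 0 i - x0 0 i) ^+ 2 <= sqdist x.
Proof.
rewrite /sqdist /sqnorm (bigD1 i)//= !mxE lerDl.
by apply: sumr_ge0 => j _; exact: sqr_ge0.
Qed.

(** The squared Euclidean distance is smooth at the pole. The affine map sends its values e^2 / 2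
    and e^2 to 0 and 1, the ends of the transition of [step]. *)
Definition cutoff e x : R := step_derivs 0 (2 / e ^+ 2 * sqdist x - 1).

Lemma smooth_cutarg W e : open W -> smooth_on W (fun x => 2 / e ^+ 2 * sqdist x - 1).
Proof.
move=> oW; apply: smooth_onB => //.
by apply: smooth_onM => //; exact: smooth_sqdist.
Qed.

Lemma smooth_cutoff W e k : open W -> smooth_on W (fun x => step_derivs k (2 / e ^+ 2 * sqdist x - 1)).
Proof.
by move=> oW; apply: (smooth_on_derivatives k oW step_derivsP); exact: smooth_cutarg.
Qed.

Lemma cutoff_eq0 e x : 0 < e -> sqdist x <= e ^+ 2 / 2 -> cutoff e x = 0.
Proof.
move=> e0 h; rewrite /cutoff step_derivs0 step_le0// subr_le0.
by rewrite -ler_pdivlMl ?divr_gt0 ?exprn_gt0// invf_div mulr1.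
Qed.

Lemma cutoff_eq1 e x : 0 < e -> e ^+ 2 <= sqdist x -> cutoff e x = 1.
Proof.
move=> e0 h; rewrite /cutoff step_derivs0 step_ge1// lerBrDr.
by rewrite -ler_pdivrMl ?divr_gt0 ?exprn_gt0// invf_div; lra.
Qed.

Lemma cutoff_ge0 e x : 0 <= cutoff e x.
Proof. by rewrite /cutoff step_derivs0 step_ge0. Qed.

Lemma cutoff_le1 e x : cutoff e x <= 1.
Proof. by rewrite /cutoff step_derivs0 step_le1. Qed.

Lemma partial_cutoff e k i x :
  partial i (fun x => step_derivs k (2 / e ^+ 2 * sqdist x - 1)) x =
  step_derivs k.+1 (2 / e ^+ 2 * sqdist x - 1) * (4 / e ^+ 2 * (x 0 i - x0 0 i)).
Proof.
have da : differentiable (fun x => 2 / e ^+ 2 * sqdist x - 1) x.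
  exact: smooth_on_diff (smooth_cutarg e openT) I.
have ds : differentiable sqdist x by exact: smooth_on_diff (smooth_sqdist (W := setT)) I.
have [_ ->] := partial_comp1 da (step_derivsP k _).
rewrite partialB; [|by apply: differentiableM => //; exact: differentiable_cst|exact: differentiable_cst].
by rewrite partialZ// partial_cst partial_sqdist; ring.
Qed.

Lemma closed_sqdist_ge c : closed [set x | c <= sqdist x].
Proof.
apply: (@closed_comp _ _ sqdist [set r | c <= r]) => [x _|]; last exact: closed_ge.
by apply: differentiable_continuous; exact: smooth_on_diff (smooth_sqdist (W := setT)) I.
Qed.

Lemma tf_cutoff e u : 0 < e -> tf U u -> tf V (fun x => cutoff e x * u x).
Proof.
move=> e0 [su [K [cK KU Ku]]]; split.
  apply: smooth_onM => //; last exact: smooth_on_sub su.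
  exact: smooth_cutoff.
exists (K `&` [set x | e ^+ 2 / 2 <= sqdist x]); split.
- by apply: compact_closedI => //; exact: closed_sqdist_ge.
- move=> x [/KU Ux /= h]; split => //=; apply: contraTneq h => ->.
  rewrite -ltNge /sqdist subrr (_ : sqnorm 0 = 0) ?divr_gt0 ?exprn_gt0//.
  by rewrite /sqnorm big1// => i _; rewrite mxE expr0n.
- move=> x /not_andP[/Ku ->|/= /negP]; first by rewrite mulr0.
  by rewrite -ltNge => h; rewrite cutoff_eq0 ?mul0r// ltW.
Qed.

(** The expanded form has coefficients bounded on the whole ball, since 1/rho and the coordinates
    are at most 1; the factor N - 2 comes from differentiating rho^(N-2). *)
Lemma hlapE u x : U x -> smooth_on U u -> hlap u x =
  \sum_i (rho x ^- 2 * partial i (partial i u) x + (N%:R - 2) * (rho x)^-1 * x 0 i * partial i u x).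
Proof.
move=> Ux su; have r0 := rho_neq0 Ux.
rewrite /hlap mulr_sumr; apply: eq_bigr => i _.
have dr : differentiable (fun y : point => rho y ^+ N) x by exact: differentiable_rhoX.
have dr2 : differentiable (fun y : point => rho y ^- 2) x.
  by apply: smooth_on_diff Ux; exact: smooth_rhoXV.
have dp : differentiable (partial i u) x by exact: smooth_on_diff (smooth_on_partial i su) Ux.
rewrite partialM//; last exact: differentiableM.
rewrite partialM// partial_rhoX// partial_rhoV2// exprS.
have rN : rho x ^+ N != 0 by rewrite expf_neq0.
by field; rewrite r0.
Qed.

Lemma rhoV_le1 x : U x -> 0 <= (rho x)^-1 <= 1.
Proof.
move=> Ux; rewrite invr_ge0 ltW ?rho_gt0//= /rho invf_div.
by rewrite ler_pdivrMr// mul1r; have := sqnorm_ge0 x; lra.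
Qed.

Lemma coord_le1 x i : U x -> `|x 0 i| <= 1.
Proof.
move=> Ux; have h : x 0 i ^+ 2 < 1.
  apply: le_lt_trans _ Ux; rewrite /sqnorm (bigD1 i)//= lerDl.
  by apply: sumr_ge0 => j _; exact: sqr_ge0.
by rewrite ler_norml; apply/andP; split; nra.
Qed.

(** Each of the N terms of [hlapE] is at most (1 + |N - 2|) A, and |N - 2| is bounded by N + 2. *)
Lemma hlap_bound u x A : U x -> smooth_on U u -> 0 <= A ->
  (forall i, `|partial i u x| <= A) -> (forall i, `|partial i (partial i u) x| <= A) ->
  `|hlap u x| <= N%:R * (N%:R + 3) * A.
Proof.
move=> Ux su A0 h1 h2; rewrite hlapE// (le_trans (ler_norm_sum _ _ _))//.
have -> : N%:R * (N%:R + 3) * A = \sum_(i < N) (N%:R + 3) * A.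
  by rewrite sumr_const card_ord -[RHS]mulr_natl mulrA.
apply: ler_sum => i _; have /andP[r0 r1] := rhoV_le1 Ux.
have N0 : 0 <= N%:R :> R by rewrite ler0n.
rewrite (le_trans (ler_normD _ _))// !normrM.
have -> : (N%:R + 3) * A = 1 * A + (N%:R + 2) * 1 * 1 * A by ring.
apply: lerD.
  apply: ler_pM => //; rewrite ger0_norm ?invr_ge0 ?sqr_ge0// -exprVn.
  by rewrite expr_le1.
apply: ler_pM; [by rewrite mulr_ge0// mulr_ge0|by []| |exact: h1].
apply: ler_pM; [by apply: mulr_ge0|by []| |exact: coord_le1].
apply: ler_pM => //; last by rewrite ger0_norm.
by rewrite ler_norml; apply/andP; split; lra.
Qed.

Lemma gp_bound u x A : U x -> 0 <= A ->
  (forall i, `|partial i u x| <= A) -> gp u u x <= N%:R * A ^+ 2.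
Proof.
move=> Ux A0 h; have /andP[r0 r1] := rhoV_le1 Ux.
have -> : N%:R * A ^+ 2 = 1 * \sum_(i < N) A ^+ 2 by rewrite sumr_const card_ord mul1r mulr_natl.
rewrite /gp ler_pM ?invr_ge0 ?sqr_ge0//.
- by apply: sumr_ge0 => i _; rewrite -expr2 sqr_ge0.
- by rewrite -exprVn expr_le1.
apply: ler_sum => i _; rewrite -expr2; move: (h i); rewrite ler_norml => /andP[h1 h2].
by nra.
Qed.

End cutoff.

Lemma normM_le {R : realDomainType} (a b A B : R) : `|a| <= A -> `|b| <= B -> `|a * b| <= A * B.
Proof. by move=> aA bB; rewrite normrM ler_pM. Qed.

Lemma normD_le {R : realDomainType} (a b A B : R) : `|a| <= A -> `|b| <= B -> `|a + b| <= A + B.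
Proof. by move=> aA bB; rewrite (le_trans (ler_normD _ _))// lerD. Qed.

Section cutoff_estimate.
Context {R : realType} {N : nat}.
Local Notation point := 'rV[R]_N.
Implicit Types (f g u v : point -> R) (x y : point) (i j : 'I_N) (e : R).
Local Notation U := (@Hspace R N).
Local Opaque partial.
Variable x0 : point.
Hypothesis hx0 : U x0.
Local Notation k := (@hdim R N).

Lemma step_derivs_bounded : exists2 M : R, 0 <= M &
  forall n s, (n <= 2)%N -> -1 <= s <= 1 -> `|step_derivs n s : R| <= M.
Proof.
have b n : exists M, forall s : R, -1 <= s <= 1 -> `|step_derivs n s| <= M.
  have cn : {within `[-1, 1], continuous (fun s : R => `|step_derivs n s|)}.
    apply: continuous_subspaceT => s; apply: continuous_comp; last exact: norm_continuous.
    exact: step_derivs_continuous.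
  have [|c _ hc] := @EVT_max R (fun s : R => `|step_derivs n s|) (-1) 1 _ cn; first by lra.
  by exists `|step_derivs n c| => s hs; apply: hc; rewrite in_itv.
have [M0 h0] := b 0%N; have [M1 h1] := b 1%N; have [M2 h2] := b 2%N.
exists (`|M0| + `|M1| + `|M2|); first by rewrite !addr_ge0.
have n0 := normr_ge0 M0; have n1 := normr_ge0 M1; have n2 := normr_ge0 M2.
have l0 := ler_norm M0; have l1 := ler_norm M1; have l2 := ler_norm M2.
case=> [|[|[|//]]] s _ hs; [have := h0 s hs|have := h1 s hs|have := h2 s hs]; lra.
Qed.

Lemma fin_bounded (f : 'I_N -> point -> R) : (forall i, cc (f i)) ->
  exists2 B : R, 0 <= B & forall i x, `|f i x| <= B.
Proof.
move=> cf; have /fin_all_exists[b hb] i := cc_bounded (cf i).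
exists (\sum_i `|b i|); first by apply: sumr_ge0.
move=> i x; rewrite (bigD1 i)//= (le_trans (hb i x))// (le_trans (ler_norm _))// lerDl.
exact: sumr_ge0.
Qed.

(** On the ball of radius [e] the argument of the step stays in [-1, 1], where its derivatives are
    bounded, and each derivative of the cutoff costs a factor of order 1/e. As e <= 1, the bound of
    order e^(-2) covers the first derivatives too. *)
Lemma cutoff_partial_bounds u : tf U u -> exists2 A : R, 0 <= A & forall e x i, 0 < e <= 1 -> U x ->
  sqdist x0 x <= e ^+ 2 ->
  `|partial i (fun y => cutoff x0 e y * u y) x| <= A / e ^+ 2 /\
  `|partial i (partial i (fun y => cutoff x0 e y * u y)) x| <= A / e ^+ 2.
Proof.
have r1 (M B E : R) : 0 <= M * B -> 0 <= B -> 1 <= E ^+ 2 -> E <= E ^+ 2 ->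
  M * (4 * E) * B + 1 * B <= (28 * M + 1) * B * E ^+ 2 by nra.
have r2 (M B E : R) : 0 <= M * B -> 0 <= B -> 1 <= E ^+ 2 -> E <= E ^+ 2 ->
  M * B * (20 * E ^+ 2 + 8 * E) + B <= (28 * M + 1) * B * E ^+ 2 by nra.
move=> tu.
have [B0 hB0] := cc_bounded (tf_cc tu).
have [B1 B1p hB1] := fin_bounded (fun i => tf_cc (tf_partial i tu)).
have [B2 B2p hB2] := fin_bounded (fun i => tf_cc (tf_partial i (tf_partial i tu))).
have [M M0 hM] := step_derivs_bounded.
pose B := `|B0| + B1 + B2.
have B0p := normr_ge0 B0; have B0l := ler_norm B0.
have bu x : `|u x| <= B by have := hB0 x; rewrite /B; lra.
have bu1 i x : `|partial i u x| <= B by have := hB1 i x; rewrite /B; lra.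
have bu2 i x : `|partial i (partial i u) x| <= B by have := hB2 i x; rewrite /B; lra.
have Bp : 0 <= B by rewrite !addr_ge0.
(* With E = 1/e, the second derivative is at most M B (20 E^2 + 8 E) + B, and E and 1 are at most
   E^2. *)
exists ((28 * M + 1) * B); first by rewrite mulr_ge0// addr_ge0// mulr_ge0.
move=> e x i /andP[e0 e1] Ux sx.
pose E := e^-1; have E1 : 1 <= E by rewrite invf_ge1.
have E2 : e ^- 2 = E ^+ 2 by rewrite exprVn.
have E0 : 0 <= E by exact: le_trans E1.
have EE : E <= E ^+ 2 by rewrite expr2 ler_peMr.
have E21 : 1 <= E ^+ 2 by rewrite (le_trans E1).
have MB : 0 <= M * B by exact: mulr_ge0.
pose s := 2 / e ^+ 2 * sqdist x0 x - 1.
have s1 : -1 <= s <= 1.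
  have sd0 : 0 <= sqdist x0 x by exact: sqnorm_ge0.
  have : 0 <= 2 / e ^+ 2 * sqdist x0 x <= 2.
    rewrite mulr_ge0 ?divr_ge0 ?sqr_ge0//= -mulrA ger_pMr//.
    by rewrite mulrC ler_pdivrMr ?exprn_gt0// mul1r.
  by rewrite /s => /andP[? ?]; apply/andP; split; lra.
have c1 : `|cutoff x0 e x| <= 1 by rewrite ger0_norm ?cutoff_ge0 ?cutoff_le1.
have g1 := hM 1%N s isT s1; have g2 := hM 2%N s isT s1.
pose d := 4 / e ^+ 2 * (x 0 i - x0 0 i).
have dE : `|d| <= 4 * E.
  have -> : 4 * E = (4 / e ^+ 2) * e by rewrite /E; field; rewrite gt_eqF.
  apply: normM_le; first by rewrite ger0_norm// divr_ge0// sqr_ge0.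
  have h := le_trans (sqr_coord_le x0 x i) sx.
  by rewrite ler_norml; apply/andP; split; nra.
have dcutoff y k' : differentiable (fun x => step_derivs k' (2 / e ^+ 2 * sqdist x0 x - 1)) y.
  exact: smooth_on_diff (smooth_cutoff x0 e k' openT) I.
have du y : differentiable u y by exact: tf_differentiable tu.
have dpu y : differentiable (partial i u) y by exact: tf_differentiable (tf_partial i tu).
have P1 y : partial i (fun y => cutoff x0 e y * u y) y =
   step_derivs 1 (2 / e ^+ 2 * sqdist x0 y - 1) * (4 / e ^+ 2 * (y 0 i - x0 0 i)) * u y
   + cutoff x0 e y * partial i u y.
  by rewrite partialM//; [rewrite {1}/cutoff partial_cutoff|exact: dcutoff].
have P1x : partial i (fun y => cutoff x0 e y * u y) x = step_derivs 1 s * d * u x + cutoff x0 e x * partial i u x.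
  by rewrite P1.
have P2 : partial i (partial i (fun y => cutoff x0 e y * u y)) x =
  (step_derivs 2 s * d * d + step_derivs 1 s * (4 * E ^+ 2)) * u x + step_derivs 1 s * d * partial i u x
  + (step_derivs 1 s * d * partial i u x + cutoff x0 e x * partial i (partial i u) x).
  have -> : partial i (fun y => cutoff x0 e y * u y) = (fun y =>
     step_derivs 1 (2 / e ^+ 2 * sqdist x0 y - 1) * (4 / e ^+ 2 * (y 0 i - x0 0 i)) * u y
     + cutoff x0 e y * partial i u y) by apply/funext => y; exact: P1.
  have dx : differentiable (fun y : point => y 0 i - x0 0 i) x.
    by apply: differentiableB; [exact: differentiable_coord|exact: differentiable_cst].
  have dx4 : differentiable (fun y : point => 4 / e ^+ 2 * (y 0 i - x0 0 i)) x.
    by apply: differentiableM => //; exact: differentiable_cst.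
  have dg : differentiable (fun y : point => step_derivs 1 (2 / e ^+ 2 * sqdist x0 y - 1) * (4 / e ^+ 2 * (y 0 i - x0 0 i))) x.
    by apply: differentiableM => //; exact: dcutoff.
  have dc0 : differentiable (cutoff x0 e) x by exact: (dcutoff x 0%N).
  rewrite partialD; [|exact: differentiableM|exact: differentiableM].
  rewrite (partialM i dg (du x)) (partialM i (dcutoff x 1%N) dx4) (partialM i dc0 (dpu x)).
  rewrite partial_cutoff partialZ// partialB; [|exact: differentiable_coord|exact: differentiable_cst].
  rewrite partial_coord eqxx partial_cst subr0 mulr1.
  by rewrite [partial i (cutoff x0 e) x]partial_cutoff -/s -/d -E2.
rewrite P1x P2 E2; split.
  apply: (@le_trans _ _ (M * (4 * E) * B + 1 * B)).
    by apply: normD_le; apply: normM_le => //; apply: normM_le.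
  exact: r1.
apply: (@le_trans _ _ ((M * (4 * E) * (4 * E) + M * (4 * E ^+ 2)) * B + M * (4 * E) * B + (M * (4 * E) * B + 1 * B))).
  apply: normD_le.
    apply: normD_le.
      apply: normM_le => //; apply: normD_le.
        by do 2 (apply: normM_le => //).
      by apply: normM_le => //; rewrite ger0_norm// mulr_ge0// sqr_ge0.
    by do 2 (apply: normM_le => //).
  apply: normD_le; last exact: normM_le.
  by do 2 (apply: normM_le => //).
have -> : (M * (4 * E) * (4 * E) + M * (4 * E ^+ 2)) * B + M * (4 * E) * B + (M * (4 * E) * B + 1 * B) =
  M * B * (20 * E ^+ 2 + 8 * E) + B by ring.
exact: r2.
Qed.

Definition dens u x : R := hlap u x ^+ 2 - k ^+ 2 * gp u u x.

Lemma tf_dens u : tf U u -> tf U (dens u).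
Proof.
move=> tu; have [su _] := tu.
have tl : tf U (hlap u) by exact: tf_hlap.
apply: tfD => //.
  by under eq_fun do rewrite expr2; apply: tfM => //; exact: tl.1.
by apply: tfN => //; apply: tfM => //; exact: tf_gpr.
Qed.

End cutoff_estimate.

Lemma limn_einf_le_lim {R : realType} (u v : (\bar R)^nat) (l : \bar R) :
  (forall n, u n <= v n)%E -> v @ \oo --> l -> (limn_einf u <= l)%E.
Proof.
move=> uv vl; rewrite -(cvg_limn_einf_sup vl).1 !limn_einf_lim.
apply: lee_lim; [exact: is_cvg_einfs|exact: is_cvg_einfs|].
apply: nearW => n; apply: le_ereal_inf_tmp => _ [i /= ni <-].
by apply: le_trans (uv i); apply: ereal_inf_lbound; exists i.
Qed.

(** * Removal of the cutoff *)

Section rellich_with_pole.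
Context {R : realType} {N : nat}.
Local Notation point := 'rV[R]_N.
Implicit Types (f g u v : point -> R) (x y : point) (i j : 'I_N) (e : R).
Local Notation U := (@Hspace R N).
Local Opaque partial.
Variable x0 : point.
Hypothesis hx0 : U x0.
Hypothesis hN : (4 < N)%N.
Local Notation V := (punctured x0).
Local Notation k := (@hdim R N).
Local Notation T := (measurableTypeR R).

Lemma hdim_ge2 : 2 <= k.
Proof.
have : (5%:R : R) <= N%:R by rewrite ler_nat.
by rewrite /hdim ler_pdivlMr//; lra.
Qed.

Lemma dens_cutoff_eq u e x : tf U u -> 0 < e -> U x -> e ^+ 2 < sqdist x0 x ->
  dens (fun y => cutoff x0 e y * u y) x = dens u x.
Proof.
move=> tu e0 Ux sx.
pose W := U `&` [set y | e ^+ 2 < sqdist x0 y].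
have oW : open W.
  apply: openI => //; apply: (@open_comp _ _ (sqdist x0) [set r | e ^+ 2 < r]); last exact: open_gt.
  by move=> y _; apply: differentiable_continuous; exact: smooth_on_diff (smooth_sqdist x0 (W := setT)) I.
have Wx : W x by [].
have tcu := tf_punctured (tf_cutoff x0 e0 tu).
have E y : W y -> cutoff x0 e y * u y = u y by move=> [_ /= h]; rewrite cutoff_eq1 ?mul1r// ltW.
have E1 i y : W y -> partial i (fun y => cutoff x0 e y * u y) y = partial i u y.
  by move=> Wy; exact: partial_open oW Wy E.
have E2 i : partial i (partial i (fun y => cutoff x0 e y * u y)) x = partial i (partial i u) x.
  by apply: (partial_open _ oW Wx) => y; exact: E1.
rewrite /dens !hlapE//; [|exact: tu.1|exact: tcu.1].
congr (_ ^+ 2 - _ * _).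
  by apply: eq_bigr => i _; rewrite E2 (E1 i x).
by rewrite /gp; congr (_ * _); apply: eq_bigr => i _; rewrite !(E1 i x).
Qed.

(** The densities differ only within distance [e] of the pole. Only an upper bound matters, so there
    the two nonpositive contributions, from the gradient of the cut-off function and from the
    Laplacian of [u], are dropped; what remains is O(e^(-4)) on a cube of volume (2 e)^N. *)
Lemma hInt_dens_cutoff u : tf U u -> exists C e0, [/\ 0 <= C, 0 < e0 & forall e, 0 < e <= e0 ->
  hInt (dens (fun y => cutoff x0 e y * u y)) <= hInt (dens u) + C * e].
Proof.
move=> tu.
have [A A0 hA] := cutoff_partial_bounds x0 tu.
have [B B0 hB] := fin_bounded (fun i => tf_cc (tf_partial i tu)).
have cr : {for x0, continuous (fun x : point => rho x ^+ N)}.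
  by apply: differentiable_continuous; exact: differentiable_rhoX.
pose c0 := rho x0 ^+ N + 1.
have c0p : 0 < c0 by rewrite ltr_wpDl// exprn_ge0// ltW// rho_gt0.
have : \forall x \near x0, rho x ^+ N < c0.
  by apply: (cr [set r | r < c0]); apply: lt_nbhsl; rewrite ltrDl.
move=> /nbhs_ballP[dl /= dl0 hdl].
pose C1 := (N%:R * (N%:R + 3) * A) ^+ 2 + k ^+ 2 * (N%:R * B ^+ 2).
have N0 : 0 <= N%:R :> R by rewrite ler0n.
have C10 : 0 <= C1 by apply: addr_ge0; [exact: sqr_ge0|rewrite mulr_ge0 ?sqr_ge0// mulr_ge0 ?sqr_ge0].
exists (c0 * C1 * 2 ^+ N), (Num.min 1 (dl / 2)); split.
- by rewrite !mulr_ge0// ?ltW// exprn_ge0.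
- by rewrite lt_min ltr01 divr_gt0.
move=> e; rewrite le_min => /andP[e0 /andP[e1 ed]].
set ue := fun y => _.
have tue : tf U ue := tf_punctured (tf_cutoff x0 e0 tu).
have t1 := tf_rho (@open_Hspace R N) (@subset_refl _ U) (tf_dens tue).
have t2 := tf_rho (@open_Hspace R N) (@subset_refl _ U) (tf_dens tu).
rewrite -lerBlDl /hInt -(IntN (tf_cc t2)) -(IntD (tf_cc t1) (ccN (tf_cc t2))).
have d0 x : ~ U x \/ e ^+ 2 < sqdist x0 x -> rho x ^+ N * dens ue x - rho x ^+ N * dens u x = 0.
  have [Ux|nU] := pselect (U x); last by rewrite (tf_out t1 nU) (tf_out t2 nU) subrr.
  by move=> [//|h]; rewrite dens_cutoff_eq ?subrr.
have -> : c0 * C1 * 2 ^+ N * e = c0 * C1 / e ^+ 4 * (2 ^+ N * (e * e ^+ 4)).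
  by field; rewrite gt_eqF.
(* As N >= 5 and e <= 1, e^N is at most e^5, so one power of [e] survives the division by e^4. *)
apply: (@le_trans _ _ (c0 * C1 / e ^+ 4 * (2 * e) ^+ N)); last first.
  rewrite ler_wpM2l ?divr_ge0 ?mulr_ge0 ?exprn_ge0 ?(ltW c0p) ?(ltW e0)//.
  rewrite exprMn ler_wpM2l ?exprn_ge0// -exprS.
  by apply: ler_wiXn2l => //; exact: ltW.
have M0 : 0 <= c0 * C1 / e ^+ 4 by rewrite divr_ge0 ?mulr_ge0 ?exprn_ge0 ?(ltW c0p) ?(ltW e0).
apply: (@Int_le_box _ _ _ x0).
- exact: ccD (tf_cc t1) (ccN (tf_cc t2)).
- exact: ltW.
- exact: M0.
- move=> x; have [h|/not_orP[/contrapT Ux /negP]] := pselect (~ U x \/ e ^+ 2 < sqdist x0 x).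
    by rewrite d0.
  rewrite -leNgt => sx.
  have xb : ball x0 dl x.
    split=> // a i; rewrite ord1 /ball/=; apply: le_lt_trans (_ : e < dl); last first.
      by apply: le_lt_trans ed _; rewrite ltr_pdivrMr//; lra.
    have := le_trans (sqr_coord_le x0 x i) sx => h.
    by rewrite ler_norml; apply/andP; split; nra.
  have r1 := hdl _ xb; have r0 : 0 <= rho x ^+ N by rewrite exprn_ge0// ltW// rho_gt0.
  rewrite -mulrBr -mulrA; apply: (@le_trans _ _ (rho x ^+ N * (C1 / e ^+ 4))); last first.
    by rewrite ler_wpM2r ?divr_ge0 ?exprn_ge0 ?(ltW e0)// ltW.
  rewrite ler_wpM2l//.
  have e01 : 0 < e <= 1 by rewrite e0.
  have p1 i := (hA e x i e01 Ux sx).1; have p2 i := (hA e x i e01 Ux sx).2.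
  have Ae : 0 <= A / e ^+ 2 by rewrite divr_ge0// sqr_ge0.
  have h1 := hlap_bound Ux tue.1 Ae p1 p2.
  have h2 := gp_bound Ux B0 (fun i => hB i x).
  have g0 := gp_ge0 ue x.
  have h3 : hlap ue x ^+ 2 <= (N%:R * (N%:R + 3) * (A / e ^+ 2)) ^+ 2.
    by move: h1; rewrite ler_norml => /andP[? ?]; nra.
  have h4 : k ^+ 2 * gp u u x <= k ^+ 2 * (N%:R * B ^+ 2) / e ^+ 4.
    apply: (@le_trans _ _ (k ^+ 2 * (N%:R * B ^+ 2))); first by rewrite ler_wpM2l ?sqr_ge0.
    apply: ler_peMr; first by rewrite mulr_ge0 ?sqr_ge0// mulr_ge0 ?sqr_ge0.
    rewrite invf_ge1 ?exprn_gt0//.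
    by rewrite exprn_ile1// ltW.
  have h5 : 0 <= k ^+ 2 * gp ue ue x by rewrite mulr_ge0 ?sqr_ge0.
  have h6 : 0 <= hlap u x ^+ 2 by exact: sqr_ge0.
  have -> : C1 / e ^+ 4 = (N%:R * (N%:R + 3) * (A / e ^+ 2)) ^+ 2 + k ^+ 2 * (N%:R * B ^+ 2) / e ^+ 4.
    by rewrite /C1; field; rewrite gt_eqF.
  move: h3 h4 h5 h6; rewrite /dens.
  generalize (k ^+ 2 * gp ue ue x), (k ^+ 2 * gp u u x), (hlap ue x ^+ 2), (hlap u x ^+ 2).
  clear; move: (_ ^+ 2) (_ / _) => a b c d f g; lra.
- move=> x i hi; rewrite d0//; right.
  apply: lt_le_trans (sqr_coord_le x0 x i).
  by rewrite -[ltRHS]real_normK ?num_real// ltr_pXn2r ?nnegrE ?(ltW e0)//.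
Qed.

Lemma hweight_ge0 x : 0 <= hweight x0 x.
Proof.
have k2 := hdim_ge2; rewrite /hweight; move: (rlogD x0 x) (rshS x0 x) => t p.
have mul_sqr_ge0 (c y : R) n : ~~ odd n -> 0 <= c -> 0 <= c * y ^+ n.
  by move=> on c0; rewrite mulr_ge0// exprn_even_ge0.
do ![apply: addr_ge0]; apply: (mul_sqr_ge0 _ _ _ _ _) => //; move: k2; move: k => K K2.
- by rewrite divr_ge0 ?sqr_ge0.
- by rewrite mulr_ge0//; nra.
- by rewrite mulr_ge0//; nra.
Qed.

Lemma smooth_hweight : smooth_on V (hweight x0).
Proof.
have st n : smooth_on V (fun x => rlogD x0 x ^+ n).
  by apply: smooth_onX => //; exact: smooth_rlogD.
have sp n : smooth_on V (fun x => rshS x0 x ^+ n).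
  by apply: smooth_onX => //; exact: smooth_rshS.
by do ![apply: smooth_onD => //]; apply: smooth_onM => //.
Qed.

(** The value 0 at the pole makes this the pointwise limit of the integrands with cutoff, which all
    vanish there. *)
Definition weighted_sqr (w : point -> R) u x : R :=
  if x == x0 then 0 else rho x ^+ N * (w x * u x ^+ 2).

Lemma cutoff_seq_cvg (w : point -> R) u (e : nat -> R) x : (forall n, 0 < e n) ->
  e @ \oo --> 0 ->
  (fun n => rho x ^+ N * (w x * (cutoff x0 (e n) x * u x) ^+ 2)) @ \oo --> weighted_sqr w u x.
Proof.
move=> e0 ecv; apply: cvg_near_cst.
rewrite /weighted_sqr; case: eqVneq => [->|xx0].
  near=> n; rewrite cutoff_eq0// ?mul0r ?expr0n ?mulr0//=.
  rewrite /sqdist subrr (_ : sqnorm 0 = 0) ?divr_ge0 ?sqr_ge0//.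
  by rewrite /sqnorm big1// => i _; rewrite mxE expr0n.
have d0 : 0 < sqdist x0 x by apply: sqnorm_gt0; rewrite subr_eq0.
have d1 : 0 < Num.min 1 (sqdist x0 x) by rewrite lt_min ltr01.
move/cvgrPdist_lt : ecv => /(_ _ d1) h.
near=> n; rewrite cutoff_eq1 ?mul1r//.
have : `|0 - e n| < Num.min 1 (sqdist x0 x) by near: n; exact: h.
rewrite sub0r normrN (ger0_norm (ltW (e0 n))) lt_min => /andP[h1 h2].
by have := e0 n; nra.
Unshelve. all: by end_near. Qed.

(** It is a pointwise limit of continuous functions, the integrands with cutoff at scale 1/(n+1). *)
Lemma weighted_sqr_measurable (w : point -> R) u : tf U u -> smooth_on V w ->
  measurable_fun setT (fun s : N.-tuple T => weighted_sqr w u (point_of_tuple s)).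
Proof.
move=> tu sw.
pose e n : R := n.+1%:R^-1.
have e0 n : 0 < e n by rewrite invr_gt0.
apply: (@measurable_fun_cvg _ _ _ _
  (fun n (s : N.-tuple T) => rho (point_of_tuple s) ^+ N * (w (point_of_tuple s) * (cutoff x0 (e n) (point_of_tuple s) * u (point_of_tuple s)) ^+ 2))).
  move=> n; apply: (measurable_point (f := fun x => rho x ^+ N * (w x * (cutoff x0 (e n) x * u x) ^+ 2))).
  have tc := tf_cutoff x0 (e0 n) tu.
  apply: (tf_continuous (V := V)); apply: tf_rho => //; apply: tfM => //.
  exact: tf_sqr.
by move=> s _; apply: cutoff_seq_cvg => //; exact: cvg_harmonic.
Qed.

Theorem rellich_with_pole u : tf U u ->
  (\int[lebesgue_tuple R N]_s (weighted_sqr (hweight x0) u (point_of_tuple s))%:E <= (hInt (dens u))%:E)%E.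
Proof.
move=> tu; have [C [e0 [C0 e0p hC]]] := hInt_dens_cutoff tu.
pose e n : R := e0 * n.+1%:R^-1.
have en0 n : 0 < e n by rewrite mulr_gt0// invr_gt0.
have ene0 n : 0 < e n <= e0 by rewrite en0/= ger_pMr// invf_le1// ler1n.
have ecv : e @ \oo --> 0.
  by rewrite -(mulr0 e0); apply: cvgM; [exact: cvg_cst|exact: cvg_harmonic].
pose h n x := rho x ^+ N * (hweight x0 x * (cutoff x0 (e n) x * u x) ^+ 2).
have tc n := tf_cutoff x0 (en0 n) tu.
have th n : tf V (h n).
  apply: tf_rho => //; apply: tfM => //; first exact: smooth_hweight.
  exact: tf_sqr.
have h0 n x : 0 <= h n x.
  have [Ux|nU] := pselect (U x).
    by rewrite mulr_ge0 ?exprn_ge0 ?(ltW (rho_gt0 Ux))// mulr_ge0 ?hweight_ge0 ?sqr_ge0.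
  by rewrite /h (tf_out tu nU) mulr0 expr0n/= !mulr0.
have -> : (\int[lebesgue_tuple R N]_s (weighted_sqr (hweight x0) u (point_of_tuple s))%:E =
   \int[lebesgue_tuple R N]_s limn_einf (fun n => (h n (point_of_tuple s))%:E))%E.
  apply: eq_integral => s _.
  have cv : (fun n => (h n (point_of_tuple s))%:E) @ \oo --> (weighted_sqr (hweight x0) u (point_of_tuple s))%:E.
    by apply: cvg_EFin; [exact: nearW|exact: cutoff_seq_cvg].
  by rewrite (cvg_limn_einf_sup cv).1.
apply: le_trans.
  apply: fatou => // n.
    by apply/measurable_EFinP; apply: measurable_point; exact: tf_continuous (th n).
  by move=> s _; rewrite lee_fin.
apply: (@limn_einf_le_lim _ _ (fun n => (hInt (dens u) + C * e n)%:E)).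
  move=> n; rewrite (Int_EFin (tf_cc (th n))) lee_fin.
  apply: le_trans (hC _ (ene0 n)).
  have tl := tf_hlap (@open_punctured R N x0) (@puncturedW R N x0) (tc n).
  have tg : tf V (fun x => k ^+ 2 * gp (fun y => cutoff x0 (e n) y * u y) (fun y => cutoff x0 (e n) y * u y) x).
    by apply: tfM => //; apply: tf_gpr => //; exact: (tc n).1.
  have := rellich_off_pole hx0 (tc n) hdim_ge2.
  have tgu : tf V (gp (fun y => cutoff x0 (e n) y * u y) (fun y => cutoff x0 (e n) y * u y)).
    by apply: tf_gpr => //; exact: (tc n).1.
  rewrite -(hIntZ _ tgu).
  by rewrite -(hIntN tg) -(hIntD (tf_sqr tl) (tfN (@open_punctured R N x0) tg)).
apply: cvg_EFin; first exact: nearW.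
rewrite -[X in _ --> X]addr0 -(mulr0 C); apply: cvgD; first exact: cvg_cst.
by apply: cvgM => //; exact: cvg_cst.
Qed.

End rellich_with_pole.

Lemma cvg_bigsum {T : topologicalType} {K : numFieldType} (W : normedModType K)
    (I : Type) (r : seq I) (f : I -> T -> W) (x : T) :
  (forall i, f i y @[y --> x] --> f i x) ->
  \sum_(i <- r) f i y @[y --> x] --> \sum_(i <- r) f i x.
Proof.
move=> cf; elim: r => [|i r IH].
  by under eq_fun do rewrite big_nil; rewrite big_nil; exact: cvg_cst.
by under eq_fun do rewrite big_cons; rewrite big_cons; exact: (cvgD (cf i) IH).
Qed.

(** * Lower bound for the geodesic distance to the pole *)

Section geodesic_distance.
Context {R : realType} {N : nat}.
Local Notation point := 'rV[R]_N.
Implicit Types (f g u v : point -> R) (x y : point) (i j : 'I_N) (e : R) (c : R -> point).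
Local Notation U := (@Hspace R N).
Local Opaque partial.
Variable x0 : point.
Hypothesis hx0 : U x0.
Local Notation V := (punctured x0).
Local Notation F := (chF x0).

Lemma sqnorm_convex x y (t : R) : 0 <= t <= 1 ->
  sqnorm (x + t *: (y - x)) <= (1 - t) * sqnorm x + t * sqnorm y.
Proof.
move=> /andP[t0 t1]; rewrite /sqnorm !mulr_sumr -big_split/=; apply: ler_sum => i _.
rewrite !mxE; move: (x 0 i) (y 0 i) => a b; rewrite -subr_ge0.
have -> : (1 - t) * a ^+ 2 + t * b ^+ 2 - (a + t * (b - a)) ^+ 2 = t * (1 - t) * (b - a) ^+ 2 by ring.
by rewrite mulr_ge0 ?sqr_ge0// mulr_ge0// subr_ge0.
Qed.

(** By convexity of the ball the set of lengths is nonempty, so the infimum in [geodesic_dist] is a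
    genuine one. *)
Lemma curve_segment x y : U x -> U y -> curve U x y (fun t => x + t *: (y - x)).
Proof.
move=> Ux Uy.
have dc (t : R) : is_derive t 1 (fun t : R => x + t *: (y - x)) (y - x).
  have d1 : is_derive t 1 (fun t : R => t *: (y - x)) (1 *: (y - x)).
    have [ex ev] := is_diff_scalel t (y - x).
    by apply: DeriveDef; [exact: diff_derivable|rewrite deriveE// ev].
  have d2 := is_deriveD (is_derive_cst x t 1) d1.
  by apply: (is_derive_eq d2); rewrite add0r scale1r.
split.
- by move=> t; case: (dc t).
- have -> : derive1 (fun t : R => x + t *: (y - x)) = cst (y - x).
    by apply/funext => t; rewrite derive1E; case: (dc t).
  exact: cst_continuous.
- by rewrite scale0r addr0.
- by rewrite scale1r addrC subrK.
- move=> t t01; apply: le_lt_trans (sqnorm_convex x y t01) _.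
  move: t01 => /andP[t0 t1]; have /= h1 : sqnorm x < 1 := Ux; have /= h2 : sqnorm y < 1 := Uy.
  by have [h|h] := leP t (1 / 2); nra.
Qed.

Lemma inner_Hmetric x (v : point) : inner Hmetric x v v = rho x ^+ 2 * sqnorm v.
Proof.
rewrite /inner mul_mx_scalar -scalemxAl mxE -[_ / (1 - _)]/(rho x) mxE /sqnorm; congr (_ * _).
by apply: eq_bigr => i _; rewrite [_^T _ _]mxE expr2.
Qed.

Lemma curve_length_ge0 c : 0 <= curve_length Hmetric c.
Proof. by apply: Rintegral_ge0 => t _; exact: sqrtr_ge0. Qed.

(** With the convention 1/0 = 0, the four weights of the statement therefore vanish at the pole, in
    agreement with [weighted_sqr]. *)
Lemma Hdist_pole : Hdist x0 x0 = 0.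
Proof.
have E : [set curve_length Hmetric c | c in curve U x0 x0] 0.
  exists (cst x0).
    split=> //; try by move=> t; exact: derivable_cst.
      have -> : derive1 (cst x0 : R -> point) = cst 0.
        by apply/funext => t; rewrite derive1_cst.
      exact: cst_continuous.
  rewrite /curve_length.
  have -> : (fun t : R => Num.sqrt (inner Hmetric (cst x0 t) (derive1 (cst x0) t) (derive1 (cst x0) t))) = cst 0.
    apply/funext => t; rewrite inner_Hmetric derive1_cst.
    by rewrite /sqnorm big1 ?mulr0 ?sqrtr0// => i _; rewrite mxE expr0n.
  by rewrite /Rintegral integral0.
apply/eqP; rewrite eq_le; apply/andP; split.
  apply: ge_inf => //; exists 0 => _ [c _ <-]; exact: curve_length_ge0.
apply: lb_le_inf; first by exists 0.
by move=> _ [c _ <-]; exact: curve_length_ge0.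
Qed.

Lemma is_derive_curve f c (t : R) : derivable c t 1 -> differentiable f (c t) ->
  is_derive t 1 (fun t => f (c t)) (\sum_i derive1 c t 0 i * partial i f (c t)).
Proof.
move=> dc df; have dc' : differentiable c t by exact/derivable1_diffP.
have dfc : differentiable (f \o c) t by exact: differentiable_comp.
apply: DeriveDef; first exact/derivable1_diffP.
rewrite -[LHS]/('D_1 (f \o c) t) deriveE// diff_comp//= -(derive1E' dc').
by rewrite -deriveE// deriveE_partial.
Qed.

(** Along a curve cosh r varies at most at sinh r times the hyperbolic speed, by Cauchy-Schwarz and
    |grad cosh r| = sinh r. *)
Lemma chF_speed x (v : point) : U x ->
  (\sum_i v 0 i * partial i F x) ^+ 2 <= (F x ^+ 2 - 1) * (rho x ^+ 2 * sqnorm v).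
Proof.
move=> Ux; have -> : \sum_i v 0 i * partial i F x = rho x ^+ 2 * \sum_i v 0 i * Yc x0 i x.
  by rewrite mulr_sumr; apply: eq_bigr => i _; rewrite partial_chF// mulrCA.
rewrite -(sum_Yc_sqr hx0 Ux) exprMn.
have := sum_cauchy_schwarz (fun i => v 0 i) (fun i => Yc x0 i x); rewrite -/(sqnorm v) => h.
have -> : rho x ^+ 2 * (\sum_i Yc x0 i x ^+ 2) * (rho x ^+ 2 * sqnorm v) =
  (rho x ^+ 2) ^+ 2 * (sqnorm v * \sum_i Yc x0 i x ^+ 2) by ring.
by rewrite ler_wpM2l// sqr_ge0.
Qed.

(** The arcosh of cosh r changes along the curve at most at the hyperbolic speed. It is not
    differentiable at the pole, hence the regularization by [e], whose cost is the term - e. *)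
Lemma curve_length_ge x c e : U x -> 0 < e -> curve U x x0 c ->
  ln (F x + Num.sqrt (F x ^+ 2 - 1)) - e <= curve_length Hmetric c.
Proof.
move=> Ux e0 [dc cc' c0 c1 cU].
have cUi (t : R) : t \in `[0, 1] -> U (c t) by rewrite in_itv/=; exact: cU.
have ct (t : R) : {for t, continuous c} by apply: differentiable_continuous; exact/derivable1_diffP.
pose f (t : R) := F (c t); pose df (t : R) := \sum_i derive1 c t 0 i * partial i F (c t).
have fD (t : R) : t \in `[0, 1] -> is_derive t 1 f (df t).
  by move=> /cUi Uc; apply: is_derive_curve => //; exact: smooth_on_diff (smooth_chF hx0) Uc.
(* The summand e^2 keeps the radicand positive where the curve meets the pole, which happens at
   least at its end. *)
pose q (t : R) := f t ^+ 2 - 1 + e ^+ 2.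
have f1 (t : R) : t \in `[0, 1] -> 1 <= f t by move=> /cUi; exact: chF_ge1.
have q0 (t : R) : t \in `[0, 1] -> 0 < q t.
  by move=> /f1 h; rewrite /q ltr_wpDl ?exprn_gt0//; nra.
pose G (t : R) := ln (f t + Num.sqrt (q t)); pose dG (t : R) := df t / Num.sqrt (q t).
have s0 (t : R) : t \in `[0, 1] -> 0 < Num.sqrt (q t) by move=> /q0; rewrite sqrtr_gt0.
have GD (t : R) : t \in `[0, 1] -> is_derive t 1 G (dG t).
  move=> t01; have fDt := fD _ t01; have s0t := s0 _ t01; have f1t := f1 _ t01.
  have dq : is_derive t 1 q (2 * f t * df t).
    have d1 : is_derive t 1 (fun t => f t * f t) (f t * df t + f t * df t) := is_deriveM fDt fDt.
    have d2 : is_derive t 1 (fun t => f t * f t - 1 + e ^+ 2) (f t * df t + f t * df t - 0 + 0) :=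
      is_deriveD (is_deriveB d1 (is_derive_cst (1 : R) t 1)) (is_derive_cst (e ^+ 2 : R) t 1).
    have -> : q = (fun t => f t * f t - 1 + e ^+ 2) by apply/funext => r; rewrite /q expr2.
    by apply: (is_derive_eq d2); ring.
  have ds := @is_derive1_comp R Num.sqrt q t _ _ (is_derive1_sqrt (q0 _ t01)) dq.
  have p0 : 0 < f t + Num.sqrt (q t) by lra.
  have dfs : is_derive t 1 (fun t => f t + Num.sqrt (q t)) _ := is_deriveD fDt ds.
  have dl := @is_derive1_comp R (@ln R) (fun t => f t + Num.sqrt (q t)) t _ _ (is_derive1_ln p0) dfs.
  apply: (is_derive_eq dl); rewrite /dG; move: p0 s0t.
  by move: (f t) (df t) (Num.sqrt (q t)) => a b s p0 s0t; field; rewrite !gt_eqF.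
have cdf (t : R) : t \in `[0, 1] -> {for t, continuous df}.
  move=> t01; apply: cvg_bigsum => i; apply: cvgM.
    apply: (@continuous_comp _ _ _ (derive1 c) (fun v : point => v 0 i)); first exact: cc'.
    exact: coord_continuous.
  apply: (@continuous_comp _ _ _ c (partial i F)); first exact: ct.
  apply: differentiable_continuous.
  exact: smooth_on_diff (smooth_on_partial i (smooth_chF hx0)) (cUi _ t01).
have cf (t : R) : t \in `[0, 1] -> {for t, continuous f}.
  by move=> /fD h; apply: differentiable_continuous; apply/derivable1_diffP; case: h.
have csqrtq (t : R) : t \in `[0, 1] -> {for t, continuous (fun t => Num.sqrt (q t))}.
  move=> /cf h; apply: (@continuous_comp _ _ _ q Num.sqrt); last exact: sqrt_continuous.
  by apply: cvgD; [apply: cvgB; [exact: (cvgM h h)|exact: cvg_cst]|exact: cvg_cst].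
have cdG (t : R) : t \in `[0, 1] -> {for t, continuous (fun t => - dG t)}.
  move=> t01; apply: cvgN; apply: cvgM; first exact: cdf.
  by apply: cvgV; [rewrite gt_eqF// s0|exact: csqrtq].
pose sp (t : R) := Num.sqrt (inner Hmetric (c t) (derive1 c t) (derive1 c t)).
have csp (t : R) : t \in `[0, 1] -> {for t, continuous sp}.
  move=> t01; apply: (@continuous_comp _ _ _ (fun t => inner Hmetric (c t) (derive1 c t) (derive1 c t)) Num.sqrt);
    last exact: sqrt_continuous.
  have -> : (fun t => inner Hmetric (c t) (derive1 c t) (derive1 c t)) =
     (fun t => rho (c t) ^+ 2 * sqnorm (derive1 c t)) by apply/funext => s; exact: inner_Hmetric.
  apply: cvgM.
    apply: (@continuous_comp _ _ _ c (fun x => rho x ^+ 2)); first exact: ct.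
    by apply: differentiable_continuous; apply: differentiable_rhoX; exact: cUi.
  apply: (@continuous_comp _ _ _ (derive1 c) (@sqnorm R N)); first exact: cc'.
  by apply: differentiable_continuous; exact: smooth_on_diff (smooth_sqnorm (V := setT)) I.
have le_sp (t : R) : t \in `[0, 1] -> - dG t <= sp t.
  move=> t01; have Uc := cUi _ t01; have h := chF_speed (derive1 c t) Uc.
  have A0 : 0 <= rho (c t) ^+ 2 * sqnorm (derive1 c t).
    by apply: mulr_ge0; [exact: sqr_ge0|exact: sqnorm_ge0].
  rewrite /sp inner_Hmetric /dG -mulNr ler_pdivrMr ?s0// -sqrtrM//.
  apply: (@le_trans _ _ `|df t|); first by rewrite -normrN ler_norm.
  rewrite -sqrtr_sqr ler_wsqrtr// (le_trans h)// mulrC ler_wpM2l//.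
  by rewrite /q lerDl sqr_ge0.
have cw : {within `[0, 1], continuous (fun t => - dG t)}.
  by apply: continuous_in_subspaceT => t; rewrite inE; exact: cdG.
have csw : {within `[0, 1], continuous sp}.
  by apply: continuous_in_subspaceT => t; rewrite inE; exact: csp.
have sub t : t \in `]0, 1[ -> t \in `[(0 : R), 1] by exact: subset_itv_oo_cc.
have NGD (t : R) : t \in `[0, 1] -> is_derive t 1 (fun t => - G t) (- dG t).
  by move=> /GD h; exact: is_deriveN.
have cNG (t : R) : t \in `[0, 1] -> - G s @[s --> t] --> - G t.
  move=> /NGD h; have dd : differentiable (fun t => - G t) t by apply/derivable1_diffP; case: h.
  exact: (differentiable_continuous dd).
have dw : derivable_oo_LRcontinuous (fun t => - G t) 0 1.
  split.
  - by move=> t /sub /NGD; case.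
  - by apply: cvg_at_right_filter; apply: cNG; rewrite in_itv/= lexx ler01.
  - by apply: cvg_at_left_filter; apply: cNG; rewrite in_itv/= lexx ler01.
have ew : {in `]0, 1[, (fun t => - G t)^`()%classic =1 (fun t => - dG t)}.
  by move=> t /sub /NGD h; rewrite derive1E; case: h.
have E := continuous_FTC2 ltr01 cw dw ew.
have i1 : (@lebesgue_measure R).-integrable `[0, 1] (EFin \o (fun t => - dG t)).
  by apply: continuous_compact_integrable => //; exact: segment_compact.
have i2 : (@lebesgue_measure R).-integrable `[0, 1] (EFin \o sp).
  by apply: continuous_compact_integrable => //; exact: segment_compact.
have le1 : G 0 - G 1 <= curve_length Hmetric c.
  have -> : G 0 - G 1 = \int[lebesgue_measure]_(t in `[0, 1]) (- dG t).
    by rewrite /Rintegral E -EFinB /= opprK addrC.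
  by apply: le_Rintegral => // t t01; exact: le_sp.
apply: le_trans le1; apply: lerB.
  have Fx1 := chF_ge1 hx0 Ux.
  have F20 : 0 <= F x ^+ 2 - 1 by nra.
  have l0 : Num.sqrt (F x ^+ 2 - 1) <= Num.sqrt (F x ^+ 2 - 1 + e ^+ 2).
    by rewrite ler_wsqrtr// lerDl sqr_ge0.
  have s00 := sqrtr_ge0 (F x ^+ 2 - 1).
  by rewrite /G /q /f c0 ler_ln ?posrE; [rewrite lerD2l|lra|lra].
(* At the pole [G] equals ln (1 + e), which is at most [e]. *)
rewrite /G /q /f c1 chF_pole// expr1n subrr add0r sqrtr_sqr ger0_norm ?(ltW e0)//.
by apply: le_ln1Dx; lra.
Qed.

Lemma Hdist_ge_logD x : V x -> logD x0 x <= Hdist x x0.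
Proof.
move=> Vx; have [Ux _] := Vx.
apply: lb_le_inf; first by exists (curve_length Hmetric (fun t => x + t *: (x0 - x))); eexists; [exact: curve_segment|].
move=> _ [c hc <-]; apply/ler_addgt0Pr => e e0; rewrite -lerBlDr.
apply: le_trans _ (curve_length_ge Ux e0 hc); rewrite /logD -(shS_sqr hx0 Vx).
by rewrite sqrtr_sqr ger0_norm// ltW// shS_gt0.
Qed.

End geodesic_distance.

(** * The inequality for the geodesic distance *)

Section rellich_inequality.
Context {R : realType} {N : nat}.
Local Notation point := 'rV[R]_N.
Implicit Types (f g u v : point -> R) (x y : point) (i j : 'I_N) (e : R).
Local Notation U := (@Hspace R N).
Local Opaque partial.
Variable x0 : point.
Hypothesis hx0 : U x0.
Hypothesis hN : (4 < N)%N.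
Local Notation V := (punctured x0).
Local Notation k := (@hdim R N).

Lemma tf_test_function u : test_function U u -> tf U u.
Proof.
move=> [su cu uU]; split => //; exists (Defs.support u); split => // x nx.
by apply/eqP; apply: contrapT => /negP ux; apply: nx; apply: subset_closure.
Qed.

Lemma rellich_lhs_hInt c u : tf U u ->
  rellich_lhs c u = (hInt (fun x => hlap u x ^+ 2) - c * hInt (gp u u))%:E.
Proof.
move=> tu; have tl : tf U (hlap u) by apply: (tf_hlap _ _ tu) => //; exact: open_Hspace.
have tl2 : tf U (fun x => hlap u x ^+ 2).
  by under eq_fun do rewrite expr2; apply: tfM => //; exact: tl.1.
have tg : tf U (gp u u) by apply: tf_gpr => //; exact: tu.1.
rewrite /rellich_lhs (Hint_hInt tl2); last by move=> x Ux; rewrite HlaplaceE.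
by rewrite (Hint_hInt tg)// => x Ux; rewrite Hgrad2E.
Qed.

Lemma hInt_densE u : tf U u ->
  hInt (dens u) = hInt (fun x => hlap u x ^+ 2) - k ^+ 2 * hInt (gp u u).
Proof.
move=> tu; have oU := @open_Hspace R N.
have tl : tf U (hlap u) by apply: (tf_hlap _ _ tu) => //; exact: open_Hspace.
have tl2 : tf U (fun x => rho x ^+ N * hlap u x ^+ 2).
  by apply: tf_rho => //; under eq_fun do rewrite expr2; apply: tfM => //; exact: tl.1.
have tg : tf U (fun x => rho x ^+ N * gp u u x).
  by apply: tf_rho => //; apply: tf_gpr => //; exact: tu.1.
have tkg := ccZ (k ^+ 2) (tf_cc tg).
rewrite /hInt -(IntZ _ (tf_cc tg)) -(IntN tkg) -(IntD (tf_cc tl2) (ccN tkg)).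
by congr Int; apply/funext => x; rewrite /dens; ring.
Qed.

(** Here [f] will contain [Hdist], so the comparison goes through [le_ge0_integral]; the value of
    [f] at the pole is asked to be 0 because [weighted_sqr] is 0 there. *)
Lemma Hint_le_weighted_sqr (w : point -> R) f u : tf U u ->
  (forall x, 0 <= f x) -> f x0 = 0 -> (forall x, V x -> f x <= w x * u x ^+ 2) ->
  (Hint f <= \int[lebesgue_tuple R N]_s (weighted_sqr x0 w u (point_of_tuple s))%:E)%E.
Proof.
move=> tu f0 fx0 fw; rewrite /Hint /vol_integral.
have -> : (\int[lebesgue_tuple R N]_s (weighted_sqr x0 w u (point_of_tuple s))%:E =
  \int[lebesgue_tuple R N]_(s in @point_of_tuple R N @^-1` U) (weighted_sqr x0 w u (point_of_tuple s))%:E)%E.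
  rewrite [RHS]integral_mkcond; apply: eq_integral => s _; rewrite patchE; case: ifPn => //.
  rewrite notin_setE /weighted_sqr => nU; case: eqP => // _.
  by rewrite (tf_out tu nU) expr0n !mulr0.
apply: le_ge0_integral => s /= Us; rewrite vol_density_Hmetric// lee_fin.
  by rewrite mulr_ge0// exprn_ge0// ltW// rho_gt0.
rewrite /weighted_sqr; case: eqVneq => [->|sx0]; first by rewrite fx0 mul0r.
by rewrite mulrC ler_wpM2l ?exprn_ge0 ?(ltW (rho_gt0 Us))//; exact: fw.
Qed.

Lemma weighted_sqr_ge0 (w : point -> R) u x : tf U u -> (forall x, 0 <= w x) ->
  0 <= weighted_sqr x0 w u x.
Proof.
move=> tu w0; rewrite /weighted_sqr; case: ifP => // _.
have [Ux|nU] := pselect (U x); last by rewrite (tf_out tu nU) expr0n !mulr0.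
by rewrite mulr_ge0 ?exprn_ge0 ?(ltW (rho_gt0 Ux))// mulr_ge0 ?sqr_ge0.
Qed.

Lemma Hint_le_weighted_sqrZ (w : point -> R) c f u : tf U u -> smooth_on V w -> 0 <= c ->
  (forall x, 0 <= w x) ->
  (forall x, 0 <= f x) -> f x0 = 0 -> (forall x, V x -> f x <= w x * u x ^+ 2) ->
  (c%:E * Hint f <= \int[lebesgue_tuple R N]_s (weighted_sqr x0 (fun x => c * w x) u (point_of_tuple s))%:E)%E.
Proof.
move=> tu sw c0 w0 f0 fx0 fw.
apply: (@le_trans _ _ (c%:E * \int[lebesgue_tuple R N]_s (weighted_sqr x0 w u (point_of_tuple s))%:E)%E).
  by apply: lee_wpmul2l; [rewrite lee_fin|exact: Hint_le_weighted_sqr].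
rewrite -ge0_integralZl//.
- rewrite le_eqVlt; apply/orP; left; apply/eqP; apply: eq_integral => s _; rewrite -EFinM /weighted_sqr; congr (_%:E).
  by case: ifP => _; rewrite ?mulr0//; ring.
- by apply/measurable_EFinP; exact: weighted_sqr_measurable.
- by move=> s _; rewrite lee_fin; exact: weighted_sqr_ge0.
Qed.

Lemma integral_weighted_sqrD (w w' : point -> R) u : tf U u -> smooth_on V w -> smooth_on V w' ->
  (forall x, 0 <= w x) -> (forall x, 0 <= w' x) ->
  (\int[lebesgue_tuple R N]_s (weighted_sqr x0 (fun x => w x + w' x) u (point_of_tuple s))%:E =
   \int[lebesgue_tuple R N]_s (weighted_sqr x0 w u (point_of_tuple s))%:E +
   \int[lebesgue_tuple R N]_s (weighted_sqr x0 w' u (point_of_tuple s))%:E)%E.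
Proof.
move=> tu sw sw' w0 w'0; rewrite -ge0_integralD//.
- apply: eq_integral => s _; rewrite -EFinD /weighted_sqr; congr (_%:E).
  by case: ifP => _; rewrite ?addr0//; ring.
- by move=> s _; rewrite lee_fin; exact: weighted_sqr_ge0.
- by apply/measurable_EFinP; exact: weighted_sqr_measurable.
- by move=> s _; rewrite lee_fin; exact: weighted_sqr_ge0.
- by apply/measurable_EFinP; exact: weighted_sqr_measurable.
Qed.

Lemma ler_sinh : {homo (@sinh R) : r s / r <= s}.
Proof. by move=> r s rs; rewrite /sinh ler_wpM2r// lerB// ler_expR// lerN2. Qed.

Theorem rellich_le u : test_function U u -> (rellich_rhs x0 u <= rellich_lhs (k ^+ 2) u)%E.
Proof.
move=> /tf_test_function tu; rewrite rellich_lhs_hInt// -hInt_densE//.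
apply: le_trans (rellich_with_pole hx0 hN tu).
have st n : smooth_on V (fun x => rlogD x0 x ^+ n).
  by apply: smooth_onX => //; exact: smooth_rlogD.
have sp n : smooth_on V (fun x => rshS x0 x ^+ n).
  by apply: smooth_onX => //; exact: smooth_rshS.
have k2 := hdim_ge2 hN : 2 <= k.
(* Then (N-1)(N-3) = 4 (k^2 - k), N^2 - 2N - 7 = 4 (k^2 - 2) and N^2 - 4N - 3 = 4 (k^2 - k -
   3/2). *)
have N0 : (N%:R : R) = 2 * k + 1 by rewrite /hdim; field.
pose K := k; have K2 : 2 <= K by [].
have r_ge x : V x -> logD x0 x <= Hdist x x0 by exact: Hdist_ge_logD.
have tV n x : V x -> u x ^+ 2 / Hdist x x0 ^+ n <= rlogD x0 x ^+ n * u x ^+ 2.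
  move=> Vx; have d0 := logD_gt0 hx0 Vx; have r0 := lt_le_trans d0 (r_ge x Vx).
  rewrite mulrC ler_wpM2r ?sqr_ge0// /rlogD -!exprVn; apply: lerXn2r; rewrite ?nnegrE ?invr_ge0 ?(ltW d0) ?(ltW r0)//.
  by rewrite lef_pV2 ?posrE// r_ge.
have pV n x : V x -> u x ^+ 2 / sinh (Hdist x x0) ^+ n <= rshS x0 x ^+ n * u x ^+ 2.
  move=> Vx; have s0 := shS_gt0 x0 x; have h := ler_sinh (r_ge x Vx).
  rewrite (sinh_logD hx0 Vx) in h; have r0 := lt_le_trans s0 h.
  rewrite mulrC ler_wpM2r ?sqr_ge0// /rshS -!exprVn; apply: lerXn2r; rewrite ?nnegrE ?invr_ge0 ?(ltW s0) ?(ltW r0)//.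
  by rewrite lef_pV2 ?posrE.
have ev (c y : R) n : ~~ odd n -> 0 <= c -> 0 <= c * y ^+ n.
  by move=> on c0; rewrite mulr_ge0// exprn_even_ge0.
have f0 (y : R) n x : ~~ odd n -> 0 <= u x ^+ 2 / y ^+ n.
  by move=> on; rewrite divr_ge0 ?sqr_ge0// exprn_even_ge0.
have sinh0 : sinh (0 : R) = 0 by rewrite /sinh oppr0 subrr mul0r.
have c3 : 0 <= (k ^+ 2 - k) * (k ^+ 2 - 2) by rewrite mulr_ge0; move: K2; rewrite /K; nra.
have c4 : 0 <= (k ^+ 2 - k) * (k ^+ 2 - k - 3 / 2) by rewrite mulr_ge0; move: K2; rewrite /K; nra.
have sZ c (w : point -> R) : smooth_on V w -> smooth_on V (fun x => c * w x).
  by move=> sw; apply: smooth_onM => //.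
pose W1 x := k ^+ 2 / 4 * rlogD x0 x ^+ 2; pose W2 x := 9 / 16 * rlogD x0 x ^+ 4.
pose W3 x := (k ^+ 2 - k) * (k ^+ 2 - 2) * rshS x0 x ^+ 2.
pose W4 x := (k ^+ 2 - k) * (k ^+ 2 - k - 3 / 2) * rshS x0 x ^+ 4.
have k40 : 0 <= k ^+ 2 / 4 by rewrite divr_ge0 ?sqr_ge0.
have W10 x : 0 <= W1 x by exact: ev.
have W20 x : 0 <= W2 x by apply: ev => //; rewrite divr_ge0.
have W30 x : 0 <= W3 x by exact: ev.
have W40 x : 0 <= W4 x by exact: ev.
have sW1 : smooth_on V W1 by exact: sZ.
have sW2 : smooth_on V W2 by exact: sZ.
have sW3 : smooth_on V W3 by exact: sZ.
have sW4 : smooth_on V W4 by exact: sZ.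
have sW12 : smooth_on V (fun x => W1 x + W2 x) by exact: smooth_onD.
have sW123 : smooth_on V (fun x => W1 x + W2 x + W3 x) by exact: smooth_onD.
have W120 x : 0 <= W1 x + W2 x by exact: addr_ge0.
have W1230 x : 0 <= W1 x + W2 x + W3 x by exact: addr_ge0.
have -> : hweight x0 = (fun x => W1 x + W2 x + W3 x + W4 x) by [].
rewrite (integral_weighted_sqrD tu sW123 sW4 W1230 W40) (integral_weighted_sqrD tu sW12 sW3 W120 W30).
rewrite (integral_weighted_sqrD tu sW1 sW2 W10 W20) /rellich_rhs.
have -> : ((N%:R - 1) ^+ 2 / 16 : R) = k ^+ 2 / 4 by rewrite N0; field.
have -> : ((N%:R - 1) * (N%:R - 3) * (N%:R ^+ 2 - 2 * N%:R - 7) / 16 : R) = (k ^+ 2 - k) * (k ^+ 2 - 2).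
  by rewrite N0; field.
have -> : ((N%:R - 1) * (N%:R - 3) * (N%:R ^+ 2 - 4 * N%:R - 3) / 16 : R) =
   (k ^+ 2 - k) * (k ^+ 2 - k - 3 / 2) by rewrite N0; field.
have c9 : (0 : R) <= 9 / 16 by rewrite divr_ge0.
have p0 n (r : R) : (0 < n)%N -> r = 0 -> u x0 ^+ 2 / r ^+ n = 0.
  by move=> n0 ->; rewrite expr0n gtn_eqF// invr0 mulr0.
have wt n (r : point -> R) : ~~ odd n -> forall x, 0 <= r x ^+ n by move=> on x; rewrite exprn_even_ge0.
have ps : sinh (Hdist x0 x0) = 0 by rewrite Hdist_pole.
apply: leeD; first apply: leeD; first apply: leeD.
- exact: (Hint_le_weighted_sqrZ (f := fun x => u x ^+ 2 / Hdist x x0 ^+ 2) tu (st 2%N) k40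
    (wt 2%N _ isT) (fun x => f0 _ 2%N x isT) (p0 2%N _ isT (Hdist_pole hx0)) (tV 2%N)).
- exact: (Hint_le_weighted_sqrZ (f := fun x => u x ^+ 2 / Hdist x x0 ^+ 4) tu (st 4%N) c9
    (wt 4%N _ isT) (fun x => f0 _ 4%N x isT) (p0 4%N _ isT (Hdist_pole hx0)) (tV 4%N)).
- exact: (Hint_le_weighted_sqrZ (f := fun x => u x ^+ 2 / sinh (Hdist x x0) ^+ 2) tu (sp 2%N) c3
    (wt 2%N _ isT) (fun x => f0 _ 2%N x isT) (p0 2%N _ isT ps) (pV 2%N)).
- exact: (Hint_le_weighted_sqrZ (f := fun x => u x ^+ 2 / sinh (Hdist x x0) ^+ 4) tu (sp 4%N) c4
    (wt 4%N _ isT) (fun x => f0 _ 4%N x isT) (p0 4%N _ isT ps) (pV 4%N)).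
Qed.

End rellich_inequality.

(** * Radial test functions built from the distance *)

Section radial_test_functions.
Context {R : realType} {N : nat}.
Local Notation point := 'rV[R]_N.
Implicit Types (f g u v h : point -> R) (x y : point) (i j : 'I_N) (e : R).
Local Notation U := (@Hspace R N).
Local Opaque partial.
Variable x0 : point.
Hypothesis hx0 : U x0.
Local Notation V := (punctured x0).
Local Notation F := (chF x0).
Local Notation S := (shS x0).
Local Notation D := (logD x0).
Local Notation Z := (Zop x0).
Local Notation L := (Lop x0).
Local Notation k := (@hdim R N).
Local Notation w := (cothD x0).

(** The closed forms in [shS] and [logD] take junk values off the punctured ball, where [tf] asks
    for zeros. *)
Definition extend0 f x : R := if (sqnorm x < 1) && (x != x0) then f x else 0.

Lemma extend0_in f x : V x -> extend0 f x = f x.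
Proof. by move=> [/= Ux xx0]; rewrite /extend0 xx0 andbT ifT. Qed.

Lemma extend0_out f x : ~ V x -> extend0 f x = 0.
Proof. by move=> nV; rewrite /extend0; case: ifPn => // /andP[Ux xx0]; case: nV. Qed.

Lemma smooth_continuous f : smooth_on setT f -> continuous f.
Proof. by move=> sf x; apply: differentiable_continuous; exact: smooth_on_diff sf I. Qed.

(** A shell between two distances lies in a compact subset of the punctured ball. From r1 >= 2, F +
    S >= 3 with S < F, so F - 1 >= 1/2, while F - 1 <= exp r2 - 1. *)
Lemma tf_extend0 f r1 r2 : smooth_on V f -> 2 <= r1 ->
  (forall x, V x -> f x != 0 -> r1 <= D x <= r2) -> tf V (extend0 f).
Proof.
move=> sf r12 fD; split.
  by apply: smooth_on_ext sf => // x Vx; rewrite extend0_in.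
(* The sign of [a c] is that of F - 1 - c, with denominators cleared: the conditions become closed
   in the whole space, and the upper one excludes the boundary sphere, where [a c] is twice the
   positive squared distance to the pole. *)
pose a c x := 2 * sqdist x0 x - c * (1 - sqnorm x) * (1 - sqnorm x0).
have oT : open [set: point] by exact: openT.
have sa c : smooth_on setT (a c).
  apply: smooth_onB => //; first by apply: smooth_onM => //; exact: smooth_sqdist.
  by do 2 apply: smooth_onM => //; apply: smooth_onB.
pose K := [set x | sqnorm x <= 1] `&` ([set x | a (expR r2 - 1) x <= 0] `&` [set x | 0 <= a (1 / 2) x]).
have cl g (B : set R) : smooth_on setT g -> closed B -> closed (g @^-1` B).
  by move=> sg; apply: preimage_closed => x _; exact: smooth_continuous.
have clK : closed K.
  apply: closedI; first exact: (cl _ [set r | r <= 1]).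
  apply: closedI; first exact: (cl _ [set r | r <= 0]).
  exact: (cl _ [set r | 0 <= r]).
have sx0 : 0 < 1 - sqnorm x0 by exact: Hspace_gt0.
exists K; split.
- apply: (subclosed_compact clK (@rV_compact R N (fun=> `[-1, 1]%classic) (fun=> @segment_compact R (-1) 1))).
  move=> x [/= s1 _] i /=; rewrite in_itv/=.
  have h : x ord0 i ^+ 2 <= 1.
    apply: le_trans _ s1; rewrite /sqnorm (bigD1 i)//= lerDl.
    by apply: sumr_ge0 => j _; exact: sqr_ge0.
  by apply/andP; split; nra.
- move=> x [/= s1 [/= a1 a2]].
  have xx0 : x != x0.
    apply/eqP => xE; move: a2; rewrite /a xE /sqdist subrr (_ : sqnorm 0 = 0); last first.
      by rewrite /sqnorm big1// => i _; rewrite mxE expr0n.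
    by nra.
  split => //=; rewrite /Hspace/= lt_neqAle s1 andbT; apply/eqP => s1E.
  have : 0 < sqdist x0 x by apply: sqnorm_gt0; rewrite subr_eq0.
  by move: a1; rewrite /a s1E; nra.
move=> x nK; have [Vx|nV] := pselect (V x); last by rewrite extend0_out.
rewrite extend0_in//; apply/eqP; apply: contrapT => /negP fx0; apply: nK.
have /andP[D1 D2] := fD _ Vx fx0; have [/= Ux xx0] := Vx.
have F1 := chF_gt1 hx0 Ux xx0; have eD := expR_logD hx0 Vx.
have e1 : expR r1 <= expR (D x) by rewrite ler_expR.
have e2 : expR (D x) <= expR r2 by rewrite ler_expR.
have e3 : 1 + r1 <= expR r1 by exact: expR_ge1Dx.
have Sx := shS_gt0 x0 x; have S2 := shS_sqr hx0 Vx.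
have sx : 0 < 1 - sqnorm x by exact: Hspace_gt0.
have sd : 2 * sqdist x0 x = (F x - 1) * ((1 - sqnorm x) * (1 - sqnorm x0)).
  by rewrite chF_sub1// divfK// mulf_neq0// Hspace_neq0.
have P0 : 0 < (1 - sqnorm x) * (1 - sqnorm x0) by rewrite mulr_gt0.
split; [by move: sx; rewrite /=; lra|split => /=; rewrite /a sd -mulrA -mulrBl].
  by rewrite pmulr_lle0//; lra.
rewrite pmulr_lge0//.
have SF : S x < F x by nra.
lra.
Qed.

Lemma Zop_extend0 f x : V x -> Z (extend0 f) x = Z f x.
Proof.
move=> Vx; rewrite /Zop (@Yop_open _ _ _ _ _ f x (@open_punctured R N x0) Vx)//.
by move=> y; exact: extend0_in.
Qed.

Lemma Lop_extend0 f x : V x -> L (extend0 f) x = L f x.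
Proof. by move=> Vx; rewrite /Lop Zop_extend0// extend0_in. Qed.

Lemma Zop_comp (g : R -> R) d f x : differentiable f x -> is_derive (f x) 1 g d ->
  Z (fun y => g (f y)) x = d * Z f x.
Proof.
move=> df gd; have [_ E] := partial_comp1 df gd.
rewrite /Zop /Yop mulrA; congr (_ / _); rewrite mulr_sumr.
by apply: eq_bigr => i _; rewrite E mulrCA.
Qed.

Lemma radial_comp (g dg : R -> R) h : (forall x, V x -> differentiable h x) ->
  (forall x, V x -> is_derive (h x) 1 g (dg (h x))) -> radial x0 h -> radial x0 (fun x => g (h x)).
Proof.
move=> dh gd [c hc]; exists (fun x => dg (h x) * c x) => i x Vx.
by have [_ ->] := partial_comp1 (dh _ Vx) (gd _ Vx); rewrite hc// mulrA.
Qed.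

Lemma radialM g h : (forall x, V x -> differentiable g x) -> (forall x, V x -> differentiable h x) ->
  radial x0 g -> radial x0 h -> radial x0 (fun x => g x * h x).
Proof.
move=> dg dh [c hc] [d hd]; exists (fun x => c x * h x + g x * d x) => i x Vx.
by rewrite partialM ?hc ?hd; [ring| | | |]; try exact: dg; try exact: dh.
Qed.

Lemma radial_extend0 h : radial x0 h -> radial x0 (extend0 h).
Proof.
move=> [c hc]; exists c => i x Vx; rewrite -hc//.
by apply: (partial_open _ (@open_punctured R N x0) Vx) => y; exact: extend0_in.
Qed.

(* S^(-k), the inverse square root of the volume density in polar coordinates. *)
Definition polar x : R := expR (- k * ln (S x)).
Local Notation W := polar.

Lemma smooth_lnS : smooth_on V (fun x => ln (S x)).
Proof. by apply: smooth_on_ln => // [x _|]; [exact: shS_gt0|exact: smoothV_shS]. Qed.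

Lemma smooth_polar : smooth_on V W.
Proof.
by apply: smooth_on_expR => //; apply: smooth_onM => //; exact: smooth_lnS.
Qed.

Lemma polar_gt0 x : 0 < W x. Proof. exact: expR_gt0. Qed.

Lemma radial_polar : radial x0 W.
Proof.
apply: (@radial_comp expR expR (fun x => - k * ln (S x))) => [x Vx|].
- by apply: smooth_on_diff Vx; apply: smooth_onM => //; exact: smooth_lnS.
apply: (@radialM (fun=> - k) (fun x => ln (S x))) => [x _|x Vx| |]; first exact: differentiable_cst.
- exact: smooth_on_diff smooth_lnS Vx.
- by exists (fun=> 0) => i x _; rewrite partial_cst mul0r.
apply: (@radial_comp (@ln R) GRing.inv S) => [x Vx|x Vx|].
- exact: smooth_on_diff (smoothV_shS hx0) Vx.
- by apply: is_derive1_ln; exact: shS_gt0.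
exact: radial_shS.
Qed.

Lemma Zop_polar x : V x -> Z W x = - (k * w x) * W x.
Proof.
move=> Vx; have dln : differentiable (fun x => ln (S x)) x by exact: smooth_on_diff smooth_lnS Vx.
rewrite (@Zop_comp expR (W x) (fun x => - k * ln (S x)) x _ (is_derive_expR _)).
  rewrite ZopM ?Zop_cst ?mul0r ?add0r//.
  rewrite (@Zop_comp (@ln R) (S x)^-1 S x _ (is_derive1_ln (shS_gt0 x0 x))) ?Zop_shS//.
    by rewrite /cothD; ring.
  exact: smooth_on_diff (smoothV_shS hx0) Vx.
by apply: differentiableM => //; exact: differentiable_cst.
Qed.

Lemma smooth_affD a b : smooth_on V (fun x => a * D x + b).
Proof.
apply: smooth_onD => //.
by apply: smooth_onM => //; exact: smoothV_logD.
Qed.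

Lemma radial_affD a b : radial x0 (fun x => a * D x + b).
Proof.
exists (fun x => a / S x) => i x Vx.
have dD : differentiable D x by exact: smooth_on_diff (smoothV_logD hx0) Vx.
rewrite partialD; [|by apply: differentiableM => //; exact: differentiable_cst|exact: differentiable_cst].
by rewrite partial_cst partialZ// partial_logD//; ring.
Qed.

Lemma Zop_derivatives G n a b x : derivatives G -> V x ->
  Z (fun y => G n (a * D y + b)) x = a * G n.+1 (a * D x + b).
Proof.
move=> dG Vx; rewrite (Zop_comp (f := fun y => a * D y + b) (smooth_on_diff (smooth_affD a b) Vx) (dG n _)).
have dD : differentiable D x by exact: smooth_on_diff (smoothV_logD hx0) Vx.
have daD : differentiable (fun y => a * D y) x by apply: differentiableM => //; exact: differentiable_cst.
rewrite (ZopD _ daD (differentiable_cst _ _)) Zop_cst addr0 ZopM ?Zop_cst ?Zop_logD//; ring.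
Qed.

Lemma smooth_polar_derivatives G n a b : derivatives G ->
  smooth_on V (fun y => W y * G n (a * D y + b)).
Proof.
move=> dG; apply: smooth_onM => //; first exact: smooth_polar.
by apply: (smooth_on_derivatives n _ dG) => //; exact: smooth_affD.
Qed.

(** As Z W = - k coth W, the operator L acts on W g as W times Z g, and Z is the derivative with
    respect to [D]. *)
Lemma Lop_polar_derivatives G n a b x : derivatives G -> V x ->
  L (fun y => W y * G n (a * D y + b)) x = W x * (a * G n.+1 (a * D x + b)).
Proof.
move=> dG Vx; rewrite /Lop ZopM.
- by rewrite Zop_polar// Zop_derivatives// /cothD; ring.
- exact: smooth_on_diff smooth_polar Vx.
- by apply: smooth_on_diff Vx; apply: (smooth_on_derivatives n _ dG) => //; exact: smooth_affD.
Qed.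

End radial_test_functions.

Section positive_integral.
Context {R : realType} {n : nat}.
Local Notation point := 'rV[R]_n.

Lemma Int_gt0 (f : point -> R) (y : point) : cc f -> (forall x, 0 <= f x) -> 0 < f y -> 0 < Int f.
Proof.
move=> ccf f0 fy; have cf := ccf.1 y.
have : \forall x \near y, f y / 2 < f x.
  by apply: (cvgr_gt _ cf); rewrite ltr_pdivrMr//; lra.
move=> /nbhs_ballP[e /= e0 he].
pose b : n.-tuple (measurableTypeR R) := [tuple y 0 i | i < n].
have e20 : 0 < e / 2 by rewrite divr_gt0.
have fb t : tuple_box b (e / 2) t -> f y / 2 <= f (point_of_tuple t).
  move=> bt; apply/ltW/he; split => // i j; rewrite ord1 !mxE /ball/= distrC.
  by apply: (@le_lt_trans _ _ (e / 2)); [have := bt j; rewrite tnth_mktuple|lra].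
rewrite -lte_fin -(Int_EFin ccf).
apply: (@lt_le_trans _ _ (\int[lebesgue_tuple R n]_(t in tuple_box b (e / 2)) (f y / 2)%:E)%E).
  have E : lebesgue_tuple R n (tuple_box b (e / 2)) = ((2 * (e / 2)) ^+ n)%:E.
    by apply: lebesgue_tuple_box; exact: ltW.
  rewrite (integral_cst _ (measurable_tuple_box b (e / 2))).
  suff : (0 < (f y / 2)%:E * lebesgue_tuple R n (tuple_box b (e / 2)))%E by [].
  by rewrite E -EFinM lte_fin mulr_gt0 ?divr_gt0// exprn_gt0// mulr_gt0.
apply: (@le_trans _ _ (\int[lebesgue_tuple R n]_(t in tuple_box b (e / 2)) (f (point_of_tuple t))%:E)%E).
  apply: le_ge0_integral => t bt; rewrite lee_fin; last exact: fb.
  by rewrite divr_ge0// ltW.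
apply: ge0_subset_integral => //; first exact: measurable_tuple_box.
  by apply/measurable_EFinP; apply: measurable_point; exact: ccf.1.
by move=> t _; rewrite lee_fin.
Qed.

End positive_integral.

(** * The plateau and its comparison with bumps having a known primitive *)

Section profile.
Context {R : realType}.
Implicit Types (G : nat -> R -> R) (s t a b : R).

Lemma derivativesS G a : derivatives G -> derivatives (fun n t => a * G n.+1 t).
Proof.
move=> dG n t; have d1 := dG n.+1 t.
have d : is_derive t 1 (fun t => a * G n.+1 t) _ := is_deriveM (is_derive_cst a t 1) d1.
by apply: (is_derive_eq d); rewrite scaler0 addr0.
Qed.

Lemma derivatives_eq0 G (O : set R) n t : derivatives G -> open O ->
  (forall s, O s -> G 0%N s = 0) -> O t -> G n t = 0.
Proof.
move=> dG oO G0; elim: n t => [|n IH] t Ot; first exact: G0.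
have d0 : is_derive t 1 (G n) 0.
  apply: (@near_eq_is_derive R R R (cst 0)).
  by near=> s; rewrite IH//; near: s; exact: open_nbhs_nbhs.
by case: (dG n t) => _ <-; case: d0 => _ ->.
Unshelve. all: by end_near. Qed.

Definition plateau t : R := step t * step (3 - t).

Lemma derivatives_plateau : derivatives (derivs plateau).
Proof.
apply: derivsP; apply: smooth_onM; first exact: openT.
  by apply: smooth_on_step; [exact: openT|exact: smooth_on_coord].
apply: smooth_on_step; first exact: openT.
by apply: smooth_onB; [exact: openT|exact: smooth_on_cst|exact: smooth_on_coord].
Qed.

Lemma plateau_le0 t : t <= 0 -> plateau t = 0.
Proof. by move=> t0; rewrite /plateau step_le0// mul0r. Qed.

Lemma plateau_ge3 t : 3 <= t -> plateau t = 0.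
Proof. by move=> t3; rewrite /plateau (@step_le0 _ (3 - t)) ?mulr0//; lra. Qed.

Lemma plateau1 t : 1 <= t <= 2 -> plateau t = 1.
Proof. by move=> /andP[t1 t2]; rewrite /plateau !step_ge1 ?mulr1//; lra. Qed.

Lemma derivs_plateau_out n t : t < 0 \/ 3 < t -> derivs plateau n t = 0.
Proof.
case=> [t0|t3].
  apply: (@derivatives_eq0 _ [set s | s < 0]) => //; first exact: derivatives_plateau.
  by move=> s /= s0; rewrite derivs0 plateau_le0// ltW.
apply: (@derivatives_eq0 _ [set s | 3 < s]) => //; first exact: derivatives_plateau.
by move=> s /= s0; rewrite derivs0 plateau_ge3// ltW.
Qed.

Local Notation bell := (@step_derivs R 1).

Lemma bell_out t : t <= 0 \/ 1 <= t -> bell t = 0.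
Proof.
rewrite step_derivs1E; case=> [t0|t1]; first by rewrite !(@flat_le0 _ _ t)// !mul0r addr0 mul0r.
by rewrite !(@flat_le0 _ _ (1 - t)) ?subr_le0// !mulr0 addr0 mul0r.
Qed.

(** Squares are dominated by a derivative of a step, whose weighted integral will be independent of
    the scale. The rescaled bump is positive on ]-1, 4[, hence bounded below by a positive constant
    on [0, 3], where the plateau lives. *)
Lemma plateau_derivs_bound : exists2 C : R, 0 <= C &
  forall t, derivs plateau 1 t ^+ 2 + derivs plateau 2 t ^+ 2 <= C * bell ((t + 1) / 5).
Proof.
have mid t : 1 / 5 <= t <= 4 / 5 -> 0 < t < 1.
  by move=> /andP[? ?]; apply/andP; split; lra.
have aff t : 0 <= t <= 3 -> (t + 1) / 5 \in `[1 / 5, 4 / 5].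
  by rewrite in_itv/= => /andP[? ?]; apply/andP; split; lra.
have h15 : 1 / 5 <= 4 / 5 :> R by lra.
pose P t := derivs plateau 1 t ^+ 2 + derivs plateau 2 t ^+ 2.
have P0 t : 0 <= P t by rewrite addr_ge0// sqr_ge0.
have c2 n : continuous (fun t => derivs plateau n t ^+ 2).
  move=> t; apply: (@continuous_comp _ _ _ (derivs plateau n) (fun s => s ^+ 2)); last exact: exprn_continuous.
  exact: derivatives_continuous derivatives_plateau _.
have cP : continuous P by move=> t; exact: (cvgD (c2 1%N t) (c2 2%N t)).
have [u _ uP] := @EVT_max R P 0 3 (ltW (ltr0n _ 3)) (continuous_subspaceT cP).
have [v v15 vP] := @EVT_min R bell (1 / 5) (4 / 5) h15 (continuous_subspaceT (@step_derivs_continuous R 1)).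
have v0 : 0 < bell v by apply/step_derivs1_gt0/mid.
exists (P u / bell v); first by rewrite divr_ge0// ltW.
move=> t; have [t03|] := boolP (0 <= t <= 3); last first.
  rewrite negb_and -!ltNge => t03; rewrite !derivs_plateau_out; [|exact/orP|exact/orP].
  by rewrite expr0n addr0 mulr_ge0 ?step_derivs1_ge0// divr_ge0// ltW.
have h1 : P t <= P u by apply: uP; rewrite in_itv.
have h2 : bell v <= bell ((t + 1) / 5).
  by apply: vP; exact: aff.
apply: (le_trans h1); rewrite -mulrA ler_peMr//.
by rewrite (ler_pdivlMl _ _ v0) mulr1.
Qed.

(** The shifted bump lives on [1, 2], where the plateau is 1. *)
Lemma plateau_lower_bound : exists2 M : R, 0 < M & forall t, bell (t - 1) <= M * plateau t ^+ 2.
Proof.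
have half01 : 0 < (1 / 2 : R) < 1 by apply/andP; split; lra.
have shift t : 1 <= t <= 2 -> t - 1 \in `[0, 1].
  by rewrite in_itv/= => /andP[? ?]; apply/andP; split; lra.
have out t : (t < 1) \/ (2 < t) -> t - 1 <= 0 \/ 1 <= t - 1.
  by case=> ?; [left|right]; lra.
have [u u01 uP] := @EVT_max R bell 0 1 ler01 (continuous_subspaceT (@step_derivs_continuous R 1)).
exists (bell u).
  apply: (lt_le_trans (step_derivs1_gt0 half01)); apply: uP.
  by rewrite in_itv/=; move: half01 => /andP[/ltW -> /ltW ->].
move=> t; have [t12|] := boolP (1 <= t <= 2).
  by rewrite plateau1// expr1n mulr1; apply: uP; exact: shift.
rewrite negb_and -!ltNge => /orP h; rewrite bell_out; last exact: out.
by rewrite mulr_ge0 ?sqr_ge0 ?step_derivs1_ge0.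
Qed.

End profile.

Section profile_inequality.
Context {R : realType}.

(** A pointwise bound for the integrand of [hInt_Rop_sqr] with K = k^2 and c = K + g. Where y = m
    p^2 <= g / 2, the zero-order coefficient is at most (K + y) (y - g) <= - g K / 2; the derivative
    terms are bounded through [b1]. The first alternative covers the region before the plateau,
    where [p] may be large but the profile vanishes. *)
Lemma profile_inequality (W t G0 G1 G2 b1 b2 C M g K m p : R) :
  0 <= C -> 0 < M -> 0 < g -> 0 <= K -> 0 <= m ->
  G1 ^+ 2 + G2 ^+ 2 <= C * b1 -> b2 <= M * G0 ^+ 2 ->
  [/\ G0 = 0, G1 = 0, G2 = 0, 0 <= b1 & b2 = 0] \/ (m * p ^+ 2 <= g / 2 /\ p ^+ 2 <= 1) ->
  (W * (t * (t * G2))) ^+ 2 + (2 * (K + m * p ^+ 2) - (K + g)) * (W * (t * G1)) ^+ 2 +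
    ((K + m * p ^+ 2) * (K + m * p ^+ 2 - (K + g)) - m * (4 * p ^+ 2 + 6 * p ^+ 4)) * (W * G0) ^+ 2 <=
  (t ^+ 4 + (2 * K + 2 * m) * t ^+ 2) * C * (W * (W * b1)) - g * K / (2 * M) * (W * (W * b2)).
Proof.
move=> C0 M0 g0 K0 m0 h1 h2 h3.
have t2 := sqr_ge0 t; have t4 : 0 <= t ^+ 4 by rewrite (exprM t 2 2) sqr_ge0.
have W2 := sqr_ge0 W.
have A0 : 0 <= t ^+ 4 + (2 * K + 2 * m) * t ^+ 2.
  by rewrite addr_ge0// mulr_ge0// addr_ge0// mulr_ge0.
case: h3 => [[-> -> -> b10 ->]|[mp p1]].
  rewrite !(mulr0, expr0n, addr0, subr0)/=.
  by apply: mulr_ge0; [exact: mulr_ge0|rewrite mulrA -expr2; exact: mulr_ge0].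
have e1 : (W * (t * (t * G2))) ^+ 2 = W ^+ 2 * (t ^+ 4 * G2 ^+ 2) by ring.
have e2 : (W * (t * G1)) ^+ 2 = W ^+ 2 * (t ^+ 2 * G1 ^+ 2) by ring.
have e3 : (W * G0) ^+ 2 = W ^+ 2 * G0 ^+ 2 by ring.
have e4 b : W * (W * b) = W ^+ 2 * b by ring.
rewrite e1 e2 e3 !e4 ![_ * (W ^+ 2 * _)]mulrCA -mulrBr -!mulrDr ler_wpM2l//.
have mp1 : m * p ^+ 2 <= m by rewrite ler_piMr.
have mp0 : 0 <= m * p ^+ 2 by rewrite mulr_ge0 ?sqr_ge0.
have a2 : (2 * (K + m * p ^+ 2) - (K + g)) * (t ^+ 2 * G1 ^+ 2) <= (2 * K + 2 * m) * (t ^+ 2 * G1 ^+ 2).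
  by apply: ler_wpM2r; [rewrite mulr_ge0 ?sqr_ge0|lra].
have p4 : 0 <= p ^+ 4 by rewrite (exprM p 2 2) sqr_ge0.
have a3 : (K + m * p ^+ 2) * (K + m * p ^+ 2 - (K + g)) - m * (4 * p ^+ 2 + 6 * p ^+ 4) <= - (g * K / 2).
  have : 0 <= m * (4 * p ^+ 2 + 6 * p ^+ 4).
    by rewrite mulr_ge0// addr_ge0// mulr_ge0// sqr_ge0.
  have : 0 <= m * p ^+ 2 * (g / 2 - m * p ^+ 2) by rewrite mulr_ge0// subr_ge0.
  have : 0 <= K * (g / 2 - m * p ^+ 2) by rewrite mulr_ge0// subr_ge0.
  have : 0 <= m * p ^+ 2 * g by rewrite mulr_ge0// ltW.
  move: (m * (4 * p ^+ 2 + 6 * p ^+ 4)) (m * p ^+ 2) => y z; nra.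
have a4 := ler_wpM2r (sqr_ge0 G0) a3.
have a5 : g * K / (2 * M) * b2 <= g * K / 2 * G0 ^+ 2.
  have -> : g * K / 2 * G0 ^+ 2 = g * K / (2 * M) * (M * G0 ^+ 2) by field; rewrite gt_eqF.
  apply: ler_wpM2l => //; rewrite divr_ge0// ?mulr_ge0//; exact: ltW.
have a6 : (t ^+ 4 + (2 * K + 2 * m) * t ^+ 2) * (G1 ^+ 2 + G2 ^+ 2) <=
    (t ^+ 4 + (2 * K + 2 * m) * t ^+ 2) * C * b1 by rewrite -mulrA ler_wpM2l.
have a7 : 0 <= t ^+ 4 * G1 ^+ 2 by rewrite mulr_ge0 ?sqr_ge0.
have a8 : 0 <= (2 * K + 2 * m) * t ^+ 2 * G2 ^+ 2.
  by rewrite mulr_ge0 ?sqr_ge0// mulr_ge0 ?sqr_ge0// addr_ge0// mulr_ge0.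
move: a2 a4 a5 a6 a7 a8; clear; move: (g * K / (2 * M)) => c; lra.
Qed.

End profile_inequality.

(** * Optimality of the constant *)

Section sharpness.
Context {R : realType} {N : nat}.
Local Notation point := 'rV[R]_N.
Implicit Types (f g u v h : point -> R) (x y : point) (i j : 'I_N) (a b c l C M : R).
Local Notation U := (@Hspace R N).
Local Opaque partial.
Variable x0 : point.
Hypothesis hx0 : U x0.
Hypothesis hN : (4 < N)%N.
Local Notation V := (punctured x0).
Local Notation F := (chF x0).
Local Notation S := (shS x0).
Local Notation D := (logD x0).
Local Notation Z := (Zop x0).
Local Notation L := (Lop x0).
Local Notation k := (@hdim R N).
Local Notation m := (k ^+ 2 - k).
Local Notation p := (rshS x0).
Local Notation w := (cothD x0).
Local Notation W := (polar x0).
Local Notation P := (derivs (@plateau R)).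
Local Notation bell := (@step_derivs R 1).

(** W^2 times the radial derivative of step ((D - a) / l). The difference of two such functions is
    exact: both steps equal 1 far from the pole, so W^2 times their difference has compact
    support. *)
Definition spread a l : point -> R :=
  extend0 x0 (fun x => W x * (W x * (l^-1 * bell (l^-1 * D x + - (l^-1 * a))))).

Lemma affE a l b : l^-1 * b + - (l^-1 * a) = (b - a) / l.
Proof. by rewrite -mulrBr mulrC. Qed.

Lemma ZopB f g x : differentiable f x -> differentiable g x ->
  Z (fun y => f y - g y) x = Z f x - Z g x.
Proof.
move=> df dg; have /eqP := ZopD x0 (differentiableB df dg) dg.
under eq_fun do rewrite subrK.
by rewrite -subr_eq => /eqP ->.
Qed.

Lemma tf_spread a l : 2 <= a -> 0 < l -> tf V (spread a l).
Proof.
move=> a2 l0; apply: (@tf_extend0 _ _ _ hx0 _ a (a + l)) => //.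
  apply: smooth_onM => //; first exact: smooth_polar.
  have := smooth_polar_derivatives hx0 0 l^-1 (- (l^-1 * a)) (derivativesS l^-1 (@step_derivsP R)).
  exact.
move=> x Vx; apply: contra_neqT => h; rewrite affE bell_out ?mulr0//.
move: h; rewrite negb_and -!ltNge => /orP[h|h]; [left|right].
  by rewrite pmulr_lle0 ?invr_gt0//; lra.
by rewrite ler_pdivlMr//; lra.
Qed.

Lemma spread_ge0 a l x : 0 < l -> 0 <= spread a l x.
Proof.
move=> l0; rewrite /spread /extend0; case: ifP => // _.
have W0 := ltW (polar_gt0 x0 x).
by rewrite !mulr_ge0// ?step_derivs1_ge0// invr_ge0 ltW.
Qed.

(* W^2 spreads the derivative of a function of the distance with the constant
   total mass of S^(-2k) against the radial density, whatever the scale. *)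
Lemma hInt_spread a l a' l' : 2 <= a -> 0 < l -> 2 <= a' -> 0 < l' ->
  hInt (spread a l) = hInt (spread a' l').
Proof.
move=> a2 l0 a2' l0'.
pose g a l x := W x * step_derivs 0 (l^-1 * D x + - (l^-1 * a)).
have sg b c : smooth_on V (g b c) by exact: smooth_polar_derivatives (@step_derivsP R).
pose f := extend0 x0 (fun x => W x * (g a l x - g a' l' x)).
have sB : smooth_on V (fun x => g a l x - g a' l' x) by apply: smooth_onB.
have tff : tf V f.
  apply: (@tf_extend0 _ _ _ hx0 _ (Num.min a a') (Num.max (a + l) (a' + l'))).
  - by apply: smooth_onM => //; exact: smooth_polar.
  - by rewrite le_min a2.
  move=> x Vx; apply: contra_neqT => h; rewrite /g -mulrBr !affE step_derivs0.
  move: h; rewrite negb_and -!ltNge => /orP[|].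
    rewrite lt_min => /andP[h h']; rewrite !step_le0 ?subrr ?mulr0//.
      by rewrite pmulr_lle0 ?invr_gt0//; lra.
    by rewrite pmulr_lle0 ?invr_gt0//; lra.
  rewrite gt_max => /andP[h h']; rewrite !step_ge1 ?subrr ?mulr0//.
    by rewrite ler_pdivlMr//; lra.
  by rewrite ler_pdivlMr//; lra.
apply: (hInt_mod (tf_spread a2 l0) (tf_spread a2' l0') (Null_Z hx0 tff)) => x Vx.
have Lg b c : Z (g b c) x + k * (w x * g b c x) = W x * (c^-1 * bell (c^-1 * D x + - (c^-1 * b))).
  exact: (Lop_polar_derivatives hx0 0 c^-1 (- (c^-1 * b)) (@step_derivsP R) Vx).
have Ef : f x = W x * (g a l x - g a' l' x) by exact: extend0_in.
have EZ : Z f x = Z (fun y => W y * (g a l y - g a' l' y)) x by exact: Zop_extend0.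
have Eb b c : spread b c x = W x * (Z (g b c) x + k * (w x * g b c x)).
  by rewrite Lg; exact: extend0_in.
rewrite EZ Ef !Eb.
have dg b c : differentiable (g b c) x by exact: smooth_on_diff (sg b c) Vx.
have dW : differentiable W x by exact: smooth_on_diff (smooth_polar hx0) Vx.
rewrite (ZopM _ dW (smooth_on_diff sB Vx)) (ZopB (dg a l) (dg a' l')) (Zop_polar hx0 Vx).
move: (Z _ x) (Z _ x) (g a l x) (g a' l' x) (W x) (w x) => z z' h h' s t; ring.
Qed.

(** Points near the boundary sphere are far from the pole; the lemma shows that the shells
    supporting test functions can be reached, in every position of the pole. *)
Lemma exists_far r : exists2 y, V y & r <= D y.
Proof.
pose i0 : 'I_N := Ordinal (ltn_trans (isT : 0 < 4)%N hN).
pose e := expR (- (1 + `|r|)).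
have e0 : 0 < e by exact: expR_gt0.
have e1 : e < 1 by rewrite -expR0 ltr_expR oppr_lt0 ltr_pwDl.
(* The sign is opposite to that of the coordinate of the pole, so the scalar product is nonpositive
   and F is at least 1/e. *)
pose c : R := if 0 <= x0 0 i0 then - Num.sqrt (1 - e) else Num.sqrt (1 - e).
have c2 : c ^+ 2 = 1 - e.
  have h : 0 <= 1 - e by rewrite subr_ge0 ltW.
  by rewrite /c; case: ifP => _; rewrite ?sqrrN sqr_sqrtr.
have cx : c * x0 0 i0 <= 0.
  rewrite /c; case: ifPn => h; first by rewrite mulNr oppr_le0 mulr_ge0 ?sqrtr_ge0.
  by rewrite mulr_ge0_le0 ?sqrtr_ge0// ltW// ltNge.
pose y : point := c *: delta_mx 0 i0.
have ny : sqnorm y = 1 - e.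
  rewrite /sqnorm (bigD1 i0)//= big1 ?addr0; first by rewrite !mxE !eqxx mulr1.
  by move=> j /negPf ji; rewrite !mxE ji andbF mulr0 expr0n.
have dy : dot y x0 = c * x0 0 i0.
  rewrite /dot (bigD1 i0)//= big1 ?addr0; first by rewrite !mxE !eqxx mulr1.
  by move=> j /negPf ji; rewrite !mxE ji andbF mulr0 mul0r.
have Uy : U y by rewrite /Hspace/= ny; lra.
have Vy : V y.
  split => //=; apply/eqP => yx; have := dotxx y.
  by rewrite {2}yx dy ny => h; move: cx; rewrite h; lra.
exists y => //.
have s0 : 0 < 1 - sqnorm x0 by exact: Hspace_gt0.
have s1 := sqnorm_ge0 x0.
have Fe : e^-1 <= F y.
  rewrite /chF ny dy ler_pdivlMr; last by rewrite mulr_gt0//; lra.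
  have -> : 1 - (1 - e) = e by ring.
  by rewrite mulKf ?gt_eqF//; nra.
have Fe0 : 0 < e^-1 by rewrite invr_gt0.
rewrite -ler_expR (expR_logD hx0 Vy); apply: (@le_trans _ _ e^-1); last first.
  by rewrite (le_trans Fe)// lerDl ltW// shS_gt0.
rewrite /e -expRN opprK ler_expR (le_trans (ler_norm r))//; lra.
Qed.

Lemma hInt_spread_gt0 a l : 2 <= a -> 0 < l -> 0 < hInt (spread a l).
Proof.
move=> a2 l0; have [y Vy Dy] := exists_far 3.
have b2 : 2 <= D y - 1 by lra.
have two0 : 0 < 2 :> R by [].
(* By scale invariance the shell may be moved so that [y] sits in the middle of the bump, where it
   is positive. *)
rewrite (@hInt_spread _ _ (D y - 1) 2)//.
have tb := tf_spread b2 two0.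
apply: (@Int_gt0 _ _ _ y).
- exact: tf_cc (tf_rho (@open_punctured R N x0) (@puncturedW R N x0) tb).
- move=> x; have [Vx|nV] := pselect (V x); last by rewrite (tf_out tb nV) mulr0.
  by rewrite mulr_ge0 ?spread_ge0// exprn_ge0// ltW// rho_gt0//; exact: puncturedW Vx.
rewrite mulr_gt0//; first by rewrite exprn_gt0// rho_gt0//; exact: puncturedW Vy.
rewrite /spread extend0_in// affE !mulr_gt0 ?polar_gt0// ?invr_gt0//.
apply: step_derivs1_gt0; rewrite opprB addrCA subrr addr0 div1r.
by rewrite invr_gt0 two0/= invf_lt1//; lra.
Qed.

Lemma rellich_rhs_ge0 u : (0 <= rellich_rhs x0 u)%E.
Proof.
have h5 : (5%:R : R) <= N%:R by rewrite ler_nat.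
have v0 x : 0 <= vol_density Hmetric x by exact: sqrtr_ge0.
have I0 f : (forall x, 0 <= f x) -> (0 <= Hint f)%E.
  by move=> f0; apply: integral_ge0 => s _; rewrite lee_fin mulr_ge0.
have h c f : 0 <= c -> (forall x, 0 <= f x) -> (0 <= c%:E * Hint f)%E.
  by move=> c0 f0; apply: mule_ge0; [rewrite lee_fin|exact: I0].
have ev (r : R) : 0 <= r ^+ 4 by rewrite (exprM r 2 2) sqr_ge0.
rewrite /rellich_rhs; apply: adde_ge0; [apply: adde_ge0; [apply: adde_ge0|]|]; apply: h.
- by rewrite divr_ge0 ?sqr_ge0.
- by move=> x; rewrite divr_ge0 ?sqr_ge0.
- by rewrite divr_ge0.
- by move=> x; rewrite divr_ge0 ?sqr_ge0.
- by rewrite divr_ge0// mulr_ge0 ?mulr_ge0//; nra.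
- by move=> x; rewrite divr_ge0 ?sqr_ge0.
- by rewrite divr_ge0// mulr_ge0 ?mulr_ge0//; nra.
- by move=> x; rewrite divr_ge0 ?sqr_ge0.
Qed.

Lemma test_function_tf u : tf U u -> test_function U u.
Proof.
move=> [su [K [cK KU Ku]]].
have clK : closed K by apply: compact_closed => //; exact: norm_hausdorff.
have sK : Defs.support u `<=` K.
  rewrite [K](closure_id _).1//; apply: closureS => x /= ux.
  by apply: contrapT => nK; move: ux; rewrite Ku// eqxx.
split => //; last exact: subset_trans KU.
by apply: (subclosed_compact _ cK) => //; exact: closed_closure.
Qed.

Lemma rellich_lhs_radial c u : tf V u -> radial x0 u ->
  rellich_lhs c u = (hInt (fun x => Rop x0 u x ^+ 2 - c * Z u x ^+ 2))%:E.
Proof.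
move=> tu ru; have tU := tf_punctured tu.
rewrite (rellich_lhs_hInt c tU) (hInt_radial_hlap hx0 tu ru); congr (_%:E).
have tZ : tf V (fun x => Z u x ^+ 2) by apply: tf_sqr; exact: tf_Zop.
have tcZ : tf V (fun x => c * Z u x ^+ 2) by apply: tfM => //.
have tR : tf V (fun x => Rop x0 u x ^+ 2) by apply: tf_sqr; exact: tf_Rop.
have -> : hInt (gp u u) = hInt (fun x => Z u x ^+ 2).
  apply: (@hInt_ext _ _ x0) => //.
    by move=> x Vx; apply/eqP; rewrite expr2 -subr_eq0; apply/eqP; exact: qh_radial ru.
  by apply: tf_gpr => //; exact: tu.1.
by rewrite -(hIntZ c tZ) -(hIntN tcZ) -(hIntD tR (tfN (@open_punctured R N x0) tcZ)).
Qed.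

Lemma Lop_eq f g x : (forall y, V y -> f y = g y) -> V x -> L f x = L g x.
Proof.
by move=> fg Vx; rewrite /Lop /Zop (Yop_open _ (@open_punctured R N x0) Vx fg) fg.
Qed.

Definition wave a l := extend0 x0 (fun x => W x * P 0 (l^-1 * D x + - (l^-1 * a))).

Section wave.
Variables a l : R.
Hypotheses (a2 : 2 <= a) (l0 : 0 < l).

Lemma tf_wave : tf V (wave a l).
Proof.
apply: (@tf_extend0 _ _ _ hx0 _ a (a + 3 * l)) => //.
  by exact: smooth_polar_derivatives (@derivatives_plateau R).
move=> x Vx; apply: contra_neqT => h; rewrite affE derivs0.
move: h; rewrite negb_and -!ltNge => /orP[h|h].
  by rewrite plateau_le0 ?mulr0// pmulr_lle0 ?invr_gt0//; lra.
by rewrite plateau_ge3 ?mulr0// ler_pdivlMr//; lra.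
Qed.

Lemma radial_wave : radial x0 (wave a l).
Proof.
apply: radial_extend0; apply: radialM.
- by move=> x Vx; exact: smooth_on_diff (smooth_polar hx0) Vx.
- move=> x Vx; apply: smooth_on_diff Vx.
  by apply: (smooth_on_derivatives 0 _ (@derivatives_plateau R)) => //; exact: smooth_affD.
- exact: radial_polar.
apply: (@radial_comp _ _ _ (P 0) (P 1)).
- by move=> x Vx; exact: smooth_on_diff (smooth_affD hx0 _ _) Vx.
- by move=> x Vx; exact: derivatives_plateau.
exact: radial_affD.
Qed.

Lemma Lop_wave x : V x ->
  L (wave a l) x = W x * (l^-1 * P 1 (l^-1 * D x + - (l^-1 * a))).
Proof.
move=> Vx; rewrite (Lop_extend0 _ Vx).
exact: (Lop_polar_derivatives hx0 0 l^-1 (- (l^-1 * a)) (@derivatives_plateau R) Vx).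
Qed.

Lemma Lop_Lop_wave x : V x ->
  L (L (wave a l)) x = W x * (l^-1 * (l^-1 * P 2 (l^-1 * D x + - (l^-1 * a)))).
Proof.
move=> Vx; rewrite (Lop_eq Lop_wave Vx).
exact: (Lop_polar_derivatives hx0 0 l^-1 (- (l^-1 * a)) (derivativesS l^-1 (@derivatives_plateau R)) Vx).
Qed.

End wave.

Lemma rshS_le x : V x -> p x <= (D x)^-1.
Proof.
move=> Vx; have D0 := logD_gt0 hx0 Vx.
rewrite /rshS -(sinh_logD hx0 Vx) lef_pV2 ?posrE//; last by rewrite (sinh_logD hx0 Vx) shS_gt0.
exact: le_sinh (ltW D0).
Qed.

(** Cost and gain are expressed by the same mass. With t = (D - a) / l, the bumps at (t + 1) / 5 and
    t - 1 are spreads of origin a - l and a + l and of width 5 l and l, whence the factors 5 l and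
    l. *)
Lemma hInt_wave_le c C M a l : k ^+ 2 < c -> 0 <= C -> 0 < M ->
  (forall t, P 1 t ^+ 2 + P 2 t ^+ 2 <= C * bell ((t + 1) / 5)) ->
  (forall t, bell (t - 1) <= M * plateau t ^+ 2) ->
  0 < l -> l + 2 <= a -> 2 * m <= a * (c - k ^+ 2) ->
  hInt (fun x => Rop x0 (wave a l) x ^+ 2 - c * Z (wave a l) x ^+ 2) <=
  ((l^-1 ^+ 4 + (2 * k ^+ 2 + 2 * m) * l^-1 ^+ 2) * C * (5 * l) -
   (c - k ^+ 2) * k ^+ 2 / (2 * M) * l) * hInt (spread 2 1).
Proof.
move=> kc C0 M0 hC hM l0 la am.
have k2 := @hdim_ge2 R N hN.
have m0 : 0 <= m by nra.
have g0 : 0 <= c - k ^+ 2 by lra.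
have a2 : 2 <= a by lra.
have al2 : 2 <= a - l by lra.
have al2' : 2 <= a + l by lra.
have l50 : 0 < 5 * l by rewrite mulr_gt0.
have tw := tf_wave a2 l0.
have tb1 := tf_spread al2 l50; have tb2 := tf_spread al2' l0.
have oV := @open_punctured R N x0.
have e1 := hInt_spread (lexx 2) ltr01 al2 l50.
have e2 := hInt_spread (lexx 2) ltr01 al2' l0.
have gen (A B h0 h1 h2 : R) : h0 = h1 -> h0 = h2 -> (A - B) * h0 = A * h1 - B * h2.
  by move=> <- <-; rewrite mulrBl.
rewrite (gen _ _ _ _ _ e1 e2) (hInt_Rop_sqr hx0 c tw) -(hIntZ _ tb1) -(hIntZ _ tb2) => {gen e1 e2}.
set A := (_ * C * _); set B := (_ / (2 * M) * l).
have tA : tf V (fun x => A * spread (a - l) (5 * l) x) by apply: tfM => //.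
have tB : tf V (fun x => B * spread (a + l) l x) by apply: tfM => //.
rewrite -(hIntN tB) -(hIntD tA (tfN oV tB)).
have sq : smooth_on V (fun x => k ^+ 2 + m * p x ^+ 2) by exact: smooth_q.
have sp n : smooth_on V (fun x => p x ^+ n) by apply: smooth_onX => //; exact: smooth_rshS.
apply: le_hInt.
- apply: tfD => //; first apply: tfD => //.
  + by apply: tf_sqr; do 2 apply: tf_Lop => //.
  + apply: tfM => //; last by apply: tf_sqr; exact: tf_Lop.
    apply: smooth_onB => //.
    by apply: smooth_onM => //.
  + apply: tfM => //; last exact: tf_sqr.
    apply: smooth_onB => //.
      by apply: smooth_onM => //; apply: smooth_onB => //.
    apply: smooth_onM => //.
    by apply: smooth_onD => //; apply: smooth_onM => //.
- by apply: tfD => //; exact: tfN.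
move=> x Vx; rewrite (Lop_Lop_wave a l Vx) (Lop_wave a l Vx).
pose t := l^-1 * D x + - (l^-1 * a).
have tE : t = (D x - a) / l by exact: affE.
have Ew : wave a l x = W x * P 0 t by exact: extend0_in.
have E1 : A * spread (a - l) (5 * l) x =
    (l^-1 ^+ 4 + (2 * k ^+ 2 + 2 * m) * l^-1 ^+ 2) * C * (W x * (W x * bell ((t + 1) / 5))).
  have -> : spread (a - l) (5 * l) x = W x * (W x * ((5 * l)^-1 * bell ((5 * l)^-1 * D x + - ((5 * l)^-1 * (a - l))))).
    exact: extend0_in.
  have -> : (5 * l)^-1 * D x + - ((5 * l)^-1 * (a - l)) = (t + 1) / 5 by rewrite tE; field; rewrite gt_eqF.
  rewrite /A; move: (bell _) (W x) => b z; field; by rewrite gt_eqF.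
have E2 : B * spread (a + l) l x =
    (c - k ^+ 2) * k ^+ 2 / (2 * M) * (W x * (W x * bell (t - 1))).
  have -> : spread (a + l) l x = W x * (W x * (l^-1 * bell (l^-1 * D x + - (l^-1 * (a + l))))).
    exact: extend0_in.
  have -> : l^-1 * D x + - (l^-1 * (a + l)) = t - 1 by rewrite tE; field; rewrite gt_eqF.
  by rewrite /B; move: (bell _) (W x) => b z; field; rewrite !gt_eqF.
rewrite E1 E2 Ew; clear A B tA tB E1 E2 Ew; have cE : c = k ^+ 2 + (c - k ^+ 2) by ring.
rewrite {1 2}cE; apply: profile_inequality => //.
- by rewrite subr_gt0.
- exact: sqr_ge0.
- by rewrite derivs0; exact: hM.
(* Before [a] the wave vanishes with its derivatives. Beyond it p <= 1/D <= 1/a, and the hypothesis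
   on [a] gives m p^2 <= m p <= (c - k^2) / 2. *)
have [Da|aD] := ltP (D x) a.
  have t0 : t < 0 by rewrite tE pmulr_llt0 ?invr_gt0// subr_lt0.
  left; split; [| | |exact: step_derivs1_ge0|].
  - by apply: derivs_plateau_out; left.
  - by apply: derivs_plateau_out; left.
  - by apply: derivs_plateau_out; left.
  by apply: bell_out; left; rewrite subr_le0 ltW// (lt_trans t0).
right.
have p0 : 0 <= p x by rewrite invr_ge0 ltW// shS_gt0.
have a0 : 0 < a by lra.
have pa : p x * a <= 1.
  rewrite -ler_pdivlMr// div1r (le_trans (rshS_le Vx))// lef_pV2// posrE//; lra.
have p1 : p x <= 1 by nra.
have pp : p x ^+ 2 <= p x by nra.
split; last by lra.
have h1 : m * p x ^+ 2 <= m * p x by rewrite ler_wpM2l.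
have h2 := ler_wpM2r p0 am.
have h3 := ler_wpM2r g0 pa.
move: h1 h2 h3; move: (p x ^+ 2) (p x) (c - k ^+ 2) m => ? ? ? ?; lra.
Qed.

Lemma exists_negative_wave c : k ^+ 2 < c ->
  exists2 u, test_function U u & (rellich_lhs c u < 0)%E.
Proof.
move=> kc; have [C C0 hC] := @plateau_derivs_bound R; have [M M0 hM] := @plateau_lower_bound R.
have k2 := @hdim_ge2 R N hN.
have m0 : 0 <= m by nra.
pose g := c - k ^+ 2; have g0 : 0 < g by rewrite subr_gt0.
have gk : 0 < g * k ^+ 2 by rewrite mulr_gt0// exprn_gt0//; lra.
pose Q := 2 * k ^+ 2 + 2 * m; have Q0 : 0 <= Q by rewrite addr_ge0// mulr_ge0// sqr_ge0.
(* The cost is at most 5 C (1 + Q) once l >= 1, and [l] is chosen so that this equals the gain per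
   unit length, g k^2 / (2 M), times l - 1. *)
pose l := 1 + 10 * M * C * (1 + Q) / (g * k ^+ 2).
have l1 : 1 <= l.
  rewrite lerDl divr_ge0//; last exact: ltW.
  by rewrite !mulr_ge0//; [exact: ltW|rewrite addr_ge0].
have l0 : 0 < l by exact: lt_le_trans l1.
(* Large enough for the two requirements of [hInt_wave_le]: a - l >= 2 and a g >= 2 m. *)
pose a := l + 2 + 2 * m / g.
have mg0 : 0 <= 2 * m / g by rewrite divr_ge0 ?mulr_ge0// ltW.
have aE : a = l + 2 + 2 * m / g by [].
have lE : l = 1 + 10 * M * C * (1 + Q) / (g * k ^+ 2) by [].
have la : l + 2 <= a by rewrite lerDl.
have am : 2 * m <= a * g.
  have -> : a * g = (l + 2) * g + 2 * m by rewrite aE; field; rewrite gt_eqF.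
  by rewrite lerDr mulr_ge0 ?ltW// addr_gt0.
clearbody a l.
have a2 : 2 <= a by lra.
have tw := tf_wave a2 l0.
have tU := tf_punctured tw.
exists (wave a l); first exact: test_function_tf.
rewrite (rellich_lhs_radial c tw (radial_wave a l)) lte_fin.
apply: (le_lt_trans (hInt_wave_le kc C0 M0 hC hM l0 la am)).
rewrite (pmulr_llt0 _ (hInt_spread_gt0 (lexx 2) ltr01)) subr_lt0.
have V1 : l^-1 <= 1 by rewrite invf_le1.
have V0 : 0 < l^-1 by rewrite invr_gt0.
apply: (@le_lt_trans _ _ (5 * C * (1 + Q))).
  have -> : (l^-1 ^+ 4 + Q * l^-1 ^+ 2) * C * (5 * l) = 5 * C * (l^-1 ^+ 3 + Q * l^-1).
    by field; rewrite gt_eqF.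
  rewrite ler_wpM2l ?mulr_ge0// lerD ?exprn_ile1 ?(ltW V0)// ler_piMr//.
have -> : 5 * C * (1 + Q) = g * k ^+ 2 / (2 * M) * (l - 1).
  by rewrite lE addrAC subrr add0r; move: (g * k ^+ 2) gk => s s0; field; rewrite !gt_eqF.
rewrite ltr_pM2l; first by rewrite ltrBlDr ltrDl.
by rewrite divr_gt0// mulr_gt0.
Qed.

End sharpness.

Theorem theorem1p1 (R : realType) (N : nat) (hN : (4 < N)%N)
    (x0 : 'rV[R]_N) (hx0 : Hspace x0) :
  (forall u : 'rV[R]_N -> R, test_function Hspace u ->
     (rellich_rhs x0 u <= rellich_lhs (((N%:R - 1) / 2) ^+ 2) u)%E) /\
  (forall c : R, ((N%:R - 1) / 2) ^+ 2 < c ->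
     ~ (forall u : 'rV[R]_N -> R, test_function Hspace u ->
          (rellich_rhs x0 u <= rellich_lhs c u)%E)).
Proof.
split=> [u tu|c kc H]; first exact: rellich_le.
have [u tu lu] := exists_negative_wave hx0 hN kc.
have := le_lt_trans (H u tu) lu.
by rewrite ltNge rellich_rhs_ge0.
Qed.
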